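(* Let $(g_n)_{n\in\mathbb{N}}$ be a sequence of functions in $H^\infty$. The following three conditions are equivalent: (i) There exists a weak*-continuous linear map $T:\ell^\infty\to H^\infty$ such that $T\epsilon_j=g_j$ for all $j\in\mathbb{N}$. (ii) $M:=\sup_{z\in\mathbb{D}}\sum_{n\in\mathbb{N}}|g_n(z)|<\infty$. (iii) There exists a Borel subset $B$ of $\mathbb{T}$ of full measure (i.e. $m(B)=1$), at each point of which all the $g_n$ have nontangential limits, such that $\tilde M:=\sup_{z\in B}\sum_{n\in\mathbb{N}}|g_n(z)|<\infty$. When these conditions are fulfilled we have $T=S^*$, where $S:L^1/H^1_0\to\ell^1$ is the bounded linear map defined by $[f]\mapsto\left(\int_{\mathbb{T}}fg_n\,dm\right)_{n\in\mathbb{N}}$, and $M=\tilde M=\|S\|=\|T\|$. Furthermore, in case the $g_n$ all belong to the disk algebra $A(\mathbb{D})$, these conditions are equivalent to (ii)' $M_1:=\sup_{z\in\mathbb{T}}\sum_{n\in\mathbb{N}}|g_n(z)|<\infty$, and then $M_1=M$.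
   Context: $\mathbb{D}$ is the open unit disk, $\mathbb{T}$ the unit circle, $m$ normalized Lebesgue measure on $\mathbb{T}$, $L^1=L^1(m)$. $A(\mathbb{D})$ is the disk algebra: functions continuous on $\overline{\mathbb{D}}$ and analytic in $\mathbb{D}$. $H^\infty$ is the Banach algebra of bounded analytic functions on $\mathbb{D}$ with the sup norm, identified via nontangential boundary values with a weak*-closed subspace of $L^\infty(m)=(L^1)^*$; for $g\in H^\infty$ and $z\in\mathbb{T}$, $g(z)$ denotes the nontangential limit of $g$ at $z$ (when it exists). $H^1_0$ is the space of functions in the Hardy space $H^1$ vanishing at $0$; it is the preannihilator of $H^\infty$, so $H^\infty=(L^1/H^1_0)^*$ under the bilinear pairing $\langle[f],h\rangle=\int_{\mathbb{T}}fh\,dm$, where $[f]$ is the class of $f\in L^1$. The weak* topology on $H^\infty$ is the one from this duality, and on $\ell^\infty$ the one from $\ell^\infty=(\ell^1)^*$ (bilinear pairing). $\epsilon_j=(\delta_{j,k})_{k\in\mathbb{N}}$ denotes the $j$-th canonical unit sequence. *)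

(* Defs.v *)
From HB Require Import structures.
From mathcomp Require Import all_boot all_order all_algebra.
From mathcomp Require Import ring_quotient complex.
From mathcomp Require Import all_classical all_reals all_analysis.
From mathcomp Require Import measurable_realfun.

Set Implicit Arguments.
Unset Strict Implicit.
Unset Printing Implicit Defensive.

Import Order.TTheory GRing.Theory Num.Theory.
Import numFieldNormedType.Exports.
Import Normc.

Local Open Scope classical_set_scope.
Local Open Scope ring_scope.
Local Open Scope complex_scope.

HB.instance Definition _ (R : rcfType) := NormedModule.copy R[i] R[i]^o.

Section ComplexTopology.
Variable R : realType.
Implicit Types (z w : R[i]) (x : R).

Lemma normrE_normc z : `|z| = (normc z)%:C.
Proof. by []. Qed.

Lemma normc_ge0 z : 0 <= normc z.
Proof. by case: z => a b; exact: sqrtr_ge0. Qed.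

Lemma normc_real x : normc x%:C = `|x|.
Proof. by rewrite /normc /= expr0n /= addr0 sqrtr_sqr. Qed.

Lemma real_complex_continuous : continuous (fun x : R => x%:C : R[i]).
Proof.
move=> x; apply/cvgrPdist_lt => /= e e0.
have er : 0 < complex.Re e by move: e0; rewrite ltcE => /andP[_]; exact.
have eE : e = (complex.Re e)%:C.
  by move: e0; rewrite ltcE => /andP[/eqP]; case: (e) => a b /= -> _.
have : \forall t \near x, `|x - t| < complex.Re e by exact: nbhsx_ballx.
by apply: filterS => t; rewrite eE -rmorphB normrE_normc normc_real ltcR.
Qed.

Lemma normc_continuous : continuous (@normc R : R[i] -> R).
Proof.
move=> z; set F := nbhs z; have FF : Filter F by exact: nbhs_filter.
apply/(@cvgrPdist_lt _ _ _ F FF) => e e0.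
have e0' : 0 < e%:C by rewrite ltcR.
have nz : F (fun w => `|z - w| < e%:C) by exact: nbhsx_ballx.
apply: (@filterS _ F FF _ _ _ nz) => w.
rewrite normrE_normc ltcR => h.
apply: le_lt_trans h.
have hh u v : normc u <= normc (u - v) + normc v.
  by rewrite -[in leLHS](subrK v u) le_normcD.
rewrite ler_norml lerBlDr lerBrDr hh andbT addrC lerBlDr addrC.
by rewrite -[normc (z - w)]normcN opprB hh.
Qed.

End ComplexTopology.

Definition unit_disk (R : realType) : set R[i] := [set z | normc z < 1].
Definition unit_circle (R : realType) : set R[i] := [set z | normc z = 1].

Definition borelC (R : realType) := g_sigma_algebraType (@open R[i]).

Definition expi2pi (R : realType) (t : R) : borelC R :=
  cos (2 * pi * t) +i* sin (2 * pi * t).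

Section CircleMeasure.
Variable R : realType.

Lemma continuous_expi2pi : continuous (@expi2pi R : R -> R[i]).
Proof.
have -> : (@expi2pi R : R -> R[i]) =
    fun t => (cos (2 * pi * t))%:C + (Complex 0 1) * (sin (2 * pi * t))%:C.
  apply/funext => t; rewrite /expi2pi; apply/eqP.
  by rewrite eq_complex /= !(mul0r, mulr0, mul1r, subr0, addr0, add0r) !eqxx.
move=> t; have ct : (2 * pi * x : R) @[x --> t] --> 2 * pi * t.
  by apply: cvgM; [exact: cvg_cst|exact: cvg_id].
have cC (f : R -> R) : continuous f ->
    ((f (2 * pi * x))%:C : R[i]) @[x --> t] --> ((f (2 * pi * t))%:C : R[i]).
  move=> cf; have cft : f (2 * pi * x) @[x --> t] --> f (2 * pi * t).
    exact: (cvg_comp _ _ ct (cf _)).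
  exact: (cvg_comp _ _ cft (@real_complex_continuous R _)).
apply: cvgD; first exact/cC/continuous_cos.
by apply: cvgM; [exact: cvg_cst|exact/cC/continuous_sin].
Qed.

Lemma measurable_openC (A : set R[i]) : open A ->
  measurable (A : set (borelC R)).
Proof. exact: sub_sigma_algebra. Qed.

Lemma measurable_expi2pi : measurable_fun [set: R] (@expi2pi R).
Proof.
apply: (measurability _ (erefl (@measurable _ (borelC R)))).
move=> _ [A oA <-]; rewrite setTI; apply: open_measurable.
by apply: open_comp => // t _; exact: continuous_expi2pi.
Qed.

(* Normalized Lebesgue measure on the unit circle, as a Borel measure on the  *)
(* complex plane: the image of Lebesgue measure on [0, 1] by                  *)
(* t |-> exp (2 pi i t).                                                      *)
Definition circle_measure : set (borelC R) -> \bar R :=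
  pushforward (mrestr lebesgue_measure (measurable_itv `[0%R, 1%R]))
    (@expi2pi R).

Let circle_measure0 : circle_measure set0 = 0%E.
Proof. by rewrite /circle_measure /pushforward preimage_set0 measure0. Qed.

Let circle_measure_ge0 A : (0 <= circle_measure A)%E.
Proof. by rewrite /circle_measure /pushforward; apply: measure_ge0. Qed.

Let circle_measure_sigma_additive : semi_sigma_additive circle_measure.
Proof.
pose mu := mrestr (@lebesgue_measure R) (measurable_itv `[0%R, 1%R]).
have := @measure_semi_sigma_additive _ _ _
  (measure_function_pushforward__canonical__measure_function_Measure
     mu measurable_expi2pi).
exact.
Qed.

HB.instance Definition _ := isMeasure.Build _ _ _ circle_measure
  circle_measure0 circle_measure_ge0 circle_measure_sigma_additive.

Let circle_measure_setT : circle_measure [set: _] = 1%E.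
Proof.
rewrite /circle_measure /pushforward preimage_setT /mrestr setTI.
by rewrite lebesgue_measure_itv /= lte_fin ltr01 oppr0 adde0.
Qed.

HB.instance Definition _ :=
  Measure_isProbability.Build _ _ _ circle_measure circle_measure_setT.

Lemma measurable_unit_circle :
  measurable (@unit_circle R : set (borelC R)).
Proof.
rewrite -[X in measurable X]setCK; apply: measurableC; apply: measurable_openC.
rewrite openC -[X in closed X]/(@normc R @^-1` [set 1]).
apply: preimage_closed; last exact: closed_eq.
by move=> z _; exact: normc_continuous.
Qed.

End CircleMeasure.

Section Definitions.
Variable R : realType.
Local Notation C := R[i].
Local Notation D := (@unit_disk R).
Local Notation T := (@unit_circle R).
Local Notation m := (@circle_measure R).

Definition analytic_in_disk (F : C -> C) := forall z, D z -> derivable F z 1.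

Definition stolz_region (a : R) (z : C) : set C :=
  [set w | D w /\ normc (w - z) < a * (1 - normc w)].

Definition has_ntlim (F : C -> C) (z l : C) :=
  forall a : R, 1 < a -> F w @[w --> within (stolz_region a z) (nbhs z)] --> l.

(* The nontangential limit of F at z, and 0 when it does not exist. *)
Definition ntlim (F : C -> C) (z : C) : C := xget 0 [set l | has_ntlim F z l].

Definition circle_integrable (f : C -> C) :=
  m.-integrable T (fun z : borelC R => (complex.Re (f z))%:E) /\
  m.-integrable T (fun z : borelC R => (complex.Im (f z))%:E).

Definition circle_integral (f : C -> C) : C :=
  Rintegral m T (fun z : borelC R => complex.Re (f z)) +i*
  Rintegral m T (fun z : borelC R => complex.Im (f z)).

Definition disk_algebra (F : C -> C) :=
  {within [set z : C | normc z <= 1], continuous F} /\ analytic_in_disk F.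

Definition hardy1 (F : C -> C) :=
  analytic_in_disk F /\
  (ereal_sup [set \int[m]_(z in T) (normc (F (r%:C * z)))%:E
             | r in [set r : R | (0 <= r < 1)%R]] < +oo)%E.

End Definitions.

Section SequenceSpaces.
Variable R : realType.

Definition bounded_seq : {pred nat -> R[i]} :=
  [pred u | `[< exists M : R, forall n, normc (u n) <= M >]].

Definition summable_seq : {pred nat -> R[i]} :=
  [pred v | `[< (\sum_(n <oo) (normc (v n))%:E < +oo)%E >]].

Fact bounded_seq_submod : submod_closed bounded_seq.
Proof.
split; first by apply/asboolP; exists 0 => n; rewrite normc0.
move=> a u v /asboolP[M uM] /asboolP[N vN]; apply/asboolP.
exists (normc a * M + N) => n; apply: le_trans (le_normcD _ _) _.
by rewrite lerD// normcM ler_wpM2l// normc_ge0.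
Qed.

Fact summable_seq_submod : submod_closed summable_seq.
Proof.
split.
  by apply/asboolP; rewrite eseries0// => n _ _; rewrite normc0.
move=> a u v /asboolP su /asboolP sv; apply/asboolP.
have n0 w n : (0 <= (normc (w n : R[i]))%:E)%E by rewrite lee_fin normc_ge0.
have n1 n : (0 <= (normc a)%:E * (normc (u n))%:E)%E.
  by rewrite mule_ge0// lee_fin normc_ge0.
apply: (@le_lt_trans _ _
  (\sum_(n <oo) ((normc a)%:E * (normc (u n))%:E + (normc (v n))%:E))%E).
  apply: lee_nneseries => [n _ _|n _]; first by rewrite lee_fin normc_ge0.
  by rewrite -EFinM -EFinD lee_fin; apply: le_trans (le_normcD _ _) _;
    rewrite normcM.
rewrite nneseriesD; [|by move=> n _ _; exact: n1|by move=> n _ _; exact: n0].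
by rewrite nneseriesZl// lte_add_pinfty// lte_mul_pinfty// lee_fin normc_ge0.
Qed.

HB.instance Definition _ :=
  GRing.isSubmodClosed.Build R[i] (nat -> R[i]) bounded_seq bounded_seq_submod.
HB.instance Definition _ :=
  GRing.isSubmodClosed.Build R[i] (nat -> R[i]) summable_seq
    summable_seq_submod.

Record linf := Linf { linf_val :> nat -> R[i]; _ : linf_val \in bounded_seq }.
HB.instance Definition _ := [isSub for linf_val].
HB.instance Definition _ := [Choice of linf by <:].
HB.instance Definition _ := [SubChoice_isSubLmodule of linf by <:].

Record l1 := L1seq { l1_val :> nat -> R[i]; _ : l1_val \in summable_seq }.
HB.instance Definition _ := [isSub for l1_val].
HB.instance Definition _ := [Choice of l1 by <:].
HB.instance Definition _ := [SubChoice_isSubLmodule of l1 by <:].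

Fact unit_seq_bounded (j : nat) :
  (fun k => (k == j)%:R) \in bounded_seq.
Proof.
apply/asboolP; exists 1 => k.
by case: eqP => _; rewrite ?normc1 ?normc0.
Qed.

Definition unit_seq (j : nat) : linf := Linf (unit_seq_bounded j).

Definition linf_norm (u : linf) : \bar R :=
  ereal_sup (range (fun n => (normc (u n))%:E)).

Definition l1_norm (v : l1) : \bar R := (\sum_(n <oo) (normc (v n))%:E)%E.

Definition l1_pairing (v : l1) (u : linf) : R[i] :=
  limn (series (fun n => v n * u n)).

(* l^oo with its weak* topology, that of pointwise convergence on l^1. *)
Definition weakstar_linf := initial_topology
  (fun u : linf => (fun v => l1_pairing v u) : {ptws l1 -> R[i]}).

End SequenceSpaces.

Section FunctionSpaces.
Variable R : realType.
Local Notation C := R[i].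
Local Notation D := (@unit_disk R).
Local Notation T := (@unit_circle R).
Local Notation m := (@circle_measure R).

(* Functions on the disk are represented by their extension by 0 to the plane,*)
(* so that equality in Hinf is equality of functions on the disk.             *)
Definition Hinf_fun : {pred C -> C} :=
  [pred h | `[< [/\ analytic_in_disk h,
                    exists M : R, forall z, D z -> normc (h z) <= M &
                    forall z, ~ D z -> h z = 0] >]].

Fact analytic_lin (a : C) (F G : C -> C) : analytic_in_disk F ->
  analytic_in_disk G -> analytic_in_disk (a *: F + G).
Proof.
by move=> aF aG z Dz; apply: derivableD; [apply: derivableZ; exact: aF|exact: aG].
Qed.

Fact Hinf_submod : submod_closed Hinf_fun.
Proof.
split.
  by apply/asboolP; split=> //; exists 0 => z _; rewrite normc0.
move=> a F G /asboolP[aF [M FM] F0] /asboolP[aG [N GN] G0]; apply/asboolP.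
split; first exact: analytic_lin.
  exists (normc a * M + N) => z Dz; apply: le_trans (le_normcD _ _) _.
  by rewrite lerD ?GN// normcM ler_wpM2l ?FM// normc_ge0.
move=> z Dz; rewrite -[LHS]/(a * F z + G z).
by rewrite F0// G0// mulr0 addr0.
Qed.

HB.instance Definition _ :=
  GRing.isSubmodClosed.Build C (C -> C) Hinf_fun Hinf_submod.

Record Hinf := MkHinf { Hinf_val :> C -> C; _ : Hinf_val \in Hinf_fun }.
HB.instance Definition _ := [isSub for Hinf_val].
HB.instance Definition _ := [Choice of Hinf by <:].
HB.instance Definition _ := [SubChoice_isSubLmodule of Hinf by <:].

Definition Hinf_norm (h : Hinf) : \bar R :=
  ereal_sup [set (normc (h z))%:E | z in D].

Definition L1_fun : {pred C -> C} := [pred f | `[< circle_integrable f >]].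

Fact integrable_lin (a b : R) (f g h : C -> R) :
  m.-integrable T (fun z : borelC R => (f z)%:E) ->
  m.-integrable T (fun z : borelC R => (g z)%:E) ->
  m.-integrable T (fun z : borelC R => (h z)%:E) ->
  m.-integrable T (fun z : borelC R => (a * f z + b * g z + h z)%:E).
Proof.
move=> fi gi hi; have mT := @measurable_unit_circle R.
have := integrableD mT (integrableD mT (integrableZl mT a fi)
  (integrableZl mT b gi)) hi.
exact.
Qed.

Fact L1_submod : submod_closed L1_fun.
Proof.
split; first by apply/asboolP; split; exact: integrable0.
move=> a f g /asboolP[fr fi] /asboolP[gr gi]; apply/asboolP; split.
  have := integrable_lin (complex.Re a) (- complex.Im a) fr fi gr.
  congr (_.-integrable _ _); apply/funext => z; congr EFin.
  rewrite -[(a *: f + g) z]/(a * f z + g z).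
  by case: a (f z) (g z) => [a1 a2] [b1 b2] [c1 c2] /=; rewrite mulNr.
have := integrable_lin (complex.Re a) (complex.Im a) fi fr gi.
congr (_.-integrable _ _); apply/funext => z; congr EFin.
rewrite -[(a *: f + g) z]/(a * f z + g z).
by case: a (f z) (g z) => [a1 a2] [b1 b2] [c1 c2].
Qed.

HB.instance Definition _ :=
  GRing.isSubmodClosed.Build C (C -> C) L1_fun L1_submod.

(* Integrable functions on the circle, before identification of functions     *)
(* that are equal almost everywhere.                                          *)
Record L1 := MkL1 { L1_val :> C -> C; _ : L1_val \in L1_fun }.
HB.instance Definition _ := [isSub for L1_val].
HB.instance Definition _ := [Choice of L1 by <:].
HB.instance Definition _ := [SubChoice_isSubLmodule of L1 by <:].

Definition L1_norm (f : L1) : \bar R :=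
  (\int[m]_(z in T) (normc (f z))%:E)%E.

(* H^1_0 as a subspace of L^1, through nontangential boundary values. It      *)
(* contains the functions vanishing almost everywhere (take F := 0), so the   *)
(* quotient by H10 also identifies functions equal almost everywhere.         *)
Definition H10 : {pred L1} :=
  [pred f : L1 | `[< exists F : C -> C, [/\ hardy1 F, F 0 = 0 &
    {ae m, forall z : borelC R, T z -> has_ntlim F z (f z)}] >]].

End FunctionSpaces.

Section HardySubspace.
Variable R : realType.
Local Notation C := R[i].
Local Notation D := (@unit_disk R).
Local Notation T := (@unit_circle R).
Local Notation m := (@circle_measure R).

Fact measurable_dilation (F : C -> C) (r : R) : analytic_in_disk F ->
  (0 <= r < 1)%R ->
  measurable_fun (T : set (borelC R)) ((fun z => (normc (F (r%:C * z)))%:E) : borelC R -> \bar R).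
Proof.
move=> aF /andP[r0 r1]; pose k (z : C) : R := normc (F (r%:C * z)).
pose U : set C := [set z | normc (r%:C * z) < 1].
have cr (z : C) : r%:C * w @[w --> z] --> r%:C * z by exact: mulrl_continuous.
have cU : continuous (fun z : C => normc (r%:C * z)).
  by move=> z; exact: (cvg_comp _ _ (cr z) (@normc_continuous R _)).
have ck z : U z -> k w @[w --> z] --> k z.
  move=> Uz; have cF : F w @[w --> r%:C * z] --> F (r%:C * z).
    by apply/differentiable_continuous/derivable1_diffP; exact: aF.
  exact: (cvg_comp _ _ (cvg_comp _ _ (cr z) cF) (@normc_continuous R _)).
have oU : open U.
  rewrite -[U]/((fun z : C => normc (r%:C * z)) @^-1` [set x | x < 1]).
  by apply: open_comp; [move=> z _; exact: cU|exact: open_lt].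
apply/measurable_EFinP; apply: (@measurable_funS _ _ _ _ (U : set (borelC R))).
- exact: measurable_openC.
- move=> z /= Tz; rewrite /U /= normcM normc_real Tz mulr1 ger0_norm//.
apply: (measurability _ (RGenOInfty.measurableE R)).
move=> _ [_ [x ->] <-]; apply: measurable_openC.
rewrite openE => z [Uz kz]; apply: filterI; first exact: open_nbhs_nbhs.
apply: (ck z Uz); apply: open_nbhs_nbhs; split; first exact: interval_open.
exact: kz.
Qed.

Fact hardy1_lin (a : C) (F G : C -> C) : hardy1 F -> hardy1 G ->
  hardy1 (a *: F + G).
Proof.
move=> [aF bF] [aG bG]; split; first exact: analytic_lin.
set SF := ereal_sup _ in bF; set SG := ereal_sup _ in bG.
have n0 w : (0 <= (normc (w : C))%:E)%E by rewrite lee_fin normc_ge0.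
have SF0 : (0 <= SF)%E.
  apply: le_trans (ereal_sup_ubound _) => /=; last first.
    by exists 0 => //; rewrite lexx ltr01.
  by apply: integral_ge0 => z _; exact: n0.
apply: (@le_lt_trans _ _ ((normc a)%:E * SF + SG)%E); last first.
  by rewrite lte_add_pinfty// lte_mul_pinfty.
apply: ge_ereal_sup => _ [r r01 <-].
have mT := @measurable_unit_circle R.
have mF := measurable_dilation aF r01; have mG := measurable_dilation aG r01.
have mH := measurable_dilation (analytic_lin (a := a) aF aG) r01.
have maF : measurable_fun (T : set (borelC R))
    ((fun z => (normc a)%:E * (normc (F (r%:C * z)))%:E)%E : borelC R -> \bar R).
  exact: measurable_funeM.
apply: (@le_trans _ _ (\int[m]_(z in T)
  ((normc a)%:E * (normc (F (r%:C * z)))%:E + (normc (G (r%:C * z)))%:E))%E).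
  apply: ge0_le_integral => //.
  - by apply: emeasurable_funD.
  - move=> z _; rewrite -EFinM -EFinD lee_fin.
    by apply: le_trans (le_normcD _ _) _; rewrite normcM.
rewrite ge0_integralD//; last first.
  by move=> z _; rewrite mule_ge0.
rewrite ge0_integralZl//.
apply: leeD; last by apply: ereal_sup_ubound; exists r.
by apply: lee_wpmul2l => //; apply: ereal_sup_ubound; exists r.
Qed.

Fact has_ntlim_lin (a : C) (F G : C -> C) z k l :
  has_ntlim F z k -> has_ntlim G z l -> has_ntlim (a *: F + G) z (a * k + l).
Proof.
move=> Fk Gl s s1; apply: cvgD; last exact: Gl.
by apply: cvgM; [exact: cvg_cst|exact: Fk].
Qed.

Fact H10_submod : submod_closed (@H10 R).
Proof.
split.
  apply/asboolP; exists 0; split=> //.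
    split; first by move=> z Dz; exact: derivable_cst.
    apply: (@le_lt_trans _ _ 0%E) => //; apply: ge_ereal_sup => _ [r _ <-].
    by rewrite integral0_eq// => z _; rewrite normc0.
  by apply: aeW => z _ s s1; exact: cvg_cst.
move=> a f g /asboolP[F [hF F0 Ff]] /asboolP[G [hG G0 Gg]]; apply/asboolP.
exists (a *: F + G); split; first exact: hardy1_lin.
  by rewrite -[LHS]/(a * F 0 + G 0) F0 G0 mulr0 addr0.
apply: filterS2 Ff Gg => z Ffz Ggz Tz.
exact: has_ntlim_lin (Ffz Tz) (Ggz Tz).
Qed.

HB.instance Definition _ :=
  GRing.isSubmodClosed.Build C (L1 R) (@H10 R) H10_submod.

End HardySubspace.

Section Predual.
Variable R : realType.
Local Notation C := R[i].
Local Notation T := (@unit_circle R).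

Local Open Scope quotient_scope.

Definition L1_H10 : Type := Quotient.quot (@H10 R).

HB.instance Definition _ := GRing.Zmodule.on L1_H10.
HB.instance Definition _ := Quotient.on L1_H10.

Definition L1_class (f : L1 R) : L1_H10 := \pi_L1_H10 f.

Definition L1_H10_scale (a : C) : L1_H10 -> L1_H10 :=
  fun x => L1_class (a *: repr x).

Fact L1_class_eq (f g : L1 R) :
  (L1_class f == L1_class g) = (f - g \in @H10 R).
Proof. exact/esym/Quotient.idealrBE. Qed.

Fact L1_classD (f g : L1 R) : L1_class (f + g) = L1_class f + L1_class g.
Proof. exact: (Quotient.pi_add (@H10 R)). Qed.

Fact L1_classZ (a : C) (f : L1 R) :
  L1_class (a *: f) = L1_H10_scale a (L1_class f).
Proof.
apply/eqP; rewrite L1_class_eq -scalerBr rpredZ// -L1_class_eq.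
by rewrite [X in _ == X]reprK.
Qed.

Fact L1_H10_scaleA a b x :
  L1_H10_scale a (L1_H10_scale b x) = L1_H10_scale (a * b) x.
Proof.
by rewrite -[x]reprK -!/(L1_class _) -!L1_classZ scalerA.
Qed.

Fact L1_H10_scale1 : left_id 1 L1_H10_scale.
Proof. by move=> x; rewrite -[x]reprK -!/(L1_class _) -L1_classZ scale1r. Qed.

Fact L1_H10_scaleDr : right_distributive L1_H10_scale +%R.
Proof.
move=> a x y; rewrite -[x]reprK -[y]reprK -!/(L1_class _).
by rewrite -L1_classD -!L1_classZ scalerDr L1_classD.
Qed.

Fact L1_H10_scaleDl x : {morph L1_H10_scale^~ x : a b / a + b}.
Proof.
move=> a b; rewrite -[x]reprK -!/(L1_class _).
by rewrite -!L1_classZ scalerDl L1_classD.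
Qed.

HB.instance Definition _ := GRing.Zmodule_isLmodule.Build C L1_H10
  L1_H10_scaleA L1_H10_scale1 L1_H10_scaleDr L1_H10_scaleDl.

Definition L1_H10_norm (x : L1_H10) : \bar R :=
  ereal_inf [set L1_norm f | f in [set f | L1_class f = x]].

Definition H_pairing (f : L1 R) (h : Hinf R) : C :=
  circle_integral (fun z => f z * ntlim h z).

(* H^oo with its weak* topology: as <[f], h> only depends on the class of f,  *)
(* that of pointwise convergence on L^1.                                      *)
Definition weakstar_Hinf := initial_topology
  (fun h : Hinf R => (fun f => H_pairing f h) : {ptws L1 R -> C}).

End Predual.

Definition op_norm (R : realType) (V W : Type)
    (normV : V -> \bar R) (normW : W -> \bar R) (f : V -> W) : \bar R :=
  ereal_sup [set normW (f x) | x in [set x | (normV x <= 1)%E]].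

Definition bounded_map (R : realType) (V W : Type)
    (normV : V -> \bar R) (normW : W -> \bar R) (f : V -> W) : Prop :=
  exists K : R, forall x, (normW (f x) <= K%:E * normV x)%E.

Definition weakstar_continuous (R : realType) (U : linf R -> Hinf R) : Prop :=
  continuous (U : weakstar_linf R -> weakstar_Hinf R).

(* U = S^* for the dualities l^oo = (l^1)^* and H^oo = (L^1 / H^1_0)^*.       *)
Definition is_adjoint (R : realType) (S : L1_H10 R -> l1 R)
    (U : linf R -> Hinf R) : Prop :=
  forall (f : L1 R) (u : linf R), H_pairing f (U u) = l1_pairing (S (L1_class f)) u.

Definition sup_sum (R : realType) (A : set R[i]) (h : nat -> R[i] -> R[i]) :
    \bar R :=
  ereal_sup [set (\sum_(n <oo) (normc (h n z))%:E)%E | z in A].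

Definition full_ntlim_set (R : realType) (g : nat -> Hinf R) (B : set R[i]) :
    Prop :=
  [/\ measurable (B : set (borelC R)), B `<=` @unit_circle R,
      @circle_measure R B = 1%E &
      forall z, B z -> forall n, exists l, has_ntlim (g n) z l].

(* Main.v *)
Require Import Defs.
From HB Require Import structures.
From mathcomp Require Import all_boot all_order all_algebra.
From mathcomp Require Import ring_quotient complex.
From mathcomp Require Import all_classical all_reals all_analysis.
From mathcomp Require Import measurable_realfun.
From mathcomp Require Import ring lra.

Set Implicit Arguments.
Unset Strict Implicit.
Unset Printing Implicit Defensive.

Import Order.TTheory GRing.Theory Num.Theory.
Import numFieldNormedType.Exports.
Import Normc.

Local Open Scope classical_set_scope.
Local Open Scope ring_scope.
Local Open Scope complex_scope.

(* A bounded analytic g is the Poisson integral of a bounded function b on    *)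
(* the circle, whose values are the nontangential limits of g almost          *)
(* everywhere. The function b is the limit of the dilations g (r .): the      *)
(* integral of g (r z) conj (g (s z)) depends only on r s, so for r = s it is *)
(* a bounded midpoint convex function of log r, hence monotone, and the       *)
(* dilations are Cauchy in L^2. Fatou's theorem on Poisson integrals at       *)
(* Lebesgue points then gives the nontangential limits. Averaging sum |b_n|   *)
(* against Poisson kernels bounds sum |g_n| on the disk, and radial limits    *)
(* give the converse; so M = M~.                                              *)
(*   If M is finite then sum u_n g_n is a bounded analytic function for every *)
(* bounded u, and by dominated convergence it can be paired with f in L^1     *)
(* term by term: this defines T as the adjoint of S. The map S is well        *)
(* defined on L^1 / H^1_0 because the boundary function of F g has integral   *)
(* F(0) g(0) for F in H^1: dividing F by an outer function shows that |F| is  *)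
(* at most the Poisson integral u of its boundary values, and Fatou's lemma   *)
(* applies to u + Re (c F) with |c| = 1.                                      *)
(*   Conversely the truncations of u converge weak* to u, so a                *)
(* weak*-continuous T with T e_j = g_j satisfies (T u)(z) = sum u_n g_n(z),   *)
(* and a gliding hump argument bounds the sums uniformly. The norms of S and  *)
(* T are computed on Poisson kernels and on sequences of phases.              *)

(** * Complex-valued integrals *)

(** The pivot is [sup_sum_boundary]: the supremum of the sums over the disk equals the one of the
    nontangential limits over any set of full measure, infinite values included. One inequality
    passes to the limit along radii. The other averages boundary values against Poisson kernels, and
    so requires each bounded analytic function to be the Poisson integral of its boundary function:
    [boundary_function] produces that function, [ntlim_poisson] identifies it with the nontangential
    limits. This settles (ii), (iii) and, the circle itself being a full set there, the disk
    algebra.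

    If the sums are bounded, [linf_combination] gives [h = sum u_n g_n] in H^oo together with the
    termwise pairing with any [f] in L^1. The map S of [predual_map] passes to the quotient by
    [H10_pairing], which rests on the mean value property [hardy_mean] for H^1. Pairing [f] with the
    image of [u] is then pairing [S f] with [u], and this is weak* continuous in [u] by the
    definition of the topology ([weakstar_map_exists]).

    Conversely, [weakstar_continuous_series] uses continuity along truncations, and
    [poisson_evaluation] places point evaluations in the predual; together they give
    [U u = sum u_n g_n] pointwise on the disk. Taking for [u] the phases at one point shows that
    each sum is finite; since [u] then depends on the point, uniformity needs the gliding hump of
    [bounded_of_linf_sums]. The norms are found in [weakstar_map_norm] and [predual_op_norm].

    The complex analysis is derived from mere differentiability: [goursat_rectangle], read in
    logarithmic coordinates, makes circle means constant in an annulus, and the Cauchy and Poisson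
    formulas follow from this. *)

Section ComplexNumbers.
Variable R : realType.
Implicit Types (z w : R[i]).

Lemma sqr_normcE z : normc z ^+ 2 = complex.Re z ^+ 2 + complex.Im z ^+ 2.
Proof. by case: z => a b; rewrite /= sqr_sqrtr// addr_ge0// sqr_ge0. Qed.

Lemma ler_Re_normc z : `|complex.Re z| <= normc z.
Proof.
rewrite -(ler_pXn2r (n := 2)) ?nnegrE ?normc_ge0//.
by rewrite sqr_normcE real_normK ?num_real// lerDl sqr_ge0.
Qed.

Lemma ler_Im_normc z : `|complex.Im z| <= normc z.
Proof.
rewrite -(ler_pXn2r (n := 2)) ?nnegrE ?normc_ge0//.
by rewrite sqr_normcE real_normK ?num_real// lerDr sqr_ge0.
Qed.

Lemma normc_le_ReIm z : normc z <= `|complex.Re z| + `|complex.Im z|.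
Proof.
rewrite -(ler_pXn2r (n := 2)) ?nnegrE ?normc_ge0 ?addr_ge0//.
rewrite sqr_normcE sqrrD !real_normK ?num_real// -addrA lerD2l lerDr.
by rewrite mulrn_wge0// mulr_ge0.
Qed.

Lemma normc_sub z w : normc (z - w) = normc (w - z).
Proof. by rewrite -normcN opprB. Qed.

Lemma normc_conj z : normc z^*%C = normc z.
Proof. by case: z => a b /=; rewrite sqrrN. Qed.

Lemma normcX z n : normc (z ^+ n) = normc z ^+ n.
Proof. by elim: n => [|n IH]; rewrite ?expr0 ?normc1// !exprS normcM IH. Qed.

Lemma normc_eq0 z : (normc z == 0) = (z == 0).
Proof. by apply/eqP/eqP => [/eq0_normc//|->]; exact: normc0. Qed.

Lemma normc_gt0 z : (0 < normc z) = (z != 0).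
Proof. by rewrite lt_neqAle normc_ge0 andbT eq_sym normc_eq0. Qed.

Lemma le_normcB z w : normc (z - w) <= normc z + normc w.
Proof. by rewrite -[normc w]normcN; exact: le_normcD. Qed.

Lemma lerB_normc z w : normc z - normc w <= normc (z - w).
Proof. by rewrite lerBlDr -[in leLHS](subrK w z) le_normcD. Qed.

Lemma mulc_conj z : z * z^*%C = (normc z ^+ 2)%:C.
Proof.
rewrite sqr_normcE; case: z => a b; apply/eqP; rewrite eq_complex /=.
by apply/andP; split; apply/eqP; ring.
Qed.

Lemma gt0_complexE (e : R[i]) : 0 < e -> 0 < complex.Re e /\ e = (complex.Re e)%:C.
Proof.
by rewrite ltcE => /andP[/eqP]; case: e => a b /= -> a0; split.
Qed.

(** In the ordered field [R[i]] a positive radius is a positive real, so real radii suffice. *)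
Lemma cvgc_normP (S : Type) (F : set_system S) {FF : Filter F} (f : S -> R[i])
    (l : R[i]) :
  f @ F --> l <->
  forall e : R, 0 < e -> \forall x \near F, normc (l - f x) < e.
Proof.
split.
  move/(@cvgrPdist_lt _ _ _ _ FF) => h e e0.
  have e0' : 0 < e%:C by rewrite ltcR.
  by apply: filterS (h _ e0') => x; rewrite normrE_normc ltcR.
move=> h; apply/(@cvgrPdist_lt _ _ _ _ FF) => e /gt0_complexE[e0 ->].
by apply: filterS (h _ e0) => x; rewrite normrE_normc ltcR.
Qed.

Lemma nbhsc_normP z (P : set R[i]) :
  nbhs z P <-> exists2 e : R, 0 < e & forall w, normc (z - w) < e -> P w.
Proof.
split.
  move/nbhs_ballP => [e /= /gt0_complexE[e0 eE]] h; exists (complex.Re e) => // w zw.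
  by apply: h; rewrite /ball /= normrE_normc eE ltcR.
move=> [e e0 h]; apply/nbhs_ballP; exists e%:C; first by rewrite /= ltcR.
by move=> w; rewrite /ball /= normrE_normc ltcR; exact: h.
Qed.

Lemma cvgc_ReIm (S : Type) (F : set_system S) {FF : Filter F} (f : S -> R[i])
    (l : R[i]) :
  f @ F --> l <->
  ((fun x => complex.Re (f x)) @ F --> complex.Re l) /\
  ((fun x => complex.Im (f x)) @ F --> complex.Im l).
Proof.
split.
  move/cvgc_normP => h; split; apply/(@cvgrPdist_lt _ _ _ _ FF) => e e0;
    apply: filterS (h _ e0) => x; apply: le_lt_trans.
    by rewrite -(raddfB (@complex.Re R : Rcomplex R -> R)); exact: ler_Re_normc.
  by rewrite -(raddfB (@complex.Im R : Rcomplex R -> R)); exact: ler_Im_normc.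
move=> [/(@cvgrPdist_lt _ _ _ _ FF) hr /(@cvgrPdist_lt _ _ _ _ FF) hi].
apply/cvgc_normP => e e0.
have e20 : 0 < e / 2 by rewrite divr_gt0.
apply: filterS2 (hr _ e20) (hi _ e20) => x xr xi.
apply: le_lt_trans (normc_le_ReIm _) _; rewrite [ltRHS]splitr.
rewrite (raddfB (@complex.Re R : Rcomplex R -> R)) (raddfB (@complex.Im R : Rcomplex R -> R)).
exact: ltrD.
Qed.

Lemma cvg_normc (S : Type) (F : set_system S) {FF : Filter F} (f : S -> R[i])
    (l : R[i]) : f @ F --> l -> (fun x => normc (f x)) @ F --> normc l.
Proof. by move=> fl; exact: (cvg_comp _ _ fl (@normc_continuous R l)). Qed.

Lemma ReB z w : complex.Re (z - w) = complex.Re z - complex.Re w.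
Proof. by case: z w => [a b] [c d]. Qed.
Lemma ImB z w : complex.Im (z - w) = complex.Im z - complex.Im w.
Proof. by case: z w => [a b] [c d]. Qed.
Lemma ReD z w : complex.Re (z + w) = complex.Re z + complex.Re w.
Proof. by case: z w => [a b] [c d]. Qed.
Lemma ImD z w : complex.Im (z + w) = complex.Im z + complex.Im w.
Proof. by case: z w => [a b] [c d]. Qed.
Lemma ReM z w : complex.Re (z * w) =
  complex.Re z * complex.Re w - complex.Im z * complex.Im w.
Proof. by case: z w => [a b] [c d]. Qed.
Lemma ImM z w : complex.Im (z * w) =
  complex.Re z * complex.Im w + complex.Im z * complex.Re w.
Proof. by case: z w => [a b] [c d]. Qed.

End ComplexNumbers.

Section ComplexIntegral.
Context d (X : measurableType d) (R : realType).
Variables (mu : {measure set X -> \bar R}) (D : set X).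
Hypothesis mD : measurable D.
Implicit Types f g : X -> R[i].

(** Has the same body as [circle_integral], for any measure and domain: the lemmas below apply by
    conversion to the circle, and also to Lebesgue measure on segments. *)
Definition cint f : R[i] :=
  Rintegral mu D (fun x => complex.Re (f x)) +i*
  Rintegral mu D (fun x => complex.Im (f x)).

Definition cintegrable f :=
  mu.-integrable D (fun x => (complex.Re (f x))%:E) /\
  mu.-integrable D (fun x => (complex.Im (f x))%:E).

Definition cmeas f :=
  measurable_fun D (fun x => complex.Re (f x)) /\
  measurable_fun D (fun x => complex.Im (f x)).

Lemma cmeas_cst c : cmeas (fun=> c).
Proof. by split; exact: measurable_cst. Qed.

Lemma cmeasD f g : cmeas f -> cmeas g -> cmeas (fun x => f x + g x).
Proof.
move=> [f1 f2] [g1 g2]; split.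
  by under eq_fun do rewrite ReD; exact: measurable_funD.
by under eq_fun do rewrite ImD; exact: measurable_funD.
Qed.

Lemma cmeasM f g : cmeas f -> cmeas g -> cmeas (fun x => f x * g x).
Proof.
move=> [f1 f2] [g1 g2]; split.
  by under eq_fun do rewrite ReM; apply: measurable_funB; exact: measurable_funM.
by under eq_fun do rewrite ImM; apply: measurable_funD; exact: measurable_funM.
Qed.

Lemma cmeas_real (f : X -> R) : measurable_fun D f -> cmeas (fun x => (f x)%:C).
Proof. by move=> mf; split => //=; exact: measurable_cst. Qed.

Lemma cmeas_conj f : cmeas f -> cmeas (fun x => (f x)^*%C).
Proof.
move=> [f1 f2]; split.
  by rewrite (_ : (fun _ => _) = fun x => complex.Re (f x))//; apply/funext => x; case: (f x).
rewrite (_ : (fun _ => _) = fun x => - complex.Im (f x)); first exact: measurable_funN.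
by apply/funext => x; case: (f x).
Qed.

Lemma cmeas_normc f : cmeas f -> measurable_fun D (fun x => normc (f x)).
Proof.
move=> [f1 f2]; rewrite (_ : (fun _ => _) =
   Num.sqrt \o (fun x => complex.Re (f x) ^+ 2 + complex.Im (f x) ^+ 2)); last first.
  by apply/funext => x /=; case: (f x).
apply: measurableT_comp; last by apply: measurable_funD; exact: measurable_funX.
by apply: continuous_measurable_fun; exact: sqrt_continuous.
Qed.

Lemma cintegrable_cmeas f : cintegrable f -> cmeas f.
Proof.
by move=> [/measurable_int/measurable_EFinP f1 /measurable_int/measurable_EFinP f2].
Qed.

Lemma le_cintegrable f (g : X -> R) : cmeas f -> mu.-integrable D (EFin \o g) ->
  (forall x, D x -> normc (f x) <= g x) -> cintegrable f.
Proof.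
move=> [f1 f2] ig fg; split.
  apply: (le_integrable mD _ _ ig); first exact/measurable_EFinP.
  move=> x Dx; rewrite /= lee_fin (le_trans (ler_Re_normc _))//.
  by rewrite (le_trans (fg _ Dx))// ler_norm.
apply: (le_integrable mD _ _ ig); first exact/measurable_EFinP.
move=> x Dx; rewrite /= lee_fin (le_trans (ler_Im_normc _))//.
by rewrite (le_trans (fg _ Dx))// ler_norm.
Qed.

Lemma cintegrable_normc f :
  cintegrable f -> mu.-integrable D (fun x => (normc (f x))%:E).
Proof.
move=> cf; have [f1 f2] := cf.
have := integrableD mD (integrable_norm f1) (integrable_norm f2).
apply: le_integrable => //.
  by apply/measurable_EFinP/cmeas_normc/cintegrable_cmeas.
move=> x Dx /=; rewrite lee_fin (ger0_norm (normc_ge0 _)).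
by rewrite (le_trans (normc_le_ReIm _))// ler_norm.
Qed.

Lemma RintegrableZl k (f : X -> R) : mu.-integrable D (fun x => (f x)%:E) ->
  mu.-integrable D (fun x => (k * f x)%:E).
Proof.
by move=> fi; have := integrableZl mD k fi; under eq_fun do rewrite -EFinM.
Qed.

Lemma RintegrableD (f g : X -> R) : mu.-integrable D (fun x => (f x)%:E) ->
  mu.-integrable D (fun x => (g x)%:E) ->
  mu.-integrable D (fun x => (f x + g x)%:E).
Proof. by move=> fi gi; have := integrableD mD fi gi. Qed.

Lemma cintegrableD f g : cintegrable f -> cintegrable g ->
  cintegrable (fun x => f x + g x).
Proof.
move=> [f1 f2] [g1 g2]; split.
  by under eq_fun do rewrite ReD EFinD; have := integrableD mD f1 g1.
by under eq_fun do rewrite ImD EFinD; have := integrableD mD f2 g2.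
Qed.

Lemma cintegrableZ c f : cintegrable f -> cintegrable (fun x => c * f x).
Proof.
move=> cf; apply: (le_cintegrable (g := fun x => normc c * normc (f x))).
- by apply: cmeasM; [exact: cmeas_cst|exact: cintegrable_cmeas].
- have := integrableZl mD (normc c) (cintegrable_normc cf).
  by apply: eq_integrable => // x _; rewrite EFinM.
- by move=> x _; rewrite normcM.
Qed.

Lemma cintD f g : cintegrable f -> cintegrable g ->
  cint (fun x => f x + g x) = cint f + cint g.
Proof.
move=> [f1 f2] [g1 g2]; rewrite /cint.
under eq_Rintegral do rewrite ReD.
under [X in _ +i* X]eq_Rintegral do rewrite ImD.
by rewrite !RintegralD.
Qed.

Lemma cintZ c f : cintegrable f -> cint (fun x => c * f x) = c * cint f.
Proof.
move=> [f1 f2]; rewrite /cint.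
under eq_Rintegral do rewrite ReM.
under [X in _ +i* X]eq_Rintegral do rewrite ImM.
rewrite RintegralB//; [|exact: RintegrableZl f1|exact: RintegrableZl f2].
rewrite RintegralD//; [|exact: RintegrableZl f2|exact: RintegrableZl f1].
by rewrite !RintegralZl//; case: c.
Qed.

Lemma cintB f g : cintegrable f -> cintegrable g ->
  cint (fun x => f x - g x) = cint f - cint g.
Proof.
move=> cf cg; rewrite -[- cint g]mulN1r -cintZ// -cintD//; last exact: cintegrableZ.
by congr cint; apply/funext => x; rewrite mulN1r.
Qed.

Lemma eq_cint f g : (forall x, D x -> f x = g x) -> cint f = cint g.
Proof.
move=> fg; rewrite /cint; congr Complex; apply: eq_Rintegral => x;
  by rewrite inE => /fg ->.
Qed.

Lemma eq_cintegrable f g : (forall x, D x -> f x = g x) -> cintegrable f -> cintegrable g.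
Proof.
by move=> fg [f1 f2]; split; [move: f1|move: f2]; apply: eq_integrable => // x;
   rewrite inE => /fg ->.
Qed.

Lemma normc_cint f : cintegrable f ->
  normc (cint f) <= Rintegral mu D (fun x => normc (f x)).
Proof.
move=> cf; have [->|n0] := eqVneq (cint f) 0.
  by rewrite normc0; apply: Rintegral_ge0 => x _; exact: normc_ge0.
(* Rotating by the phase of the integral makes the integral real. *)
pose c := (cint f)^*%C * ((normc (cint f))^-1)%:C.
have nc : normc c = 1.
  rewrite /c normcM normc_conj normc_real ger0_norm ?invr_ge0 ?normc_ge0//.
  by rewrite divff// normc_eq0.
have -> : normc (cint f) = complex.Re (cint (fun x => c * f x)).
  rewrite cintZ// /c mulrC mulrA mulc_conj -rmorphM.
  by move: (normc_eq0 (cint f)); move: (normc _) => y; rewrite (negbTE n0) /= => y0;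
    rewrite expr2 mulfK// y0.
have [iR _] := cintegrableZ c cf.
apply: (le_Rintegral mD iR (cintegrable_normc cf)).
move=> x _; rewrite (le_trans (ler_norm _))// (le_trans (ler_Re_normc _))//.
by rewrite normcM nc mul1r.
Qed.

Lemma Rdominated_cvg (f_ : (X -> R)^nat) (f g : X -> R) :
  (forall n, measurable_fun D (f_ n)) -> measurable_fun D f ->
  {ae mu, forall x, D x -> f_ ^~ x @ \oo --> f x} ->
  mu.-integrable D (EFin \o g) ->
  (forall n x, D x -> `|f_ n x| <= g x) ->
  mu.-integrable D (EFin \o f) /\
  (Rintegral mu D (f_ n) @[n --> \oo] --> Rintegral mu D f).
Proof.
move=> mf_ mf ff ig fg.
have [|||||intf _ h] := @dominated_convergence _ _ _ mu D mD
  (fun n x => (f_ n x)%:E) (EFin \o f) (EFin \o g).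
- by move=> n; apply/measurable_EFinP.
- exact/measurable_EFinP.
- by apply: filterS ff => x h Dx; apply/fine_cvgP; split; [exact: nearW|exact: h].
- by [].
- by apply: aeW => x n Dx; rewrite lee_fin fg.
split => //; apply: fine_cvg; rewrite fineK//; exact: integrable_fin_num.
Qed.

Lemma cdominated_cvg (f_ : (X -> R[i])^nat) f (g : X -> R) :
  (forall n, cmeas (f_ n)) -> cmeas f ->
  {ae mu, forall x, D x -> f_ ^~ x @ \oo --> f x} ->
  mu.-integrable D (EFin \o g) ->
  (forall n x, D x -> normc (f_ n x) <= g x) ->
  cintegrable f /\ (cint (f_ n) @[n --> \oo] --> cint f).
Proof.
move=> mf_ [mf1 mf2] ff ig fg.
have [] := @Rdominated_cvg (fun n x => complex.Re (f_ n x))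
  (fun x => complex.Re (f x)) g.
- by move=> n; case: (mf_ n).
- by [].
- by apply: filterS ff => x h Dx; have /cvgc_ReIm[] := h Dx.
- by [].
- by move=> n x Dx; rewrite (le_trans (ler_Re_normc _))// fg.
move=> i1 c1.
have [] := @Rdominated_cvg (fun n x => complex.Im (f_ n x))
  (fun x => complex.Im (f x)) g.
- by move=> n; case: (mf_ n).
- by [].
- by apply: filterS ff => x h Dx; have /cvgc_ReIm[] := h Dx.
- by [].
- by move=> n x Dx; rewrite (le_trans (ler_Im_normc _))// fg.
by move=> i2 c2; split => //; apply/cvgc_ReIm.
Qed.

End ComplexIntegral.

(** * Cauchy's theorem *)

Section IntervalIntegral.
Variable R : realType.
Local Notation mu := (@lebesgue_measure R).
Implicit Types (f g : R -> R[i]) (a b c : R).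

Definition itv_cint a b f : R[i] := cint mu (`[a, b]%classic : set (measurableTypeR R)) f.

Lemma continuous_cintegrable f a b :
  (forall x, a <= x <= b -> f y @[y --> x] --> f x) ->
  cintegrable mu (`[a, b]%classic : set (measurableTypeR R)) f.
Proof.
move=> cf; split; apply: (@continuous_compact_integrable R _ `[a, b]) => //;
  try exact: segment_compact; apply: continuous_in_subspaceT => x;
  rewrite inE /= in_itv /= => /cf /cvgc_ReIm[]//.
Qed.

Lemma itv_cint_split f a b c :
  a <= c <= b -> (forall x, a <= x <= b -> f y @[y --> x] --> f x) ->
  itv_cint a b f = itv_cint a c f + itv_cint c b f.
Proof.
move=> /andP[ac cb] /continuous_cintegrable[fr fi].
have e (h : R -> R) : mu.-integrable `[a, b] (EFin \o h) ->
    Rintegral mu `[a, b] h = Rintegral mu `[a, c] h + Rintegral mu `[c, b] h.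
  move=> ih.
  have := @Rintegral_itvB R h _ _ c ih; rewrite !bnd_simp => /(_ ac cb).
  rewrite Rintegral_itv_obnd_cbnd.
    by move/eqP; rewrite subr_eq addrC => /eqP.
  by apply: integrableS ih => //; apply: subset_itvr; rewrite bnd_simp.
by rewrite /itv_cint /cint e// e.
Qed.

Lemma fine_lebesgue_segment a b : a <= b ->
  fine (mu (`[a, b]%classic : set (measurableTypeR R))) = b - a.
Proof.
move=> ab; rewrite lebesgue_measure_itv /= lte_fin.
by case: ltgtP ab => // ->; rewrite subrr.
Qed.

Lemma normc_itv_cint_le f a b (C : R) : a <= b ->
  (forall x, a <= x <= b -> f y @[y --> x] --> f x) ->
  (forall x, a <= x <= b -> normc (f x) <= C) ->
  normc (itv_cint a b f) <= C * (b - a).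
Proof.
move=> ab cf fC.
have intf := continuous_cintegrable cf.
rewrite /itv_cint (le_trans (normc_cint _ intf))//.
have -> : C * (b - a) = Rintegral mu `[a, b] (fun=> C).
  by rewrite Rintegral_cst// fine_lebesgue_segment.
apply: le_Rintegral => //.
- exact: cintegrable_normc.
- by apply: continuous_compact_integrable; [exact: segment_compact|
    apply: continuous_subspaceT => x; exact: cvg_cst].
Qed.

Lemma eq_itv_cint f g a b : (forall x, a <= x <= b -> f x = g x) ->
  itv_cint a b f = itv_cint a b g.
Proof. by move=> fg; apply: eq_cint => x; rewrite /= in_itv /=; exact: fg. Qed.

Lemma itv_cintB f g a b :
  (forall x, a <= x <= b -> f y @[y --> x] --> f x) ->
  (forall x, a <= x <= b -> g y @[y --> x] --> g x) ->
  itv_cint a b (fun x => f x - g x) = itv_cint a b f - itv_cint a b g.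
Proof.
by move=> cf cg; apply: cintB => //; exact: continuous_cintegrable.
Qed.

Lemma itv_cint_cst a b (c : R[i]) : a <= b ->
  itv_cint a b (fun=> c) = c * (b - a)%:C.
Proof.
move=> ab; rewrite /itv_cint /cint !Rintegral_cst// fine_lebesgue_segment//.
by case: c => c1 c2; apply/eqP; rewrite eq_complex /= !mulr0 subr0 add0r !eqxx.
Qed.

End IntervalIntegral.

Section GoursatRectangle.
Variables (R : realType) (k : R) (H : R -> R -> R[i]).
Hypothesis k0 : 0 <= k.

(* Complex differentiability of [H] in the variable [s + i k t]. *)
Definition strip_differentiable (s0 t0 : R) := exists L : R[i],
  forall e : R, 0 < e -> exists2 d : R, 0 < d & forall s t : R,
    `|s - s0| < d -> `|t - t0| < d ->
    normc (H s t - H s0 t0 - L * ((s - s0) +i* (k * (t - t0)))) <=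
    e * (`|s - s0| + k * `|t - t0|).

Let I : R[i] := 0 +i* k.

(** The integral of [H d(s + i k t)] along the boundary of the rectangle, counterclockwise. *)
Definition rect_int (a b c d : R) : R[i] :=
  itv_cint a b (H^~ c) - itv_cint a b (H^~ d) +
  I * (itv_cint c d (H b) - itv_cint c d (H a)).

Lemma normc_I : normc I = k.
Proof. by rewrite /= expr0n add0r sqrtr_sqr ger0_norm. Qed.

Lemma strip_differentiable_cvgl s0 t0 : strip_differentiable s0 t0 ->
  H s t0 @[s --> s0] --> H s0 t0.
Proof.
move=> [L hL]; apply/cvgc_normP => e e0.
have [d d0 hd] := hL 1 ltr01.
have n0 := normc_ge0 L.
have e1 : 0 < e / (1 + normc L) by rewrite divr_gt0// ltr_pwDl.
have h1 : \forall s \near s0, `|s0 - s| < d by exact: nbhsx_ballx.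
have h2 : \forall s \near s0, `|s0 - s| < e / (1 + normc L) by exact: nbhsx_ballx.
apply: filterS2 h1 h2 => s; rewrite distrC => sd se.
have := hd s t0 sd; rewrite !subrr normr0 !mulr0 addr0 mul1r => /(_ d0) h.
rewrite normc_sub -(subrK (L * ((s - s0) +i* 0)) (_ - _)).
apply: le_lt_trans (le_normcD _ _) _; rewrite normcM normc_real.
move: se; rewrite ltr_pdivlMr ?ltr_pwDl// => se.
by apply: le_lt_trans se; rewrite mulrDr mulr1 lerD// [leRHS]mulrC.
Qed.

Lemma strip_differentiable_cvgr s0 t0 : strip_differentiable s0 t0 ->
  H s0 t @[t --> t0] --> H s0 t0.
Proof.
move=> [L hL]; apply/cvgc_normP => e e0.
have [d d0 hd] := hL 1 ltr01.
have n0 := normc_ge0 L.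
have C0 : 0 < (1 + normc L) * (1 + k) by rewrite mulr_gt0// ltr_pwDl.
have e1 : 0 < e / ((1 + normc L) * (1 + k)) by rewrite divr_gt0.
have h1 : \forall t \near t0, `|t0 - t| < d by exact: nbhsx_ballx.
have h2 : \forall t \near t0, `|t0 - t| < e / ((1 + normc L) * (1 + k)) by exact: nbhsx_ballx.
apply: filterS2 h1 h2 => t; rewrite distrC => sd se.
have := hd s0 t; rewrite !subrr normr0 add0r mul1r => /(_ d0 sd) h.
rewrite normc_sub -(subrK (L * (0 +i* (k * (t - t0)))) (_ - _)).
apply: le_lt_trans (le_normcD _ _) _; rewrite normcM.
have -> : normc (0 +i* (k * (t - t0))) = k * `|t - t0|.
  by rewrite /= expr0n add0r sqrtr_sqr normrM ger0_norm.
move: se; rewrite ltr_pdivlMr// => se.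
apply: le_lt_trans se; rewrite (le_trans (lerD h (lexx _)))//.
have -> : k * `|t - t0| + normc L * (k * `|t - t0|) =
  `|t - t0| * ((1 + normc L) * k) by ring.
by rewrite ler_wpM2l// ler_wpM2l// ?addr_ge0// lerDr.
Qed.

Variables a b c d : R.
Hypothesis ab : a <= b.
Hypothesis cd : c <= d.
Hypothesis dH : forall s t, a <= s <= b -> c <= t <= d -> strip_differentiable s t.

Let in_ab x y s : a <= x -> y <= b -> x <= s <= y -> a <= s <= b.
Proof. by move=> ax yb /andP[xs sy]; rewrite (le_trans ax xs) (le_trans sy yb). Qed.

Let in_cd x y s : c <= x -> y <= d -> x <= s <= y -> c <= s <= d.
Proof. by move=> ax yb /andP[xs sy]; rewrite (le_trans ax xs) (le_trans sy yb). Qed.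

Lemma rect_int_split x x' y y' z z' : a <= x -> x <= z <= x' -> x' <= b ->
  c <= y -> y <= z' <= y' -> y' <= d ->
  rect_int x x' y y' = rect_int x z y z' + rect_int z x' y z' +
    (rect_int x z z' y' + rect_int z x' z' y').
Proof.
move=> ax xzx xb cy yzy yd; have /andP[xz zx] := xzx; have /andP[yz zy] := yzy.
have hz (s : R) : c <= s <= d -> itv_cint x x' (H^~ s) = itv_cint x z (H^~ s) + itv_cint z x' (H^~ s).
  move=> cs; apply: itv_cint_split => // t xt; apply: strip_differentiable_cvgl.
  by apply: dH => //; exact: in_ab xt.
have vt (s : R) : a <= s <= b -> itv_cint y y' (H s) = itv_cint y z' (H s) + itv_cint z' y' (H s).
  move=> cs; apply: itv_cint_split => // t xt; apply: strip_differentiable_cvgr.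
  by apply: dH => //; exact: in_cd xt.
rewrite /rect_int !hz; last 2 first.
- by rewrite (le_trans cy (le_trans yz zy)).
- by rewrite cy (le_trans (le_trans yz zy) yd).
rewrite !vt; last 2 first.
- by rewrite ax (le_trans (le_trans xz zx) xb).
- by rewrite (le_trans ax (le_trans xz zx)).
ring.
Qed.

(** The boundary integral of an affine function of [s + i k t] vanishes, so only the error [e] of
    the affine approximation counts, once on each of two opposite sides. *)
Lemma rect_int_small x x' y y' s0 t0 e : a <= x -> x <= s0 <= x' -> x' <= b ->
  c <= y -> y <= t0 <= y' -> y' <= d -> 0 <= e -> forall L,
  (forall s t, x <= s <= x' -> y <= t <= y' ->
    normc (H s t - H s0 t0 - L * ((s - s0) +i* (k * (t - t0)))) <= e) ->
  normc (rect_int x x' y y') <= 2 * e * ((x' - x) + k * (y' - y)).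
Proof.
move=> ax /andP[xs sx] xb cy /andP[yt ty] yd e0 L hL.
have xx := le_trans xs sx; have yy := le_trans yt ty.
have xin : x <= x <= x' by rewrite lexx.
have xin' : x <= x' <= x' by rewrite xx lexx.
have yin : y <= y <= y' by rewrite lexx.
have yin' : y <= y' <= y' by rewrite yy lexx.
have ch s t : x <= s <= x' -> y <= t <= y' -> H u t @[u --> s] --> H s t.
  by move=> h1 h2; apply: strip_differentiable_cvgl; apply: dH;
    [exact: in_ab h1|exact: in_cd h2].
have cv s t : x <= s <= x' -> y <= t <= y' -> H s u @[u --> t] --> H s t.
  by move=> h1 h2; apply: strip_differentiable_cvgr; apply: dH;
    [exact: in_ab h1|exact: in_cd h2].
have chB t t' s : y <= t <= y' -> y <= t' <= y' -> x <= s <= x' ->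
  (H u t - H u t') @[u --> s] --> H s t - H s t'.
  by move=> h1 h2 h3; apply: cvgB; exact: ch.
have cvB t t' s : x <= t <= x' -> x <= t' <= x' -> y <= s <= y' ->
  (H t u - H t' u) @[u --> s] --> H t s - H t' s.
  by move=> h1 h2 h3; apply: cvgB; exact: cv.
(* [K] and [K'] are the constant differences of the affine part between opposite sides; their
   contributions [K (x' - x)] and [I K' (y' - y)] cancel. *)
pose K : R[i] := L * (I * (y - y')%:C).
pose K' : R[i] := L * (x' - x)%:C.
have e1 : itv_cint x x' (H^~ y) - itv_cint x x' (H^~ y') =
    itv_cint x x' (fun s => H s y - H s y' - K) + K * (x' - x)%:C.
  rewrite itv_cintB; [|by move=> s hs; exact: chB|by move=> s _; exact: cvg_cst].
  rewrite itv_cint_cst// subrK itv_cintB// => s hs; exact: ch.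
have e2 : itv_cint y y' (H x') - itv_cint y y' (H x) =
    itv_cint y y' (fun t => H x' t - H x t - K') + K' * (y' - y)%:C.
  rewrite itv_cintB; [|by move=> s hs; exact: cvB|by move=> s _; exact: cvg_cst].
  rewrite itv_cint_cst// subrK itv_cintB// => s hs; exact: cv.
have -> : rect_int x x' y y' =
   itv_cint x x' (fun s => H s y - H s y' - K) +
   I * itv_cint y y' (fun t => H x' t - H x t - K').
  rewrite /rect_int e1 e2 /K /K' !rmorphB /=; ring.
have b2 (u v : R[i]) : normc u <= e -> normc v <= e -> normc (u - v) <= 2 * e.
  by move=> h1 h2; rewrite mulr_natl mulr2n (le_trans (le_normcB _ _))// lerD.
have rw (u v : R) : u +i* v = u%:C + (0 +i* 1) * v%:C.
  by apply/eqP; rewrite eq_complex /= !(mul0r, mulr0, mul1r, subr0, addr0, add0r) !eqxx.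
have n1 : normc (itv_cint x x' (fun s => H s y - H s y' - K)) <= 2 * e * (x' - x).
  apply: normc_itv_cint_le => // s hs.
    by apply: cvgB; [exact: chB|exact: cvg_cst].
  have := b2 _ _ (hL s y hs yin) (hL s y' hs yin').
  congr (normc _ <= _); rewrite /K /I.
  rewrite (rw 0 k) rmorph0 add0r.
  rewrite !(rw (s - s0)) !rmorphM !rmorphB /=; ring.
have n2 : normc (itv_cint y y' (fun t => H x' t - H x t - K')) <= 2 * e * (y' - y).
  apply: normc_itv_cint_le => // s hs.
    by apply: cvgB; [exact: cvB|exact: cvg_cst].
  have := b2 _ _ (hL x' s xin' hs) (hL x s xin hs).
  congr (normc _ <= _); rewrite /K'.
  rewrite !(rw (_ - s0)) !rmorphM !rmorphB /=; ring.
rewrite (le_trans (le_normcD _ _))// mulrDr lerD// normcM normc_I.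
by rewrite mulrCA; apply: ler_wpM2l.
Qed.

End GoursatRectangle.

Section NestedIntervals.
Variable R : realType.

Lemma nested_intervals (x : nat -> R) (l : nat -> R) :
  (forall n, x n <= x n.+1) -> (forall n, x n.+1 + l n.+1 <= x n + l n) ->
  (forall n, 0 <= l n) -> exists p, forall n, x n <= p <= x n + l n.
Proof.
move=> xS xl l0.
have xm n m : (n <= m)%N -> x n <= x m.
  by move=> /subnK <-; elim: (m - n)%N => [//|k IH]; exact: le_trans IH (xS _).
have lm n m : (n <= m)%N -> x m + l m <= x n + l n.
  by move=> /subnK <-; elim: (m - n)%N => [//|k IH]; exact: le_trans (xl _) IH.
have xub n m : x m <= x n + l n.
  have [nm|mn] := leqP n m.
    by rewrite (le_trans _ (lm _ _ nm))// lerDl.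
  by rewrite (le_trans (xm _ _ (ltnW mn)))// lerDl.
have ubx n : ubound (range x) (x n + l n) by move=> y [m _ <-]; exact: xub.
exists (sup (range x)) => n; apply/andP; split.
  by apply: ub_le_sup; [exists (x 0%N + l 0%N); exact: ubx|exists n].
by apply: ge_sup; [exists (x 0%N); exists 0%N|exact: ubx].
Qed.

End NestedIntervals.

Section Goursat.
Variables (R : realType) (k : R) (H : R -> R -> R[i]) (a b c d : R).
Hypothesis k0 : 0 <= k.
Hypothesis ab : a <= b.
Hypothesis cd : c <= d.
Hypothesis dH : forall s t, a <= s <= b -> c <= t <= d ->
  strip_differentiable k H s t.

Let l n : R := (b - a) / 2 ^+ n.
Let w n : R := (d - c) / 2 ^+ n.

Let l0 n : 0 <= l n. Proof. by rewrite /l divr_ge0 ?subr_ge0// exprn_ge0. Qed.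
Let w0 n : 0 <= w n. Proof. by rewrite /w divr_ge0 ?subr_ge0// exprn_ge0. Qed.
Let lS n : l n = l n.+1 + l n.+1.
Proof. by rewrite /l exprS invfM mulrCA [2^-1 * _]mulrC -splitr. Qed.
Let wS n : w n = w n.+1 + w n.+1.
Proof. by rewrite /w exprS invfM mulrCA [2^-1 * _]mulrC -splitr. Qed.

Let A0 := normc (rect_int k H a b c d).

Let P (n : nat) (p : R * R) :=
  [/\ a <= p.1, p.1 + l n <= b, c <= p.2, p.2 + w n <= d &
      A0 / 4 ^+ n <= normc (rect_int k H p.1 (p.1 + l n) p.2 (p.2 + w n))].

(** One of the four quarters carries at least a quarter of the integral. The invariant [P n p] is a
    premise under the existential, so that [choice] yields a function defined on all corners. *)
Let step n p : exists q : R * R, P n p -> P n.+1 q /\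
  [/\ p.1 <= q.1, q.1 + l n.+1 <= p.1 + l n,
      p.2 <= q.2 & q.2 + w n.+1 <= p.2 + w n].
Proof.
have [Pp|nP] := pselect (P n p); last by exists p.
have [ap pb cp pd hA] := Pp.
set x := p.1 in ap pb hA *; set y := p.2 in cp pd hA *.
pose z := x + l n.+1; pose z' := y + w n.+1.
have l0' := l0 n.+1; have w0' := w0 n.+1; have lSn := lS n; have wSn := wS n.
have zE : x + l n = z + l n.+1 by rewrite /z lS addrA.
have zE' : y + w n = z' + w n.+1 by rewrite /z' wS addrA.
have xz : x <= z by rewrite /z lerDl.
have yz : y <= z' by rewrite /z' lerDl.
have zx : z <= x + l n by rewrite zE lerDl.
have zy : z' <= y + w n by rewrite zE' lerDl.
have hS : rect_int k H x (x + l n) y (y + w n) =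
  rect_int k H x z y z' + rect_int k H z (x + l n) y z' +
    (rect_int k H x z z' (y + w n) + rect_int k H z (x + l n) z' (y + w n)).
  apply: (rect_int_split k0 dH) => //; first by rewrite xz.
  by rewrite yz.
have sumle : A0 / 4 ^+ n <= normc (rect_int k H x z y z') +
   normc (rect_int k H z (x + l n) y z') +
   (normc (rect_int k H x z z' (y + w n)) + normc (rect_int k H z (x + l n) z' (y + w n))).
  rewrite (le_trans hA)// hS (le_trans (le_normcD _ _))// lerD// le_normcD//.
set A := A0 / 4 ^+ n in sumle hA; pose A' := A0 / 4 ^+ n.+1.
have AE : A = A' * 4.
  by rewrite /A /A' exprS; field; rewrite expf_neq0// pnatr_eq0.
have az := le_trans ap xz; have cz := le_trans cp yz.
have zb := le_trans zx pb; have zd := le_trans zy pd.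
rewrite zE in zx pb; rewrite zE' in zy pd.
have [h1|h1] := leP A' (normc (rect_int k H x z y z')).
  by exists (x, y) => _; split; split; rewrite //= ?zE ?zE'.
have [h2|h2] := leP A' (normc (rect_int k H z (x + l n) y z')).
  by exists (z, y) => _; split; split; rewrite //= -?zE ?zE'.
have [h3|h3] := leP A' (normc (rect_int k H x z z' (y + w n))).
  by exists (x, z') => _; split; split; rewrite //= ?zE -?zE'.
have h4 : A' <= normc (rect_int k H z (x + l n) z' (y + w n)).
  by clear -sumle h1 h2 h3 AE; lra.
by exists (z, z') => _; split; split; rewrite //= -?zE -?zE'.
Qed.

(** Repeated bisection leads to nested rectangles that keep at least the fraction [4 ^- n] of the
    integral. At their common point differentiability bounds the integral by an arbitrarily small
    multiple of the squared size, that is of [4 ^- n]. *)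
Theorem goursat_rectangle : rect_int k H a b c d = 0.
Proof.
have [f hf] := @choice _ _ (fun np q => P np.1 np.2 -> P np.1.+1 q /\
  [/\ np.2.1 <= q.1, q.1 + l np.1.+1 <= np.2.1 + l np.1,
      np.2.2 <= q.2 & q.2 + w np.1.+1 <= np.2.2 + w np.1]) (fun np => step np.1 np.2).
pose u := fix u n := if n is n'.+1 then f (n', u n') else (a, c).
have Pu n : P n (u n).
  elim: n => [|n IH]; last by case: (hf (n, u n) IH).
  by rewrite /P /= /l /w !expr0 !divr1 !subrKC.
have nest n := (hf (n, u n) (Pu n)).2.
have [x hx] := @nested_intervals R (fun n => (u n).1) l
  (fun n => let: And4 h _ _ _ := nest n in h) (fun n => let: And4 _ h _ _ := nest n in h) l0.
have [y hy] := @nested_intervals R (fun n => (u n).2) w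
  (fun n => let: And4 _ _ h _ := nest n in h) (fun n => let: And4 _ _ _ h := nest n in h) w0.
apply: eq0_normc; apply/eqP; rewrite eq_le normc_ge0 andbT; apply/ler_addgt0Pr => e e0.
rewrite add0r.
have xab : a <= x <= b.
  by have := hx 0%N; rewrite /= /l expr0 divr1 subrKC.
have ycd : c <= y <= d.
  by have := hy 0%N; rewrite /= /w expr0 divr1 subrKC.
have [L hL] := dH xab ycd.
pose m := (b - a) + k * (d - c).
have m0 : 0 <= m by rewrite addr_ge0 ?mulr_ge0 ?subr_ge0.
(* The final estimate is [e' * (2 * (m * m))]; the [+ 1] covers a degenerate rectangle with
   [m = 0]. *)
pose e' := e / (2 * (m * m) + 1).
have den0 : 0 < 2 * (m * m) + 1 by rewrite ltr_wpDl// mulr_ge0// mulr_ge0.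
have e'0 : 0 < e' by rewrite divr_gt0.
have [dl dl0 hd] := hL _ e'0.
have [n hn] : exists n, (b - a) + (d - c) < dl * 2 ^+ n.
  have q0 : 0 <= (b - a + (d - c)) / dl.
    by rewrite divr_ge0 ?(ltW dl0)// addr_ge0 ?subr_ge0.
  have := archi_boundP q0; rewrite ltr_pdivrMr// mulrC => h.
  exists (Num.Def.archi_bound ((b - a + (d - c)) / dl)).
  rewrite (lt_le_trans h)// ler_wpM2l ?(ltW dl0)// -natrX ler_nat.
  exact/ltnW/ltn_expl.
have p2 : (0 : R) < 2 ^+ n by rewrite exprn_gt0.
have ln : l n < dl by rewrite /l ltr_pdivrMr//; lra.
have wn : w n < dl by rewrite /w ltr_pdivrMr//; lra.
have [ap pb cp pd hA] := Pu n.
have l0n := l0 n; have w0n := w0 n.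
have mn : l n + k * w n = m / 2 ^+ n by rewrite /l /w /m; ring.
have m2 : 0 <= m / 2 ^+ n by rewrite divr_ge0// ltW.
have {}hs : normc (rect_int k H (u n).1 ((u n).1 + l n) (u n).2 ((u n).2 + w n)) <=
    2 * (e' * (m / 2 ^+ n)) * (m / 2 ^+ n).
  have := rect_int_small k0 dH ap (hx n) pb cp (hy n) pd (mulr_ge0 (ltW e'0) m2) (L := L).
  rewrite [X in (X - _) + _]addrC addrK [X in k * X]addrAC subrr add0r mn; apply.
  move=> s t /andP[s1 s2] /andP[t1 t2].
  have /andP[x1 x2] := hx n; have /andP[y1 y2] := hy n.
  have sx : `|s - x| <= l n by rewrite ler_norml; apply/andP; split; lra.
  have ty : `|t - y| <= w n by rewrite ler_norml; apply/andP; split; lra.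
  apply: le_trans (hd s t _ _) _; [exact: le_lt_trans ln|exact: le_lt_trans wn|].
  by rewrite -mn ler_wpM2l ?(ltW e'0)// lerD// ler_wpM2l.
have := le_trans hA hs; rewrite ler_pdivrMr ?exprn_gt0//.
have -> : 2 * (e' * (m / 2 ^+ n)) * (m / 2 ^+ n) * 4 ^+ n = e' * (2 * (m * m)).
  have -> : (4 : R) ^+ n = 2 ^+ n * 2 ^+ n by rewrite -exprMn; congr (_ ^+ _); ring.
  by field; rewrite gt_eqF.
move=> /le_trans; apply; rewrite /e' mulrAC ler_pdivrMr// ler_wpM2l ?(ltW e0)//.
by rewrite lerDl.
Qed.

End Goursat.

Section ComplexDerivative.
Variable R : realType.
Implicit Types (F G : R[i] -> R[i]) (z w L : R[i]).

Lemma real_derive_expand (f : R -> R) (x df : R) : is_derive x 1 f df ->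
  forall e : R, 0 < e -> exists2 d : R, 0 < d & forall h, `|h| < d ->
    `|f (x + h) - f x - df * h| <= e * `|h|.
Proof.
move=> [fx fE] e e0; move: fx => /cvg_ex[/= l hl].
have ldf : l = df by rewrite -fE; apply/esym/cvg_lim.
rewrite {}ldf {l} in hl.
move/cvgrPdist_le: hl => /(_ e e0) /nbhs_ballP [d /= d0 hd].
exists d => // h hd'; have [->|h0] := eqVneq h 0.
  by rewrite addr0 subrr mulr0 subr0 normr0 mulr0.
have bh : ball 0 d h by rewrite /ball /= sub0r normrN.
have := hd h bh h0; rewrite /= [h *: 1]mulr1 [h + x]addrC => hh.
rewrite -normrN opprB.
have -> : df * h - (f (x + h) - f x) = (df - h^-1 *: (f (x + h) - f x)) * h.
  by rewrite mulrBl -[_ *: _]/(_ * _) mulrAC mulVf// mul1r.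
by rewrite normrM ler_wpM2r.
Qed.

(** First-order expansion with real radii; unlike a difference quotient it makes sense at [w = z],
    which simplifies compositions. *)
Definition cdiff F z L := forall e : R, 0 < e -> exists2 d : R, 0 < d &
  forall w, normc (w - z) < d ->
    normc (F w - F z - L * (w - z)) <= e * normc (w - z).

Lemma derivable_cdiff F z : derivable F z 1 -> exists L, cdiff F z L.
Proof.
move=> /cvg_ex[/= L hL]; exists L => e e0.
move/cvgc_normP: hL => /(_ e e0) /nbhsc_normP [d d0 hd].
exists d => // w wd; have [->|h0] := eqVneq w z.
  by rewrite !subrr mulr0 subr0 normc0 mulr0.
have h0' : w - z != 0 by rewrite subr_eq0.
have := hd (w - z); rewrite sub0r normcN => /(_ wd h0') /=.
rewrite [_ *: 1]mulr1 subrK => hh.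
rewrite [leLHS]normc_sub.
have -> : L * (w - z) - (F w - F z) = (L - (w - z)^-1 *: (F w - F z)) * (w - z).
  by rewrite mulrBl -[_ *: _]/(_ * _) mulrAC mulVf// mul1r.
by rewrite normcM ler_wpM2r ?normc_ge0// ltW.
Qed.

Lemma cdiff_derivable F z L : cdiff F z L -> derivable F z 1.
Proof.
move=> hF; apply/cvg_ex; exists L; apply/cvgc_normP => e e0.
have [d d0 hd] := hF (e / 2) (divr_gt0 e0 (ltr0n _ 2)).
apply/nbhsc_normP; exists d => // h; rewrite sub0r normcN => hd' h0.
have := hd (h + z); rewrite addrK => /(_ hd') hh.
rewrite /= [_ *: 1]mulr1.
have n0 : 0 < normc h by rewrite normc_gt0.
rewrite -(ltr_pM2r n0) -normcM mulrBl -[_ *: _]/(_ * _) mulrAC mulVf// mul1r.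
rewrite normc_sub (le_lt_trans hh)// ltr_pM2r//.
by rewrite ltr_pdivrMr// ltr_pMr// ltr1n.
Qed.

Lemma derivable_continuous F z : derivable F z 1 -> F w @[w --> z] --> F z.
Proof.
by move=> dF; apply/differentiable_continuous/derivable1_diffP.
Qed.

Definition cexp z : R[i] :=
  (expR (complex.Re z))%:C * (cos (complex.Im z) +i* sin (complex.Im z)).

Lemma cexpD z w : cexp (z + w) = cexp z * cexp w.
Proof.
rewrite /cexp ReD ImD expRD cosD sinD rmorphM /=.
apply/eqP; rewrite eq_complex /=; apply/andP; split; apply/eqP; ring.
Qed.

Lemma normc_cis (t : R) : normc (cos t +i* sin t) = 1.
Proof. by rewrite /= cos2Dsin2 sqrtr1. Qed.

Lemma normc_cexp z : normc (cexp z) = expR (complex.Re z).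
Proof. by rewrite normcM normc_cis mulr1 normc_real ger0_norm// expR_ge0. Qed.

Lemma cexp_neq0 z : cexp z != 0.
Proof. by rewrite -normc_gt0 normc_cexp expR_gt0. Qed.

Lemma cexp0_expand (e : R) : 0 < e -> exists2 d : R, 0 < d &
  forall h : R[i], normc h < d -> normc (cexp h - 1 - h) <= e * normc h.
Proof.
(* The errors in the real part cost [1 + 2] times [e1 * normc h], those in the imaginary part
   [1 + 2 + 1] times; 8 leaves room. *)
move=> e0; have [e1 [e10 e11 e1e]] : exists e1 : R, [/\ 0 < e1, e1 <= 1 & 8 * e1 <= e].
  exists (Num.min 1 (e / 8)); split.
  - by rewrite lt_min ltr01 divr_gt0.
  - by rewrite ge_min lexx.
  - by rewrite mulrC -ler_pdivlMr// ge_min lexx orbT.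
have [d1 d10 h1] := real_derive_expand (is_derive_expR 0) e10.
have [d2 d20 h2] := real_derive_expand (is_derive_cos 0) e10.
have [d3 d30 h3] := real_derive_expand (is_derive_sin 0) e10.
exists (Num.min e1 (Num.min d1 (Num.min d2 d3))).
  by rewrite !lt_min e10 d10 d20 d30.
move=> h; rewrite !lt_min => /and4P[he hd1 hd2 hd3].
have rn := ler_Re_normc h; have imn := ler_Im_normc h.
have := h1 _ (le_lt_trans rn hd1); have := h2 _ (le_lt_trans imn hd2).
have := h3 _ (le_lt_trans imn hd3).
rewrite !(add0r, expR0, cos0, sin0, oppr0, mul0r, subr0, mul1r).
set x := complex.Re h in rn *; set y := complex.Im h in imn *.
set N := normc h in he hd1 hd2 hd3 rn imn *.
move=> s1 s2 s3.
have N0 : 0 <= N by exact: normc_ge0.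
have x1 : `|1 + x| <= 2.
  rewrite (le_trans (ler_normD _ _))// normr1 -[leRHS]/(1 + 1) lerD2l.
  by rewrite (le_trans rn)// (le_trans (ltW he)).
have E0 (u v : R) : 0 <= u -> u <= N -> v <= e1 * u -> v <= e1 * N.
  by move=> u0 uN vu; rewrite (le_trans vu)// ler_wpM2l// ltW.
have t1 := E0 _ _ (normr_ge0 _) imn s1.
have t2 := E0 _ _ (normr_ge0 _) imn s2.
have t3 := E0 _ _ (normr_ge0 _) rn s3.
have M1 (u v : R) (C : R) : `|u| <= e1 * N -> `|v| <= C -> `|u * v| <= C * (e1 * N).
  by move=> hu hv; rewrite normrM mulrC ler_pM.
apply: le_trans (normc_le_ReIm _) _.
have cb : `|cos y| <= 1 by rewrite ler_norml cos_geN1 cos_le1.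
have sb : `|sin y| <= 1 by rewrite ler_norml sin_geN1 sin_le1.
have -> : complex.Re (cexp h - 1 - h) = (expR x - 1 - x) * cos y + (cos y - 1) * (1 + x).
  by rewrite /cexp !ReB ReM /= -/x -/y; ring.
have -> : complex.Im (cexp h - 1 - h) = (expR x - 1 - x) * sin y + (sin y - y) * (1 + x) + x * y.
  by rewrite /cexp !ImB ImM /= -/x -/y; ring.
have xy : `|x * y| <= e1 * N.
  by rewrite normrM ler_pM// (le_trans rn)// ltW.
apply: le_trans (lerD (ler_normD _ _) (le_trans (ler_normD _ _) (lerD (ler_normD _ _) (lexx _)))) _.
have := M1 _ _ _ t3 cb; have := M1 _ _ _ t3 sb.
have := M1 _ _ _ t2 x1; have := M1 _ _ _ t1 x1 => a1 a2 a3 a4.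
have : 8 * e1 * N <= e * N by rewrite ler_wpM2r.
have : 0 <= e1 * N by rewrite mulr_ge0// ltW.
move: a1 a2 a3 a4 xy; rewrite !mul1r -!mulrA; move: (e1 * N) (e * N) `|_ * _| `|_ * _| `|_ * _| `|_ * _| `|_ * _|.
clear; move=> ? ? ? ? ? ? ?; lra.
Qed.

Lemma cdiff_cexp z : cdiff cexp z (cexp z).
Proof.
move=> e e0; have c0 := cexp_neq0 z; have n0 : 0 < normc (cexp z) by rewrite normc_gt0.
have [d d0 hd] := cexp0_expand (divr_gt0 e0 n0).
exists d => // w wd; have := hd _ wd.
rewrite mulrAC ler_pdivlMr// mulrC -normcM !mulrBr mulr1 -cexpD.
by rewrite [z + _]addrC subrK.
Qed.

Lemma derivable_cexp z : derivable cexp z 1.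
Proof. exact: cdiff_derivable (@cdiff_cexp z). Qed.

End ComplexDerivative.

(** * Integration over the circle *)

Section CircleIntegral.
Variable R : realType.
Local Notation C := R[i].
Local Notation T := (@unit_circle R : set (borelC R)).
Local Notation m := (@circle_measure R).
Local Notation lam := (@lebesgue_measure R).
Local Notation I01 := (`[0%R, 1%R]%classic : set (measurableTypeR R)).

Lemma measurable_T : measurable T.
Proof. exact: measurable_unit_circle. Qed.

Lemma circle_measure_T : m T = 1%E.
Proof.
rewrite /circle_measure /pushforward (_ : _ @^-1` _ = setT).
  by rewrite /mrestr setTI lebesgue_measure_itv /= lte_fin ltr01 oppr0 adde0.
by apply/seteqP; split => // t _; exact: normc_cis.
Qed.

Lemma expi2pi_T (t : R) : T (@expi2pi R t).
Proof. exact: normc_cis. Qed.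

Lemma integral_mrestr_ge0 d (X : measurableType d) (mu : {measure set X -> \bar R})
    (D : set X) (mD : measurable D) (f : X -> \bar R) :
  measurable_fun setT f -> (forall x, (0 <= f x)%E) ->
  (\int[mrestr mu mD]_x f x = \int[mu]_(x in D) f x)%E.
Proof.
move=> mf f0.
have mDC := measurableC mD.
rewrite -[in LHS](setUv D) ge0_integral_setU//=; last 2 first.
- by rewrite setUv.
- by apply/disj_setPS; rewrite setICr.
rewrite [X in (_ + X)%E](_ : _ = 0%E) ?adde0.
  apply: eq_measure_integral => A mA AD; exact: (@congr1 _ _ mu (A `&` D) A (setIidl AD)).
apply: etrans (integral_measure_zero (~` D) f).
apply: eq_measure_integral => A mA AD.
have AD0 : A `&` D = set0 by apply/disjoints_subset.
exact: (etrans (congr1 mu AD0) (measure0 mu)).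
Qed.

Lemma circle_integral_ge0 (u : C -> \bar R) : measurable_fun T (u : borelC R -> \bar R) ->
  (forall z, T z -> (0 <= u z)%E) ->
  (\int[m]_(z in T) u z = \int[lam]_(t in I01) u (@expi2pi R t))%E.
Proof.
move=> mu u0.
pose nu : {measure set (measurableTypeR R) -> \bar R} :=
  mrestr lam (measurable_itv `[0%R, 1%R]).
have := @ge0_integral_pushforward _ _ (measurableTypeR R) _ R _ (@measurable_expi2pi R) nu T u measurable_T mu.
rewrite (_ : _ @^-1` _ = setT); last first.
  by apply/seteqP; split => // t _; exact: normc_cis.
have mue : measurable_fun setT (u \o @expi2pi R).
  apply: (measurable_comp measurable_T _ mu (@measurable_expi2pi R)).
  by move=> _ [t _ <-]; exact: expi2pi_T.
rewrite integral_mrestr_ge0//; last by move=> x; apply: u0; exact: expi2pi_T.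
by apply => z; rewrite inE => /u0.
Qed.

Lemma circle_integral_expi (u : C -> R) : measurable_fun T (u : borelC R -> R) ->
  Rintegral m T u = Rintegral lam I01 (u \o @expi2pi R).
Proof.
move=> mu; have mu' : measurable_fun T (EFin \o u : borelC R -> \bar R).
  exact/measurable_EFinP.
congr fine; rewrite [LHS]integralE [RHS]integralE; congr (_ - _)%E.
  have := circle_integral_ge0 (measurable_funepos mu') (fun z _ => funepos_ge0 _ z).
  by move=> ->; apply: eq_integral => t _; rewrite !funeposE.
have := circle_integral_ge0 (measurable_funeneg mu') (fun z _ => funeneg_ge0 _ z).
by move=> ->; apply: eq_integral => t _; rewrite !funenegE.
Qed.

Lemma circle_cintE (f : C -> C) : cmeas T (f : borelC R -> C) ->
  circle_integral f = itv_cint 0 1 (f \o @expi2pi R).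
Proof. by move=> [f1 f2]; rewrite /circle_integral !circle_integral_expi. Qed.

Lemma circle_Rintegral_cst (c : R) : Rintegral m T (fun=> c) = c.
Proof.
have -> := @Rintegral_cst _ (borelC R) R m T measurable_T c.
by rewrite -[RHS]mulr1; congr (_ * _); exact: (congr1 fine circle_measure_T).
Qed.

Lemma circle_integral_cst (c : C) : circle_integral (fun=> c) = c.
Proof. by rewrite /circle_integral !circle_Rintegral_cst; case: c. Qed.

Lemma circle_integrable_cst (c : R) : m.-integrable T (EFin \o (fun=> c)).
Proof. exact: (finite_measure_integrable_cst _ c measurable_T). Qed.

Lemma circle_integrable_bounded (f : C -> C) (M : R) : cmeas T (f : borelC R -> C) ->
  (forall z, T z -> normc (f z) <= M) -> circle_integrable f.
Proof.
move=> mf fM; apply: (le_cintegrable measurable_T mf (circle_integrable_cst M) fM).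
Qed.

Lemma circle_integrableD (f g : C -> C) : circle_integrable f -> circle_integrable g ->
  circle_integrable (fun z => f z + g z).
Proof. exact: (cintegrableD measurable_T). Qed.

Lemma circle_integrableZ c (f : C -> C) : circle_integrable f ->
  circle_integrable (fun z => c * f z).
Proof. exact: (cintegrableZ measurable_T). Qed.

Lemma eq_circle_integrable (f g : C -> C) : (forall z, T z -> f z = g z) ->
  circle_integrable f -> circle_integrable g.
Proof. exact: (eq_cintegrable measurable_T). Qed.

Lemma circle_integrableB (f g : C -> C) : circle_integrable f -> circle_integrable g ->
  circle_integrable (fun z => f z - g z).
Proof.
move=> cf cg; have := circle_integrableD cf (circle_integrableZ (-1) cg).
by apply: eq_circle_integrable => z _; rewrite mulN1r.
Qed.

Lemma circle_integralD (f g : C -> C) : circle_integrable f -> circle_integrable g ->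
  circle_integral (fun z => f z + g z) = circle_integral f + circle_integral g.
Proof. exact: (cintD measurable_T). Qed.

Lemma circle_integralZ c (f : C -> C) : circle_integrable f ->
  circle_integral (fun z => c * f z) = c * circle_integral f.
Proof. exact: (cintZ measurable_T). Qed.

Lemma circle_integralB (f g : C -> C) : circle_integrable f -> circle_integrable g ->
  circle_integral (fun z => f z - g z) = circle_integral f - circle_integral g.
Proof. exact: (cintB measurable_T). Qed.

Lemma eq_circle_integral (f g : C -> C) : (forall z, T z -> f z = g z) ->
  circle_integral f = circle_integral g.
Proof. exact: eq_cint. Qed.

Lemma circle_integral_conj (f : C -> C) : circle_integrable f ->
  circle_integral (fun z => (f z)^*%C) = (circle_integral f)^*%C.
Proof.
move=> [f1 f2]; rewrite /circle_integral /=; congr Complex.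
  by apply: eq_Rintegral => z _; case: (f z).
rewrite -mulN1r -(RintegralZl (-1) measurable_T f2).
by apply: eq_Rintegral => z _; case: (f z) => a b; rewrite mulN1r.
Qed.

(** On the circle the preimage of an open ray agrees with its interior, which is open and therefore
    Borel; continuity off the circle does not enter. *)
Lemma continuous_measurable_T (g : C -> R) :
  (forall z, T z -> g w @[w --> z] --> g z) -> measurable_fun T (g : borelC R -> R).
Proof.
move=> cg; apply: (measurability _ (RGenOInfty.measurableE R)) => _ [_ [x ->] <-].
rewrite (_ : _ `&` _ = T `&` interior (g @^-1` `]x, +oo[)).
  apply: measurableI; first exact: measurable_T.
  by apply: measurable_openC; exact: open_interior.
apply/seteqP; split => z [Tz]; last by move/interior_subset.
move=> gz; split => //; apply: (cg z Tz); apply: open_nbhs_nbhs; split => //.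
Qed.

Lemma continuous_cmeas_T (f : C -> C) :
  (forall z, T z -> f w @[w --> z] --> f z) -> cmeas T (f : borelC R -> C).
Proof.
by move=> cf; split; apply: continuous_measurable_T => z /cf /cvgc_ReIm[].
Qed.

End CircleIntegral.

Section AnnulusMean.
Variable R : realType.
Local Notation C := R[i].
Implicit Types (F : C -> C).

Definition circle_mean F (r : R) : C := circle_integral (fun z => F (r%:C * z)).

Lemma continuous_scale (c z : C) : c * w @[w --> z] --> c * z.
Proof. exact: mulrl_continuous. Qed.

Lemma normc_scale_T (r : R) z : 0 <= r -> unit_circle z -> normc (r%:C * z) = r.
Proof. by move=> r0 z1; rewrite normcM z1 mulr1 normc_real ger0_norm. Qed.

Lemma circle_cmeas F (r : R) : 0 <= r ->
  (forall z, normc z = r -> F w @[w --> z] --> F z) ->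
  cmeas (@unit_circle R : set (borelC R)) (fun z : borelC R => F (r%:C * z)).
Proof.
move=> r0 cF; apply: continuous_cmeas_T => z Tz.
have cFz : F w @[w --> r%:C * z] --> F (r%:C * z).
  by apply: cF; exact: normc_scale_T.
exact: (cvg_comp _ _ (@continuous_scale r%:C z) cFz).
Qed.

Definition polar F (s t : R) : C := F ((expR s)%:C * @expi2pi R t).

(** The chain rule for [F] composed with the exponential, in the variable [s + 2 pi i t]: the
    logarithm of the radius and the angle in turns. *)
Lemma strip_differentiable_polar F (s t : R) :
  derivable F ((expR s)%:C * @expi2pi R t) 1 ->
  strip_differentiable (2 * pi) (polar F) s t.
Proof.
move=> /derivable_cdiff[L].
pose E (s t : R) : C := (expR s)%:C * @expi2pi R t.
have EE s' t' : E s' t' = cexp (s' +i* (2 * pi * t')) by [].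
rewrite [cdiff _ _ _]/(cdiff F (E s t) L) => hL.
have k0 : 0 <= 2 * pi :> R by rewrite mulr_ge0// pi_ge0.
have HE s' t' : polar F s' t' = F (E s' t') by [].
move: E EE HE k0 hL; rewrite /strip_differentiable; move: (polar F) (2 * pi) => H k E EE HE k0 hL.
have cE : cdiff (@cexp R) (s +i* (k * t)) (E s t) by rewrite EE; exact: cdiff_cexp.
exists (L * E s t) => e e0.
set N := normc (E s t); have N0 : 0 <= N by exact: normc_ge0.
have L0 := normc_ge0 L.
(* Half of [e] pays for the expansion of [F], half for that of the exponential. The cap [1] in [e2]
   bounds the increment of the exponential by [(N + 1) * normc h]. *)
pose e1 := e / (2 * (N + 1)); pose e2 := Num.min 1 (e / (2 * (normc L + 1))).
have N2 : 0 < 2 * (N + 1) by rewrite mulr_gt0// ltr_wpDl.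
have L2 : 0 < 2 * (normc L + 1) by rewrite mulr_gt0// ltr_wpDl.
have e10 : 0 < e1 by rewrite divr_gt0.
have e20 : 0 < e2 by rewrite lt_min ltr01 divr_gt0.
have [d1 d10 h1] := hL _ e10; have [d2 d20 h2] := cE _ e20.
pose d3 := Num.min d2 (d1 / (N + 1)).
have d30 : 0 < d3 by rewrite lt_min d20 divr_gt0// ltr_wpDl.
exists (d3 / (2 * (k + 1))); first by rewrite divr_gt0// mulr_gt0// ltr_wpDl.
move=> s' t'; rewrite !ltr_pdivlMr; try by rewrite mulr_gt0// ltr_wpDl.
move=> hs ht.
set h := (s' - s) +i* (k * (t' - t)).
have hE : (s' +i* (k * t')) - (s +i* (k * t)) = h.
  by apply/eqP; rewrite eq_complex /= mulrBr !eqxx.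
have nh : normc h <= `|s' - s| + k * `|t' - t|.
  by rewrite (le_trans (normc_le_ReIm _))//= normrM (ger0_norm k0).
have nhd : normc h < d3.
  rewrite (le_lt_trans nh)// -(ltr_pM2r (ltr0n _ 2)).
  have k1 : 0 < k + 1 by rewrite ltr_wpDl.
  rewrite -(ltr_pM2r k1).
  have -> : (`|s' - s| + k * `|t' - t|) * 2 * (k + 1) =
    `|s' - s| * (2 * (k + 1)) + k * (`|t' - t| * (2 * (k + 1))) by ring.
  have -> : d3 * 2 * (k + 1) = d3 + k * d3 + (d3 + k * d3) by ring.
  have kd : k * (`|t' - t| * (2 * (k + 1))) <= k * d3 by rewrite ler_wpM2l// ltW.
  have d30' := ltW d30.
  rewrite (lt_le_trans (ltr_leD hs kd))// lerDl.
  exact: addr_ge0 d30' (mulr_ge0 k0 d30').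
have := h2 (s' +i* (k * t')); rewrite hE -!EE => /(_ _) h2'.
have {}h2' : normc (E s' t' - E s t - E s t * h) <= e2 * normc h.
  by apply: h2'; rewrite (lt_le_trans nhd)// ge_min lexx.
have dE : normc (E s' t' - E s t) <= (N + 1) * normc h.
  rewrite -(subrK (E s t * h) (_ - _)) (le_trans (le_normcD _ _))//.
  rewrite normcM -/N mulrDl mul1r addrC lerD2l (le_trans h2')//.
  by rewrite ler_piMl ?normc_ge0// ge_min lexx.
have := h1 (E s' t') _ => /(_ _) h1'.
have {}h1' : normc (F (E s' t') - F (E s t) - L * (E s' t' - E s t)) <= e1 * normc (E s' t' - E s t).
  apply: h1'; rewrite (le_lt_trans dE)// mulrC -ltr_pdivlMr ?ltr_wpDl//.
  by rewrite (lt_le_trans nhd)// ge_min lexx orbT.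
have -> : H s' t' - H s t - L * E s t * h = (F (E s' t') - F (E s t) - L * (E s' t' - E s t)) +
   L * (E s' t' - E s t - E s t * h) by rewrite !HE; ring.
apply: le_trans (le_normcD _ _) _; rewrite normcM.
apply: le_trans (lerD h1' (ler_wpM2l L0 h2')) _.
apply: (@le_trans _ _ (e * normc h)); last by rewrite ler_wpM2l// ltW.
apply: le_trans (lerD (ler_wpM2l (ltW e10) dE) (lexx _)) _.
rewrite mulrA mulrA -mulrDl ler_wpM2r ?normc_ge0//.
have -> : e1 * (N + 1) = e / 2 by rewrite /e1; field; rewrite gt_eqF// ltr_wpDl.
have : normc L * e2 <= e / 2.
  apply: (@le_trans _ _ ((normc L + 1) * (e / (2 * (normc L + 1))))).
    by rewrite ler_pM ?(ltW e20)// ?lerDl// ge_min lexx orbT.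
  rewrite le_eqVlt; apply/orP; left; apply/eqP; field; rewrite gt_eqF// ltr_wpDl//.
by move=> hh; rewrite [leRHS]splitr lerD2l.
Qed.

(** In logarithmic coordinates the annulus is a rectangle and [polar F] has period 1 in the angle.
    The two sides of constant angle cancel, and Goursat's theorem equates the other two, which are
    the means. *)
Lemma circle_mean_annulus F (p q : R) : 0 < p -> p <= q ->
  (forall z, p <= normc z <= q -> derivable F z 1) ->
  circle_mean F p = circle_mean F q.
Proof.
move=> p0 pq dF; have q0 := lt_le_trans p0 pq.
have k0 : 0 <= 2 * pi :> R by rewrite mulr_ge0// pi_ge0.
have dH s t : ln p <= s <= ln q -> 0 <= t <= 1 ->
    strip_differentiable (2 * pi) (polar F) s t.
  move=> /andP[ps sq] _; apply: strip_differentiable_polar; apply: dF.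
  rewrite normcM normc_real ger0_norm ?expR_ge0// [normc _]normc_cis mulr1.
  apply/andP; split.
    by rewrite -[leLHS]lnK ?posrE// ler_expR.
  by rewrite -[leRHS]lnK ?posrE// ler_expR.
have := goursat_rectangle k0 _ ler01 dH; rewrite ler_ln ?posrE// => /(_ pq).
have per : (polar F)^~ 0 = (polar F)^~ 1.
  apply/funext => s; rewrite /polar; congr (F (_ * _)).
  rewrite /expi2pi mulr1 mulr0 cos0 sin0.
  by rewrite [2 * pi]mulr_natl cos2pi sin2pi.
have mE r : p <= r -> r <= q -> circle_mean F r = itv_cint 0 1 (polar F (ln r)).
  move=> pr rq; have r0 := lt_le_trans p0 pr.
  rewrite /circle_mean circle_cintE.
    by apply: eq_itv_cint => t _; rewrite /polar lnK.
  apply: circle_cmeas; first exact: ltW.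
  by move=> z zr; apply/derivable_continuous/dF; rewrite zr pr rq.
rewrite (mE p (lexx p) pq) (mE q pq (lexx q)).
rewrite /rect_int per subrr add0r.
move: (itv_cint 0 1 _) (itv_cint 0 1 _) => J1 J2 /eqP.
rewrite mulf_eq0 => /orP[|].
  by rewrite eq_complex /= eqxx /= mulf_eq0 pnatr_eq0/= gt_eqF// pi_gt0.
by rewrite subr_eq0 => /eqP.
Qed.

End AnnulusMean.

Section DerivativeRules.
Variable R : realType.
Local Notation C := R[i].
Implicit Types (F G : C -> C) (z w : C).

Lemma cderiv_cst (c z : C) : derivable (fun _ : C => c) z 1.
Proof. exact: derivable_cst. Qed.

Lemma cderiv_id z : derivable (fun w : C => w) z 1.
Proof. exact: derivable_id. Qed.

Lemma cderivN F z : derivable F z 1 -> derivable (fun w => - F w) z 1.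
Proof. exact: derivableN. Qed.

Lemma cderivB F G z : derivable F z 1 -> derivable G z 1 ->
  derivable (fun w => F w - G w) z 1.
Proof. exact: derivableB. Qed.

Lemma cderivM F G z : derivable F z 1 -> derivable G z 1 ->
  derivable (fun w => F w * G w) z 1.
Proof. exact: derivableM. Qed.

Lemma cderivV F z : F z != 0 -> derivable F z 1 ->
  derivable (fun w => (F w)^-1) z 1.
Proof. exact: derivableV. Qed.

Lemma cderiv_comp F G z : derivable G z 1 -> derivable F (G z) 1 ->
  derivable (fun w => F (G w)) z 1.
Proof.
move=> /derivable1_diffP dG /derivable1_diffP dF.
by apply/derivable1_diffP; exact: differentiable_comp dG dF.
Qed.

Lemma cderiv_scale F (c z : C) : derivable F (c * z) 1 ->
  derivable (fun w => F (c * w)) z 1.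
Proof.
have dcz : derivable (fun w => c * w) z 1.
  exact: cderivM (@cderiv_cst c z) (@cderiv_id z).
by move=> dF; have := cderiv_comp dcz dF.
Qed.

Lemma cderiv_conj F z : derivable F z^*%C 1 ->
  derivable (fun w => (F w^*%C)^*%C) z 1.
Proof.
move=> /derivable_cdiff[L hL]; apply: (@cdiff_derivable _ _ _ L^*%C) => e /hL[d d0 hd].
exists d => // w wd; have E (u v : C) : u^*%C - v^*%C = (u - v)^*%C by rewrite rmorphB.
have := hd w^*%C; rewrite E normc_conj => /(_ wd).
rewrite -[in X in X -> _]normc_conj.
have -> // : (F w^*%C - F z^*%C - L * (w - z)^*%C)^*%C = (F w^*%C)^*%C - (F z^*%C)^*%C - L^*%C * (w - z).
by rewrite 2!rmorphB rmorphM /= conjcK.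
Qed.

Lemma cderiv_near F G z (d : R) : 0 < d ->
  (forall w, normc (w - z) < d -> F w = G w) -> derivable F z 1 -> derivable G z 1.
Proof.
move=> d0 FG; apply: near_eq_derivable; apply/nbhsc_normP; exists d => // w.
by rewrite normc_sub; exact: FG.
Qed.

End DerivativeRules.

#[global] Instance complex_nbhs_filter (R : realType) (z : R[i]) : Filter (nbhs z).
Proof. exact: nbhs_filter. Qed.

Arguments cderiv_cst {R} c z.
Arguments cderiv_id {R} z.

Section ClosedDisk.
Variable R : realType.
Local Notation C := R[i].
Implicit Types (F G : C -> C) (z w : C).

Definition closed_disk : set C := [set z | normc z <= 1].

Lemma compact_closed_disk : compact closed_disk.
Proof.
pose f (p : R * R) : C := p.1 +i* p.2.
pose Q : set (R * R) := `[-1, 1] `*` `[-1, 1].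
have cf : continuous f.
  move=> p; apply/cvgc_ReIm; split => /=; [exact: cvg_fst|exact: cvg_snd].
have cQ : compact (f @` Q).
  apply: continuous_compact; first exact: continuous_subspaceT.
  by apply: compact_setX; exact: segment_compact.
apply: (subclosed_compact _ cQ).
  rewrite [closed_disk](_ : _ = @normc R @^-1` [set x | x <= 1])//.
  apply: preimage_closed; last exact: closed_le.
  by move=> z _; exact: normc_continuous.
move=> z z1; exists (complex.Re z, complex.Im z); last by case: z {z1}.
have h1 := ler_Re_normc z; have h2 := ler_Im_normc z.
by split; rewrite /= in_itv /= -ler_norml; [exact: le_trans h1 _|exact: le_trans h2 _].
Qed.

Lemma closed_disk_bounded F : (forall z, normc z <= 1 -> F w @[w --> z] --> F z) ->
  exists M : R, forall z, normc z <= 1 -> normc (F z) <= M.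
Proof.
move=> cF; have /compact_near_coveringP := compact_closed_disk.
move=> /(_ R (pinfty_nbhs R) (fun M z => normc (F z) <= M) _).
case.
  move=> z z1; have := cF z z1 => /cvgc_normP /(_ 1 ltr01) hz.
  exists ([set w | normc (F z - F w) < 1], [set M | normc (F z) + 1 <= M]).
    split; last by apply: nbhs_pinfty_ge; exact: num_real.
    exact: hz.
  move=> [w M] [/= hw hM]; rewrite (le_trans _ hM)//.
  rewrite -lerBlDl (le_trans (lerB_normc _ _))// normc_sub ltW//.
move=> N [_ hN]; exists (N + 1) => z z1; apply: hN => //; exact: ltr_pwDr.
Qed.

Lemma closed_disk_unif F : (forall z, normc z <= 1 -> F w @[w --> z] --> F z) ->
  forall e : R, 0 < e -> exists2 d : R, 0 < d & forall z w, normc z <= 1 -> normc w <= 1 ->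
    normc (z - w) < d -> normc (F z - F w) < e.
Proof.
move=> cF e e0; have /compact_near_coveringP := compact_closed_disk.
move=> /(_ R (0^'+) (fun d z => forall w, normc w <= 1 -> normc (z - w) < d -> normc (F z - F w) < e) _).
case.
  move=> z z1; have := cF z z1 => /cvgc_normP /(_ (e / 2) (divr_gt0 e0 (ltr0n _ 2))).
  move=> /nbhsc_normP[d d0 hd].
  exists ([set w | normc (z - w) < d / 2], [set x | x < d / 2]).
    split; last by apply: nbhs_right_lt; rewrite divr_gt0.
    by apply/nbhsc_normP; exists (d / 2) => //; rewrite divr_gt0.
  move=> [w x] [/= hw hx] v v1 wv.
  have h1 : normc (F z - F w) < e / 2.
    by apply: hd; rewrite (lt_trans hw)// ltr_pdivrMr// ltr_pMr// ltr1n.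
  have h2 : normc (F z - F v) < e / 2.
    apply: hd; rewrite -(subrKA w) (le_lt_trans (le_normcD _ _))//.
    by rewrite [ltRHS]splitr ltrD// (lt_trans wv).
  rewrite -(subrKA (F z)) (le_lt_trans (le_normcD _ _))//.
  by rewrite [ltRHS]splitr ltrD// normc_sub.
move=> d /= d0 hd; exists (d / 2); first by rewrite divr_gt0.
move=> z w z1 w1 zw; apply: (hd (d / 2)) => //=; last by rewrite divr_gt0.
by rewrite sub0r normrN gtr0_norm ?divr_gt0// ltr_pdivrMr// ltr_pMr// ltr1n.
Qed.

End ClosedDisk.

Section MeanValue.
Variable R : realType.
Local Notation C := R[i].
Local Notation T := (@unit_circle R : set (borelC R)).
Local Notation m := (@circle_measure R).
Implicit Types (F G : C -> C) (z w a : C).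

Lemma scale_disk (r : R) z : 0 <= r <= 1 -> unit_circle z -> normc (r%:C * z) <= 1.
Proof. by move=> /andP[r0 r1] z1; rewrite normc_scale_T. Qed.

Lemma circle_cmeas_disk F (r : R) : 0 <= r <= 1 ->
  (forall z, normc z <= 1 -> F w @[w --> z] --> F z) ->
  cmeas T (fun z : borelC R => F (r%:C * z)).
Proof.
move=> /andP[r0 r1] cF; apply: circle_cmeas => // z zr; apply: cF.
by rewrite zr.
Qed.

Lemma circle_integrable_disk F (r : R) : 0 <= r <= 1 ->
  (forall z, normc z <= 1 -> F w @[w --> z] --> F z) ->
  circle_integrable (fun z => F (r%:C * z)).
Proof.
move=> r01 cF; have [M hM] := closed_disk_bounded cF.
apply: (circle_integrable_bounded (M := M)); first exact: circle_cmeas_disk.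
by move=> z Tz; apply: hM; exact: scale_disk.
Qed.

Lemma normc_circle_integral_le (f : C -> C) (M : R) : circle_integrable f ->
  (forall z, T z -> normc (f z) <= M) -> normc (circle_integral f) <= M.
Proof.
move=> fi fM; rewrite (le_trans (normc_cint (@measurable_T R) fi))//.
rewrite -[leRHS](@circle_Rintegral_cst R); apply: (le_Rintegral (@measurable_T R) (cintegrable_normc (@measurable_T R) fi)) => //.
exact: circle_integrable_cst.
Qed.

Lemma circle_mean0 F : circle_mean F 0 = F 0.
Proof.
rewrite /circle_mean (_ : (fun _ => _) = fun=> F 0) ?circle_integral_cst//.
by apply/funext => z; rewrite mul0r.
Qed.

Lemma circle_mean_continuous F : (forall z, normc z <= 1 -> F w @[w --> z] --> F z) ->
  forall e : R, 0 < e -> exists2 d : R, 0 < d & forall r s : R, 0 <= r <= 1 -> 0 <= s <= 1 ->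
    `|r - s| < d -> normc (circle_mean F r - circle_mean F s) <= e.
Proof.
move=> cF e e0; have [d d0 hd] := closed_disk_unif cF e0; exists d => // r s r1 s1 rs.
rewrite /circle_mean -circle_integralB; [|exact: circle_integrable_disk..].
apply: normc_circle_integral_le.
  by apply: circle_integrableB; exact: circle_integrable_disk.
move=> z Tz; apply/ltW/hd; try exact: scale_disk.
by rewrite -mulrBl normcM Tz mulr1 -rmorphB normc_real.
Qed.

(* The mean over circles is constant on both sides of the exceptional radius [q]
   and continuous in the radius. *)
Lemma mean_value F (q : R) : 0 <= q < 1 ->
  (forall z, normc z <= 1 -> F w @[w --> z] --> F z) ->
  (forall z, 0 < normc z <= 1 -> normc z != q -> derivable F z 1) ->
  circle_mean F 1 = F 0.
Proof.
move=> /andP[q0 q1] cF dF.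
have mc := circle_mean_continuous cF.
have eqP2 (u v : C) : (forall e : R, 0 < e -> normc (u - v) <= e) -> u = v.
  move=> h; apply/eqP; rewrite -subr_eq0 -normc_eq0 eq_le normc_ge0 andbT.
  by apply/ler_addgt0Pr => e e0; rewrite add0r; exact: h.
have below r : 0 < r -> r < q -> circle_mean F r = F 0.
  move=> r0 rq; rewrite -circle_mean0; apply: eqP2 => e /mc[d d0 hd].
  pose s := Num.min r (d / 2).
  have s0 : 0 < s by rewrite lt_min r0 divr_gt0.
  have sr : s <= r by rewrite ge_min lexx.
  have sd : s < d.
    by rewrite gt_min; apply/orP; right; rewrite ltr_pdivrMr// ltr_pMr// ltr1n.
  rewrite -(@circle_mean_annulus _ F s r)//.
    apply: hd; rewrite ?lexx ?ler01 ?(ltW s0)//=.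
      by rewrite (le_trans sr)// (le_trans (ltW rq))// ltW.
    by rewrite subr0 gtr0_norm.
  move=> z /andP[z1 z2]; apply: dF.
    by rewrite (lt_le_trans s0)//= (le_trans z2)// (le_trans (ltW rq))// ltW.
  by rewrite lt_eqF// (le_lt_trans z2).
have atq : circle_mean F q = F 0.
  move: q0; rewrite le_eqVlt => /orP[/eqP<-|q0]; first exact: circle_mean0.
  apply: eqP2 => e /mc[d d0 hd].
  pose s := Num.max (q / 2) (q - d / 2).
  have s0 : 0 < s by rewrite lt_max divr_gt0.
  have sq : s < q.
    by rewrite gt_max ltr_pdivrMr// ltr_pMr// ltr1n /= gtrBl divr_gt0.
  rewrite -(below s)//; apply: hd; rewrite ?(ltW q0) ?(ltW q1) ?(ltW s0)//=.
    by rewrite (le_trans (ltW sq))// ltW.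
  rewrite gtr0_norm ?subr_gt0// ltrBlDl -ltrBlDr.
  by rewrite lt_max; apply/orP; right; rewrite ltrD2l ltrN2 ltr_pdivrMr// ltr_pMr// ltr1n.
rewrite -atq; apply: eqP2 => e /mc[d d0 hd].
pose s := Num.min ((q + 1) / 2) (q + d / 2).
have sq : q < s.
  by rewrite lt_min ltrDl divr_gt0// andbT ltr_pdivlMr// mulrDr mulr1 ltrD2l.
have s1 : s <= 1.
  by rewrite ge_min ler_pdivrMr// mul1r -[leRHS]/(1 + 1) lerD2r (ltW q1).
have s0 : 0 < s by exact: le_lt_trans sq.
rewrite -(@circle_mean_annulus _ F s 1)//.
  apply: hd; rewrite ?(ltW s0) ?s1 ?q0 ?(ltW q1)//.
  rewrite gtr0_norm ?subr_gt0// ltrBlDl.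
  by rewrite gt_min; apply/orP; right; rewrite ltrD2l ltr_pdivrMr// ltr_pMr// ltr1n.
move=> z /andP[z1 z2]; apply: dF.
  by rewrite (lt_le_trans s0)//=.
by rewrite gt_eqF// (lt_le_trans sq).
Qed.

Lemma circle_integral_disk F : (forall z, normc z <= 1 -> derivable F z 1) ->
  circle_integral F = F 0.
Proof.
move=> dF; have q : 0 <= (0 : R) < 1 by rewrite lexx ltr01.
have cF z : normc z <= 1 -> F w @[w --> z] --> F z.
  by move=> z1; apply: derivable_continuous; exact: dF.
have dF' z : 0 < normc z <= 1 -> normc z != 0 -> derivable F z 1.
  by move=> /andP[_ z1] _; exact: dF.
rewrite -(mean_value q cF dF'); apply: eq_circle_integral => z _.
by rewrite mul1r.
Qed.

End MeanValue.

(** * Cauchy and Poisson integrals *)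

Section Kernels.
Variable R : realType.
Local Notation C := R[i].
Local Notation T := (@unit_circle R : set (borelC R)).
Local Notation m := (@circle_measure R).
Implicit Types (F G : C -> C) (z w a : C).

(** On the circle [dz / (2 pi i) = z dm], so this is the kernel [1 / (z - a)] of Cauchy's formula
    relative to [m]. *)
Definition cauchy_kernel a z : C := z / (z - a).

Definition poisson a z : R := (1 - normc a ^+ 2) / normc (z - a) ^+ 2.

Lemma circle_sub_ge a z : unit_circle z -> 1 - normc a <= normc (z - a).
Proof. by move=> <-; exact: lerB_normc. Qed.

Lemma circle_sub_gt0 a z : normc a < 1 -> unit_circle z -> 0 < normc (z - a).
Proof. by move=> a1 /(circle_sub_ge a); apply: lt_le_trans; rewrite subr_gt0. Qed.

Lemma circle_sub_neq0 a z : normc a < 1 -> unit_circle z -> z - a != 0.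
Proof. by move=> a1 z1; rewrite -normc_gt0 circle_sub_gt0. Qed.

Lemma circle_neq0 z : unit_circle z -> z != 0.
Proof. by move=> z1; rewrite -normc_gt0 z1 ltr01. Qed.

Lemma circle_conj z : unit_circle z -> z * z^*%C = 1.
Proof. by move=> z1; rewrite mulc_conj z1 expr1n. Qed.

Lemma one_sub_conj_neq0 a z : normc a < 1 -> normc z <= 1 -> 1 - a^*%C * z != 0.
Proof.
move=> a1 z1; rewrite -normc_gt0 (lt_le_trans _ (lerB_normc _ _))//.
rewrite normc1 subr_gt0 normcM normc_conj (le_lt_trans _ a1)//.
by rewrite ler_piMr// normc_ge0.
Qed.

Lemma poisson_ge0 a z : normc a < 1 -> 0 <= poisson a z.
Proof.
move=> a1; rewrite /poisson divr_ge0 ?sqr_ge0// subr_ge0.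
by rewrite expr_le1// ?normc_ge0// ltW.
Qed.

Lemma poisson_le a z : normc a < 1 -> unit_circle z ->
  poisson a z <= 2 / (1 - normc a).
Proof.
move=> a1 z1; have h := circle_sub_ge a z1; have n0 := normc_ge0 a.
have p0 : 0 < 1 - normc a by rewrite subr_gt0.
have q0 := lt_le_trans p0 h.
rewrite /poisson ler_pdivrMr ?exprn_gt0// mulrAC ler_pdivlMr//.
apply: (@le_trans _ _ (2 * (1 - normc a) ^+ 2)); last first.
  by rewrite ler_wpM2l// ler_pXn2r ?nnegrE// ltW.
have -> : (1 - normc a ^+ 2) * (1 - normc a) = (1 + normc a) * (1 - normc a) ^+ 2 by ring.
by rewrite ler_wpM2r ?sqr_ge0// -[leRHS]/(1 + 1) lerD2l ltW.
Qed.

(** The second summand is analytic in [z] on the closed disk and vanishes at 0, so against analytic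
    functions the Poisson kernel acts like the Cauchy kernel. *)
Lemma poissonE a z : normc a < 1 -> unit_circle z ->
  (poisson a z)%:C = cauchy_kernel a z + a^*%C * z / (1 - a^*%C * z).
Proof.
move=> a1 z1; have h1 := circle_sub_neq0 a1 z1; have z0 := circle_neq0 z1.
have h2 : (z - a)^*%C != 0 by rewrite conjc_eq0.
have -> : 1 - a^*%C * z = z * (z - a)^*%C.
  by rewrite rmorphB /= mulrBr circle_conj// [z * _]mulrC.
have -> : a^*%C * z / (z * (z - a)^*%C) = a^*%C / (z - a)^*%C.
  by move: (z - a)^*%C h2 => u h2; field; rewrite h2 z0.
rewrite /poisson /cauchy_kernel rmorphM fmorphV rmorphB rmorph1 /= -!mulc_conj.
have -> : 1 - a * a^*%C = z * (z - a)^*%C + a^*%C * (z - a).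
  by rewrite rmorphB /= mulrBr (circle_conj z1); move: (a^*%C) => b; ring.
by move: (z - a)^*%C h2 => u h2; field; rewrite h1 h2.
Qed.

Lemma cauchy_kernel_cvg a z : z - a != 0 ->
  cauchy_kernel a w @[w --> z] --> cauchy_kernel a z.
Proof.
move=> h; have dB : derivable (fun w => w - a) z 1.
  exact (cderivB (cderiv_id z) (cderiv_cst a z)).
have dK : derivable (cauchy_kernel a) z 1.
  have -> : cauchy_kernel a = fun w => w * (w - a)^-1 by [].
  exact (cderivM (cderiv_id z) (@cderivV R (fun w => w - a) z h dB)).
exact: derivable_continuous dK.
Qed.

Lemma cauchy_kernel_cmeas a : normc a < 1 -> cmeas T (cauchy_kernel a : borelC R -> C).
Proof.
by move=> a1; apply: continuous_cmeas_T => z Tz; apply: cauchy_kernel_cvg;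
  exact: circle_sub_neq0.
Qed.

Lemma normc_cauchy_kernel a z : normc a < 1 -> unit_circle z ->
  normc (cauchy_kernel a z) <= (1 - normc a)^-1.
Proof.
move=> a1 z1; rewrite normcM z1 mul1r normcV lef_pV2 ?posrE ?circle_sub_gt0//.
  exact: circle_sub_ge.
by rewrite subr_gt0.
Qed.

Lemma poisson_measurable a : normc a < 1 -> measurable_fun T (poisson a : borelC R -> R).
Proof.
move=> a1; apply: continuous_measurable_T => z Tz.
have c : normc (w - a) @[w --> z] --> normc (z - a).
  have dB : derivable (fun w => w - a) z 1.
    exact (cderivB (cderiv_id z) (cderiv_cst a z)).
  exact: cvg_normc (derivable_continuous dB).
have n0 : normc (z - a) ^+ 2 != 0 by rewrite expf_neq0// gt_eqF// circle_sub_gt0.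
rewrite /poisson; set Fz := nbhs z in c *.
have FFz : Filter Fz by exact: nbhs_filter.
have cV : (normc (w - a) ^+ 2)^-1 @[w --> Fz] --> (normc (z - a) ^+ 2)^-1.
  by apply: cvgV => //; exact: (cvgM c c).
by apply: cvgM; [exact: cvg_cst|exact: cV].
Qed.

Lemma poisson_cmeas a : normc a < 1 ->
  cmeas T (fun z : borelC R => (poisson a z)%:C).
Proof. by move=> a1; apply: cmeas_real; exact: poisson_measurable. Qed.

Lemma normc_poisson a z : normc a < 1 -> normc (poisson a z)%:C = poisson a z.
Proof. by move=> a1; rewrite normc_real ger0_norm// poisson_ge0. Qed.

Lemma circle_integrableMr (f k : C -> C) (M : R) : circle_integrable f ->
  cmeas T (k : borelC R -> C) -> (forall z, T z -> normc (k z) <= M) ->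
  circle_integrable (fun z => f z * k z).
Proof.
move=> fi mk kM.
have mT := @measurable_T R.
have h := RintegrableZl mT M (cintegrable_normc mT fi).
apply: (le_cintegrable mT _ h).
  by apply: cmeasM => //; exact: cintegrable_cmeas fi.
by move=> z Tz /=; rewrite normcM mulrC ler_wpM2r ?normc_ge0 ?kM.
Qed.

Lemma circle_integrable_poisson (f : C -> C) a : normc a < 1 -> circle_integrable f ->
  circle_integrable (fun z => f z * (poisson a z)%:C).
Proof.
move=> a1 fi; apply: (circle_integrableMr (M := 2 / (1 - normc a)) fi).
  exact: poisson_cmeas.
by move=> z Tz; rewrite normc_poisson// poisson_le.
Qed.

Lemma circle_integrable_cauchy (f : C -> C) a : normc a < 1 -> circle_integrable f ->
  circle_integrable (fun z => f z * cauchy_kernel a z).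
Proof.
move=> a1 fi; apply: (circle_integrableMr (M := (1 - normc a)^-1) fi).
  exact: cauchy_kernel_cmeas.
by move=> z Tz; rewrite normc_cauchy_kernel.
Qed.

Lemma cderiv_one_sub a z : normc a < 1 -> normc z <= 1 ->
  derivable (fun w => (1 - a^*%C * w)^-1) z 1.
Proof.
move=> a1 z1; apply: (cderivV (F := fun w => 1 - a^*%C * w)).
  exact: one_sub_conj_neq0.
exact (cderivB (cderiv_cst 1 z) (cderivM (cderiv_cst (a^*%C) z) (cderiv_id z))).
Qed.

Lemma circle_integrable_analytic F : (forall z, normc z <= 1 -> derivable F z 1) ->
  circle_integrable F.
Proof.
move=> dF; have r01 : 0 <= (1 : R) <= 1 by rewrite lexx ler01.
have cF z : normc z <= 1 -> F w @[w --> z] --> F z.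
  by move=> z1; exact: (derivable_continuous (dF z z1)).
have := circle_integrable_disk r01 cF.
by apply: eq_circle_integrable => z _; rewrite mul1r.
Qed.

(** On the circle the kernel is the conjugate of [(1 - a^* z)^-1], which is analytic on the closed
    disk with value 1 at 0. *)
Lemma circle_integral_cauchy_kernel a : normc a < 1 ->
  circle_integral (cauchy_kernel a) = 1.
Proof.
move=> a1; pose F w := (1 - a^*%C * w)^-1.
have dF z : normc z <= 1 -> derivable F z 1 by move=> z1; exact: cderiv_one_sub.
transitivity (circle_integral F)^*%C; last first.
  by rewrite circle_integral_disk// /F mulr0 subr0 invr1 rmorph1.
rewrite -circle_integral_conj; last exact: circle_integrable_analytic.
apply: eq_circle_integral => z Tz; have h1 := circle_sub_neq0 a1 Tz.
have z0 := circle_neq0 Tz.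
have zc0 : z^*%C != 0 by rewrite conjc_eq0.
have zc : (z^*%C)^-1 = z.
  by rewrite -[RHS]mulr1 -(mulfV zc0) mulrA (circle_conj Tz) mul1r.
rewrite /F conjc_inv rmorphB rmorph1 rmorphM /= conjcK -(circle_conj Tz) -mulrBl.
by rewrite invfM /cauchy_kernel mulrC zc.
Qed.

Lemma cauchy_formula F a : normc a < 1 ->
  (forall z, normc z <= 1 -> derivable F z 1) ->
  circle_integral (fun z => F z * cauchy_kernel a z) = F a.
Proof.
move=> a1 dF; have [L hL] := derivable_cdiff (dF a (ltW a1)).
(* The difference quotient at [a], completed by the derivative [L] and multiplied by [w]. It is
   continuous, and differentiable except at [a], so [mean_value] applies with exceptional radius
   [normc a]; the factor [w] makes the value at 0 vanish. *)
pose G w := w * (if w == a then L else (F w - F a) / (w - a)).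
have dG z : normc z <= 1 -> z != a -> derivable G z 1.
  move=> z1 za; have za0 : z - a != 0 by rewrite subr_eq0.
  have n0 : 0 < normc (z - a) by rewrite normc_gt0.
  apply: (@cderiv_near _ (fun w => w * ((F w - F a) / (w - a))) _ _ _ n0).
    move=> w hw; rewrite /G; case: eqP => // wa; move: hw.
    by rewrite wa normc_sub ltxx.
  have dB : derivable (fun w => w - a) z 1 := cderivB (cderiv_id z) (cderiv_cst a z).
  have dV : derivable (fun w => (w - a)^-1) z 1 := cderivV (F := fun w => w - a) za0 dB.
  have dN : derivable (fun w => F w - F a) z 1 := cderivB (dF z z1) (cderiv_cst (F a) z).
  exact (cderivM (cderiv_id z) (cderivM dN dV)).
have cG z : normc z <= 1 -> G w @[w --> z] --> G z.
  move=> z1; have [->|za] := eqVneq z a; last exact/derivable_continuous/dG.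
  apply: cvgM; first exact: cvg_id.
  rewrite eqxx; apply/cvgc_normP => e e0.
  have [d d0 hd] := hL _ (divr_gt0 e0 (ltr0n _ 2)).
  apply/nbhsc_normP; exists d => // w hw; case: eqP => [_|/eqP wa].
    by rewrite subrr normc0.
  have wa0 : w - a != 0 by rewrite subr_eq0.
  have n0 : 0 < normc (w - a) by rewrite normc_gt0.
  rewrite normc_sub -(ltr_pM2r n0) -normcM mulrBl mulfVK//.
  have hw' : normc (w - a) < d by rewrite normc_sub.
  rewrite (le_lt_trans (hd w hw'))// ltr_pM2r//.
  by rewrite ltr_pdivrMr// ltr_pMr// ltr1n.
have := @mean_value R G (normc a) _ cG; rewrite a1 normc_ge0 => /(_ isT) hG.
have {}hG : circle_integral G = 0.
  rewrite -[RHS](mul0r (if 0 == a then L else (F 0 - F a) / (0 - a))) -[RHS]/(G 0).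
  rewrite -hG; first by apply: eq_circle_integral => z _; rewrite mul1r.
  move=> z /andP[_ z1] za; apply: dG => //.
  by apply: contra za => /eqP ->.
have GE z : T z -> G z = F z * cauchy_kernel a z - F a * cauchy_kernel a z.
  move=> Tz; have h1 := circle_sub_neq0 a1 Tz.
  rewrite /G ifF; last by rewrite -subr_eq0 (negbTE h1).
  by rewrite /cauchy_kernel; ring.
move: hG; rewrite (eq_circle_integral GE).
have iF := circle_integrable_analytic dF.
have iK : circle_integrable (cauchy_kernel a).
  apply: (circle_integrable_bounded (M := (1 - normc a)^-1)); first exact: cauchy_kernel_cmeas.
  by move=> z Tz; exact: normc_cauchy_kernel.
rewrite circle_integralB; [|exact: circle_integrable_cauchy|exact: circle_integrableZ].
rewrite circle_integralZ// circle_integral_cauchy_kernel// mulr1.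
by move/eqP; rewrite subr_eq0 => /eqP.
Qed.

Lemma poisson_formula F a : normc a < 1 ->
  (forall z, normc z <= 1 -> derivable F z 1) ->
  circle_integral (fun z => F z * (poisson a z)%:C) = F a.
Proof.
move=> a1 dF; pose G z := F z * (a^*%C * z * (1 - a^*%C * z)^-1).
have dG z : normc z <= 1 -> derivable G z 1.
  move=> z1; exact (cderivM (dF z z1)
    (cderivM (cderivM (cderiv_cst _ z) (cderiv_id z)) (cderiv_one_sub a1 z1))).
have iF := circle_integrable_analytic dF.
have PE z : T z -> F z * (poisson a z)%:C = F z * cauchy_kernel a z + G z.
  by move=> Tz; rewrite poissonE// mulrDr.
rewrite (eq_circle_integral PE) circle_integralD; last 2 first.
- exact: circle_integrable_cauchy.
- exact: circle_integrable_analytic.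
by rewrite cauchy_formula// circle_integral_disk// /G mulr0 mul0r mulr0 addr0.
Qed.

Lemma poisson_formula_dilation F a (r : R) : 0 <= r < 1 -> normc a < 1 ->
  analytic_in_disk F ->
  circle_integral (fun z => F (r%:C * z) * (poisson a z)%:C) = F (r%:C * a).
Proof.
move=> /andP[r0 r1] a1 dF.
apply: (@poisson_formula (fun z => F (r%:C * z))) => // z z1.
apply: cderiv_scale; apply: dF; rewrite /unit_disk /= normcM normc_real ger0_norm//.
by rewrite (le_lt_trans _ r1)// ler_piMr.
Qed.

Lemma Rintegral_poisson a : normc a < 1 -> Rintegral m T (poisson a) = 1.
Proof.
move=> a1; have := @poisson_formula (fun=> 1) a a1 (fun z _ => cderiv_cst _ _).
rewrite (@eq_circle_integral _ _ (fun z => (poisson a z)%:C)); last first.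
  by move=> z _; rewrite mul1r.
by move/(congr1 (@complex.Re R)).
Qed.

Lemma integrable_poisson a : normc a < 1 ->
  m.-integrable T (fun z : borelC R => (poisson a z)%:E).
Proof.
move=> a1; have [//] : circle_integrable (fun z => (poisson a z)%:C).
apply: (circle_integrable_bounded (M := 2 / (1 - normc a))); first exact: poisson_cmeas.
by move=> z Tz; rewrite normc_poisson// poisson_le.
Qed.

End Kernels.

Section CauchyTransform.
Variable R : realType.
Local Notation C := R[i].
Local Notation T := (@unit_circle R : set (borelC R)).
Local Notation m := (@circle_measure R).
Implicit Types (f F G : C -> C) (z w a : C).

Definition cauchy_transform f a : C :=
  circle_integral (fun z => f z * cauchy_kernel a z).

(** The remainder of the expansion under the integral is exactly [(w - z)^2 x / ((x - w) (x - z)^2)]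
    times [f x]. With [dl] the distance from [z] to the circle and [w] within [dl / 2] of [z], the
    factor after [(w - z)^2] is at most [2 / dl ^+ 3]. *)
Lemma cauchy_transform_derivable f z : circle_integrable f -> normc z < 1 ->
  derivable (cauchy_transform f) z 1.
Proof.
move=> fi z1; have mT := @measurable_T R.
set dl := 1 - normc z; have dl0 : 0 < dl by rewrite subr_gt0.
have inf := cintegrable_normc mT fi.
pose N := Rintegral m T (fun x => normc (f x)).
have N0 : 0 <= N by apply: Rintegral_ge0 => x _; exact: normc_ge0.
have mk : cmeas T (fun x : borelC R => cauchy_kernel z x / (x - z)).
  apply: cmeasM; first exact: cauchy_kernel_cmeas.
  apply: continuous_cmeas_T => x Tx.
  have h := circle_sub_neq0 z1 Tx.
  have dB : derivable (fun w => w - z) x 1 := cderivB (cderiv_id x) (cderiv_cst z x).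
  exact: (derivable_continuous (cderivV (F := fun w => w - z) h dB)).
have ki : circle_integrable (fun x => f x * (cauchy_kernel z x / (x - z))).
  apply: (circle_integrableMr (M := dl^-1 * dl^-1) fi mk) => x Tx.
  rewrite normcM ler_pM ?normc_ge0 ?normc_cauchy_kernel//.
  rewrite normcV lef_pV2 ?posrE ?circle_sub_gt0//; exact: circle_sub_ge.
apply: (@cdiff_derivable _ _ _ (circle_integral (fun x => f x * (cauchy_kernel z x / (x - z))))).
move=> e e0.
pose B := 2 / dl ^+ 3 * N + 1.
have B0 : 0 < B by rewrite ltr_wpDl// mulr_ge0// divr_ge0// exprn_ge0// ltW.
exists (Num.min (dl / 2) (e / B)).
  by rewrite lt_min !divr_gt0.
move=> w; rewrite lt_min => /andP[wd we].
have nw : normc w <= normc z + dl / 2.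
  rewrite -(subrK z w) (le_trans (le_normcD _ _))// addrC lerD2l ltW//.
have w1 : normc w < 1.
  rewrite (le_lt_trans nw)// -ltrBrDl ltr_pdivrMr// -/dl ltr_pMr// ltr1n//.
rewrite /cauchy_transform [X in _ - X * _]lock.
rewrite -circle_integralB; [|exact: circle_integrable_cauchy..].
rewrite -lock [X in _ - X]mulrC -circle_integralZ//.
have i1 : circle_integrable (fun x => f x * cauchy_kernel w x - f x * cauchy_kernel z x).
  by apply: circle_integrableB; exact: circle_integrable_cauchy.
have i2 := circle_integrableZ (w - z) ki.
rewrite -circle_integralB//.
rewrite (le_trans (normc_cint mT (circle_integrableB i1 i2)))//.
apply: (@le_trans _ _ (Rintegral m T (fun x => (normc (w - z) ^+ 2 * (2 / dl ^+ 3)) * normc (f x)))).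
  apply: (le_Rintegral mT).
  - exact: (cintegrable_normc mT (circle_integrableB i1 i2)).
  - exact: (RintegrableZl mT _ inf).
  move=> x Tx.
  have hz := circle_sub_neq0 z1 Tx; have hw := circle_sub_neq0 w1 Tx.
  have -> : f x * cauchy_kernel w x - f x * cauchy_kernel z x -
    (w - z) * (f x * (cauchy_kernel z x / (x - z))) =
    (w - z) ^+ 2 * (x / ((x - w) * (x - z) ^+ 2)) * f x.
    rewrite /cauchy_kernel; field; rewrite hz hw//.
  rewrite normcM ler_wpM2r ?normc_ge0// normcM normcX ler_wpM2l ?sqr_ge0//.
  rewrite normcM Tx mul1r normcV normcM normcX.
  have gz := circle_sub_ge z Tx; have gw := circle_sub_ge w Tx.
  have gw2 : dl / 2 <= normc (x - w).
    rewrite (le_trans _ gw)// /dl lerBrDl -lerBrDr (le_trans nw)// /dl.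
    rewrite lerBrDr -addrA -splitr addrC subrK//.
  rewrite -[leRHS]invrK lef_pV2 ?posrE; last 2 first.
  - by rewrite mulr_gt0 ?exprn_gt0// circle_sub_gt0.
  - by rewrite invr_gt0 divr_gt0// exprn_gt0.
  rewrite invf_div exprSr.
  have -> : dl ^+ 2 * dl / 2 = (dl / 2) * dl ^+ 2 by field.
  by rewrite ler_pM ?exprn_ge0 ?divr_ge0 ?(ltW dl0)// ler_pXn2r ?nnegrE ?normc_ge0 ?(ltW dl0).
rewrite RintegralZl// -/N -[_ * _ * N]mulrA.
set x := normc (w - z) in wd we *; have x0 : 0 <= x by exact: normc_ge0.
have xB : x * B <= e by rewrite -ler_pdivlMr// ltW.
rewrite expr2 -mulrA [leRHS]mulrC ler_wpM2l// (le_trans _ xB)// ler_wpM2l//.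
by rewrite lerDl.
Qed.

End CauchyTransform.

Section PoissonIntegral.
Variable R : realType.
Local Notation C := R[i].
Local Notation T := (@unit_circle R : set (borelC R)).
Local Notation m := (@circle_measure R).
Implicit Types (f F G : C -> C) (z w a : C) (v : C -> R).

Definition poisson_integral v a : R := Rintegral m T (fun z => poisson a z * v z).

Lemma circle_integrable_real v : m.-integrable T (fun z : borelC R => (v z)%:E) <->
  circle_integrable (fun z => (v z)%:C).
Proof.
split=> [iv|[]//]; split => //=; exact: integrable0.
Qed.

Lemma integrable_poissonM v a : normc a < 1 ->
  m.-integrable T (fun z : borelC R => (v z)%:E) ->
  m.-integrable T (fun z : borelC R => (poisson a z * v z)%:E).
Proof.
move=> a1 /circle_integrable_real iv; apply/circle_integrable_real.
have := circle_integrable_poisson a1 iv; apply: eq_circle_integrable => z _.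
by rewrite -rmorphM mulrC.
Qed.

Lemma poisson_integral_cst (c : R) a : normc a < 1 -> poisson_integral (fun=> c) a = c.
Proof.
move=> a1; rewrite /poisson_integral.
have -> := @RintegralZr _ (borelC R) R m T (poisson a) c (@measurable_T R) (integrable_poisson a1).
by rewrite Rintegral_poisson// mul1r.
Qed.

Lemma le_poisson_integral v v' a : normc a < 1 ->
  m.-integrable T (fun z : borelC R => (v z)%:E) ->
  m.-integrable T (fun z : borelC R => (v' z)%:E) ->
  (forall z, T z -> v z <= v' z) -> poisson_integral v a <= poisson_integral v' a.
Proof.
move=> a1 iv iv' vv; apply: (le_Rintegral (@measurable_T R)).
- exact: integrable_poissonM.
- exact: integrable_poissonM.
- by move=> z Tz; rewrite ler_wpM2l ?poisson_ge0 ?vv.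
Qed.

Lemma poisson_integralD v v' a : normc a < 1 ->
  m.-integrable T (fun z : borelC R => (v z)%:E) ->
  m.-integrable T (fun z : borelC R => (v' z)%:E) ->
  poisson_integral (fun z => v z + v' z) a = poisson_integral v a + poisson_integral v' a.
Proof.
move=> a1 iv iv'; rewrite /poisson_integral.
rewrite -(RintegralD (@measurable_T R) (integrable_poissonM a1 iv) (integrable_poissonM a1 iv')).
by apply: eq_Rintegral => z _; rewrite mulrDr.
Qed.

Lemma poisson_integralZ (c : R) v a : normc a < 1 ->
  m.-integrable T (fun z : borelC R => (v z)%:E) ->
  poisson_integral (fun z => c * v z) a = c * poisson_integral v a.
Proof.
move=> a1 iv; rewrite /poisson_integral.
rewrite -(RintegralZl c (@measurable_T R) (integrable_poissonM a1 iv)).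
by apply: eq_Rintegral => z _; rewrite mulrCA.
Qed.

Lemma normc_poisson_le f a : normc a < 1 -> circle_integrable f ->
  normc (circle_integral (fun z => f z * (poisson a z)%:C)) <=
  poisson_integral (fun z => normc (f z)) a.
Proof.
move=> a1 fi; have ip := circle_integrable_poisson a1 fi.
rewrite (le_trans (normc_cint (@measurable_T R) ip))//.
rewrite le_eqVlt; apply/orP; left; apply/eqP; apply: eq_Rintegral => z _.
by rewrite normcM normc_poisson// mulrC.
Qed.

(** The Poisson formula for the dilation by [r], at the point [a / r], writes [G a] as an average of
    the values on the circle of radius [r]. *)
Lemma max_modulus_dilation G a (r M : R) : analytic_in_disk G -> 0 < r < 1 ->
  normc a < r -> (forall z, T z -> normc (G (r%:C * z)) <= M) -> normc (G a) <= M.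
Proof.
move=> dG /andP[r0 r1] ar GM.
have a1 : normc (a / r%:C) < 1.
  by rewrite normcM normcV normc_real gtr0_norm// ltr_pdivrMr// mul1r.
have r01 : 0 <= r < 1 by rewrite ltW.
have := poisson_formula_dilation r01 a1 dG.
have rc0 : r%:C != 0 by rewrite -normc_gt0 normc_real gtr0_norm.
have -> : r%:C * (a / r%:C) = a by rewrite mulrC divfK.
move=> <-.
have Gi : circle_integrable (fun z => G (r%:C * z)).
  apply: circle_integrable_analytic => z z1; apply: cderiv_scale; apply: dG.
  by rewrite /unit_disk /= normcM normc_real gtr0_norm// (le_lt_trans _ r1)// ler_piMr// ltW.
rewrite (le_trans (normc_poisson_le a1 Gi))// -(poisson_integral_cst M a1).
apply: le_poisson_integral => //.
- exact: (cintegrable_normc (@measurable_T R) Gi).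
- exact: circle_integrable_cst.
Qed.

Lemma poisson_Re_cauchy a z : normc a < 1 -> unit_circle z ->
  poisson a z = 2 * complex.Re (cauchy_kernel a z) - 1.
Proof.
move=> a1 z1.
have h1 := circle_sub_neq0 a1 z1; have z0 := circle_neq0 z1.
have zc0 : z^*%C != 0 by rewrite conjc_eq0.
have KE : a^*%C * z / (1 - a^*%C * z) = (cauchy_kernel a z)^*%C - 1.
  have h3 : 1 - a^*%C * z != 0 by rewrite one_sub_conj_neq0// z1.
  rewrite /cauchy_kernel rmorphM /= conjc_inv rmorphB /=.
  have hc : z^*%C - a^*%C != 0 by rewrite -rmorphB conjc_eq0.
  have zc1 := circle_conj z1.
  move: h3 hc zc1; move: (z^*%C) (a^*%C) => u b h3 hc zc1.
  have -> : u / (u - b) = 1 / (1 - b * z).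
    have -> : 1 - b * z = z * (u - b) by rewrite -zc1; ring.
    rewrite invfM; have -> : z^-1 = u by rewrite -[RHS]mul1r -(mulVf z0) -mulrA zc1 mulr1.
    by rewrite mul1r.
  by field.
have := poissonE a1 z1; rewrite KE => /(congr1 (@complex.Re R)).
rewrite [LHS]/= => ->; case: (cauchy_kernel a z) => p q /=.
by ring.
Qed.

(** The integral of [v] against the Herglotz kernel [(z + a) / (z - a) = 2 z / (z - a) - 1]: an
    analytic function whose real part is the Poisson integral of [v]. *)
Definition herglotz v a : C :=
  2 * cauchy_transform (fun z => (v z)%:C) a - circle_integral (fun z => (v z)%:C).

Lemma herglotz_derivable v z : m.-integrable T (fun z : borelC R => (v z)%:E) ->
  normc z < 1 -> derivable (herglotz v) z 1.
Proof.
move=> /circle_integrable_real iv z1.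
exact (cderivB (cderivM (cderiv_cst 2 z) (cauchy_transform_derivable iv z1))
  (cderiv_cst _ z)).
Qed.

Lemma Re_herglotz v a : m.-integrable T (fun z : borelC R => (v z)%:E) ->
  normc a < 1 -> complex.Re (herglotz v a) = poisson_integral v a.
Proof.
move=> iv a1; have /circle_integrable_real ivc := iv.
have mT := @measurable_T R.
have ik := circle_integrable_cauchy a1 ivc.
have -> : herglotz v a = circle_integral (fun z => 2 * ((v z)%:C * cauchy_kernel a z) - (v z)%:C).
  by rewrite circle_integralB ?circle_integralZ//; exact: circle_integrableZ.
rewrite /circle_integral /=; apply: eq_Rintegral => z; rewrite inE => Tz.
have E2 (x : C) : complex.Re (2 * x) = 2 * complex.Re x.
  by rewrite mulr_natl mulr2n ReD mulr_natl mulr2n.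
by rewrite poisson_Re_cauchy// ReB E2 ReM /=; ring.
Qed.

(** The circle is split at distance [dl] from [z]. Near [z] the oscillation of [v] is at most [e].
    Far from it [normc (w - r z) >= dl / 2] bounds the kernel by [8 (1 - r) / dl^2], and the
    oscillation is at most [2 M]. *)
Lemma poisson_approx v z (M e dl r : R) : unit_circle z -> 0 <= r < 1 ->
  m.-integrable T (fun z : borelC R => (v z)%:E) ->
  (forall w, unit_circle w -> `|v w| <= M) -> 0 < dl -> 1 - r <= dl / 2 -> 0 <= e ->
  (forall w, unit_circle w -> normc (w - z) < dl -> `|v w - v z| <= e) ->
  `|poisson_integral v (r%:C * z) - v z| <= e + 16 * M * (1 - r) / dl ^+ 2.
Proof.
move=> Tz /andP[r0 r1] iv vM dl0 rdl e0 ve; have mT := @measurable_T R.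
have na : normc (r%:C * z) = r by exact: normc_scale_T.
have a1 : normc (r%:C * z) < 1 by rewrite na.
have M0 : 0 <= M by apply: le_trans (vM _ Tz).
have ivz : m.-integrable T (fun w : borelC R => (v w - v z)%:E).
  have := RintegrableD mT iv (circle_integrable_cst (- v z)).
  by [].
have -> : poisson_integral v (r%:C * z) - v z = poisson_integral (fun w => v w - v z) (r%:C * z).
  rewrite poisson_integralD//; last exact: circle_integrable_cst.
  by rewrite poisson_integral_cst.
set K := 16 * M * (1 - r) / dl ^+ 2.
have K0 : 0 <= K by rewrite divr_ge0 ?exprn_ge0 ?(ltW dl0)// !mulr_ge0// subr_ge0 ltW.
have ip := integrable_poissonM a1 ivz.
apply: le_trans (le_normr_Rintegral mT ip) _.
have iR : m.-integrable T (fun w : borelC R => (e * poisson (r%:C * z) w + K)%:E).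
  apply: (RintegrableD mT); last exact: circle_integrable_cst.
  exact: (RintegrableZl mT e (integrable_poisson a1)).
apply: (@le_trans _ _ (Rintegral m T (fun w => e * poisson (r%:C * z) w + K))); last first.
  rewrite (RintegralD mT (RintegrableZl mT e (integrable_poisson a1)) (circle_integrable_cst K)).
  rewrite (RintegralZl e mT (integrable_poisson a1)) Rintegral_poisson// mulr1.
  by rewrite circle_Rintegral_cst.
apply: (le_Rintegral mT) => //.
  exact: (integrable_norm ip).
move=> w Tw; have P0 := poisson_ge0 w a1.
rewrite normrM (ger0_norm P0).
have [wz|wz] := ltP (normc (w - z)) dl.
  by rewrite mulrC (le_trans (ler_wpM2r P0 (ve w Tw wz)))// lerDl.
apply: (@le_trans _ _ K); last by rewrite lerDr mulr_ge0.
have vv : `|v w - v z| <= 2 * M.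
  by rewrite (le_trans (ler_normB _ _))// mulr_natl mulr2n lerD ?vM.
have d2 : dl / 2 <= normc (w - r%:C * z).
  have : normc (z - r%:C * z) <= dl / 2.
    rewrite -[X in normc (X - _)]mul1r -mulrBl normcM Tz mulr1.
    by rewrite -(rmorph1 (real_complex R)) -rmorphB normc_real ger0_norm ?subr_ge0// ltW.
  have := le_normcD (w - r%:C * z) (r%:C * z - z); rewrite subrKA => h1.
  rewrite normc_sub => h2; rewrite [dl]splitr in wz.
  by move: (le_trans wz h1) h2; move: (normc _) (normc _) (dl / 2); clear; move=> x y t; lra.
have n0 : 0 < normc (w - r%:C * z) by apply: lt_le_trans d2; rewrite divr_gt0.
have P2 : poisson (r%:C * z) w <= 8 * (1 - r) / dl ^+ 2.
  rewrite /poisson na ler_pdivrMr ?exprn_gt0//.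
  apply: (@le_trans _ _ (8 * (1 - r) / dl ^+ 2 * (dl / 2) ^+ 2)); last first.
    rewrite ler_wpM2l//; last by rewrite ler_pXn2r ?nnegrE// ?normc_ge0// ?divr_ge0// ltW.
    by rewrite divr_ge0 ?exprn_ge0 ?(ltW dl0)// mulr_ge0// subr_ge0 ltW.
  have -> : 8 * (1 - r) / dl ^+ 2 * (dl / 2) ^+ 2 = 2 * (1 - r) by field; rewrite gt_eqF.
  have -> : 1 - r ^+ 2 = (1 + r) * (1 - r) by ring.
  by rewrite ler_wpM2r// ?subr_ge0 ?(ltW r1)// -[leRHS]/(1 + 1) lerD2l ltW.
apply: le_trans (ler_pM P0 (normr_ge0 _) P2 vv) _.
by rewrite /K le_eqVlt; apply/orP; left; apply/eqP; field; rewrite gt_eqF.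
Qed.

End PoissonIntegral.

(** * Domination of analytic functions by outer functions *)

Section LogInequalities.
Variable R : realType.
Implicit Types (x y L : R).

Lemma ln_le_subr1 x : 0 < x -> ln x <= x - 1.
Proof.
by move=> x0; rewrite lerBrDl -[leRHS](lnK (x := x)) ?posrE// expR_ge1Dx.
Qed.

Lemma ln_sub_le x y (e : R) : 0 < e -> e <= x -> e <= y -> `|ln x - ln y| <= `|x - y| / e.
Proof.
move=> e0; wlog xy : x y / y <= x.
  move=> h ex ey; have [yx|/ltW yx] := leP y x; first exact: h.
  by rewrite distrC [in leRHS]distrC; exact: h.
move=> ex ey; have x0 := lt_le_trans e0 ex; have y0 := lt_le_trans e0 ey.
rewrite !ger0_norm ?subr_ge0// ?ler_ln ?posrE//.
rewrite -ln_div ?posrE// (le_trans (ln_le_subr1 _)) ?divr_gt0//.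
have -> : x / y - 1 = (x - y) / y by rewrite mulrBl divff// gt_eqF.
by rewrite ler_wpM2l ?subr_ge0// lef_pV2.
Qed.

(** Truncation at [L] costs only [y / L] in the logarithm. Truncated functions are bounded, which
    later permits dominated convergence where only L^1 means are controlled. *)
Lemma ln_le_min y L : 0 < y -> 0 < L -> ln y <= ln (Num.min y L) + y / L.
Proof.
move=> y0 L0; have [yL|Ly] := leP y L; first by rewrite lerDl divr_ge0// ltW.
rewrite -lerBlDl -ln_div ?posrE// (le_trans (ln_le_subr1 _)) ?divr_gt0//.
by rewrite gerBl.
Qed.

(** The tangent of the concave [ln] at [c]; integrated with [c] the mean of [x], it gives Jensen's
    inequality. *)
Lemma ln_tangent x c : 0 < x -> 0 < c -> ln x <= ln c + (x / c - 1).
Proof.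
move=> x0 c0; rewrite -lerBlDl -ln_div ?posrE// ln_le_subr1// divr_gt0//.
Qed.

End LogInequalities.

Section OuterBound.
Variable R : realType.
Local Notation C := R[i].
Local Notation T := (@unit_circle R : set (borelC R)).
Local Notation m := (@circle_measure R).
Implicit Types (f F G : C -> C) (z w a : C) (v : C -> R).

Lemma integrable_bounded_T v (M : R) : measurable_fun T (v : borelC R -> R) ->
  (forall z, T z -> `|v z| <= M) -> m.-integrable T (fun z : borelC R => (v z)%:E).
Proof.
move=> mv vM; have [//] : circle_integrable (fun z => (v z)%:C).
apply: (circle_integrable_bounded (M := M)); first exact: cmeas_real.
by move=> z Tz; rewrite normc_real vM.
Qed.

Lemma normc_herglotz_cexp v z : m.-integrable T (fun z : borelC R => (v z)%:E) ->
  normc z < 1 -> normc (cexp (- herglotz v z)) = expR (- poisson_integral v z).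
Proof.
move=> iv z1; rewrite normc_cexp -(Re_herglotz iv z1).
by congr expR; case: (herglotz v z).
Qed.

(* Divide F by the outer function exp(H), where Re H is the Poisson integral of
   ln(|F| + e); the quotient is bounded by 1 near the circle. *)
Lemma outer_bound F a (e : R) : 0 < e -> normc a < 1 ->
  (forall z, normc z <= 1 -> derivable F z 1) ->
  normc (F a) <= expR (poisson_integral (fun z => ln (normc (F z) + e)) a).
Proof.
move=> e0 a1 dF.
have cF z : normc z <= 1 -> F w @[w --> z] --> F z.
  by move=> z1; exact: (derivable_continuous (dF z z1)).
have [M0 hM0] := closed_disk_bounded cF.
have n0 z : 0 <= normc (F z) by exact: normc_ge0.
pose v z := ln (normc (F z) + e).
have ve z : e <= normc (F z) + e by rewrite lerDr.
have v0 z : 0 < normc (F z) + e by exact: lt_le_trans (ve z).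
have mv : measurable_fun T (v : borelC R -> R).
  apply: measurableT_comp; first exact: measurable_ln.
  apply: measurable_funD => //; apply: cmeas_normc.
  apply: continuous_cmeas_T => z Tz; apply: cF; by rewrite Tz.
have M00 : 0 <= M0 by apply: le_trans (n0 0) (hM0 0 _); rewrite normc0.
pose M := `|ln e| + (M0 + e).
have vM z : unit_circle z -> `|v z| <= M.
  move=> Tz; have z1 : normc z <= 1 by rewrite Tz.
  have lb : ln e <= v z by rewrite ler_ln ?posrE.
  have ub : v z <= M0 + e.
    rewrite (le_trans (ln_le_subr1 (v0 z)))//.
    by move: (hM0 z z1); clear; move: (normc _) => x; lra.
  have := ler_norm (- ln e); rewrite normrN => h1.
  have := normr_ge0 (ln e) => h2.
  rewrite ler_norml /M; move: lb ub h1 h2 M00 e0.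
  move: (v z) (ln e) `|ln e|; clear; move=> x y t; lra.
have iv : m.-integrable T (fun z : borelC R => (v z)%:E) by exact: integrable_bounded_T vM.
pose U := poisson_integral v.
pose G z := F z * cexp (- herglotz v z).
have GE z : normc z < 1 -> normc (G z) = normc (F z) * expR (- U z).
  by move=> z1; rewrite normcM normc_herglotz_cexp.
have dG : analytic_in_disk G.
  move=> z z1; apply: cderivM; first exact/dF/ltW.
  exact (@cderiv_comp R (@cexp R) (fun w => - herglotz v w) z
    (cderivN (herglotz_derivable iv z1)) (@derivable_cexp R _)).
suff hG : forall eta : R, 0 < eta -> normc (G a) <= expR (2 * eta).
  have Ua : normc (F a) = normc (G a) * expR (U a).
    by rewrite GE// -mulrA -expRD addNr expR0 mulr1.
  rewrite Ua -[leRHS]mul1r ler_wpM2r ?expR_ge0//.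
  have [g0|g0] := leP (normc (G a)) 0; first by rewrite (le_trans g0).
  rewrite -(lnK (x := normc (G a))) ?posrE// -expR0 ler_expR.
  apply/ler_addgt0Pr => eta eta0; rewrite add0r.
  rewrite -[leRHS]expRK ler_ln ?posrE ?expR_gt0//.
  have := hG (eta / 2) (divr_gt0 eta0 (ltr0n _ 2)).
  by rewrite mulrC divfK// pnatr_eq0.
move=> eta eta0.
(* The bound [eta * e] keeps the oscillation of [ln (normc F + e)] below [eta], by [ln_sub_le]; the
   bound [e] keeps [normc F] on the inner circle below [normc F + e] on the unit circle. *)
pose e1 := Num.min (eta * e) e.
have e10 : 0 < e1 by rewrite lt_min mulr_gt0.
have [dl dl0 hdl] := closed_disk_unif cF e10.
have M_0 : 0 <= M by rewrite addr_ge0// addr_ge0// ltW.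
(* The circle of radius [1 - t] must enclose [a], lie within the scale [dl] of uniform continuity,
   and be so close to the unit circle that the far part in [poisson_approx] is at most [eta]. There
   [G] is at most [expR (2 * eta)]. *)
have [t [t0 t1 ta td tM]] : exists t : R, [/\ 0 < t, t < 1, t < 1 - normc a, t <= dl / 2 &
    16 * M * t / dl ^+ 2 <= eta].
  pose K := 16 * M / dl ^+ 2 + 1.
  have K0 : 0 < K by rewrite ltr_wpDl// divr_ge0 ?exprn_ge0 ?(ltW dl0)// mulr_ge0.
  have a0 : 0 < 1 - normc a by rewrite subr_gt0.
  exists (Num.min ((1 - normc a) / 2) (Num.min (dl / 2 / 2) (eta / K))).
  have h0 : 0 < (1 - normc a) / 2 by rewrite divr_gt0.
  have h1 : 0 < dl / 2 / 2 by rewrite !divr_gt0.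
  have h2 : 0 < eta / K by rewrite divr_gt0.
  have na0 := normc_ge0 a.
  split.
  - by rewrite !lt_min h0 h1 h2.
  - by rewrite gt_min; apply/orP; left; lra.
  - by rewrite gt_min; apply/orP; left; lra.
  - by rewrite ge_min; apply/orP; right; rewrite ge_min; apply/orP; left; lra.
  set t := Num.min _ _.
  have tK : t <= eta / K by rewrite /t !ge_min lexx !orbT.
  have t0 : 0 <= t by rewrite /t !le_min !ltW.
  have -> : 16 * M * t / dl ^+ 2 = t * (16 * M / dl ^+ 2) by ring.
  rewrite ler_pdivlMr// in tK; apply: le_trans tK.
  by rewrite ler_wpM2l// lerDl.
have r01 : 0 < 1 - t < 1 by rewrite subr_gt0 t1 gtrBl.
have r01' : 0 <= 1 - t < 1 by case/andP: r01 => /ltW -> ->.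
have ar : normc a < 1 - t by rewrite ltrBrDr -ltrBrDl.
apply: (max_modulus_dilation dG r01 ar) => z Tz.
have z1 : normc z <= 1 by rewrite Tz.
have nz : normc ((1 - t)%:C * z) = 1 - t by apply: normc_scale_T => //; case/andP: r01'.
have nz1 : normc ((1 - t)%:C * z) < 1 by rewrite nz; case/andP: r01'.
rewrite GE//.
have Fz : normc (F ((1 - t)%:C * z)) <= normc (F z) + e.
  rewrite -lerBlDl (le_trans (lerB_normc _ _))// ltW// (lt_le_trans (hdl _ _ (ltW nz1) z1 _))//.
    rewrite -[X in normc (_ - X)]mul1r -mulrBl normcM Tz mulr1.
    rewrite -(rmorph1 (real_complex R)) -rmorphB normc_real addrAC subrr sub0r normrN.
    by rewrite gtr0_norm// (le_lt_trans td)// ltr_pdivrMr// ltr_pMr// ltr1n.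
  by rewrite ge_min lexx orbT.
have tE : 1 - (1 - t) = t by rewrite opprB addrC subrK.
have := @poisson_approx R v z M eta dl (1 - t) Tz r01' iv vM dl0.
rewrite tE => /(_ td (ltW eta0)) hU.
have {}hU : `|U ((1 - t)%:C * z) - v z| <= 2 * eta.
  rewrite (le_trans (hU _))//; last by rewrite [leRHS]mulr_natl mulr2n lerD2l.
  move=> w Tw wz; have w1 : normc w <= 1 by rewrite Tw.
  have ww := hdl _ _ w1 z1 wz.
  rewrite (le_trans (ln_sub_le e0 (ve w) (ve z)))// ler_pdivrMr// opprD addrACA subrr addr0.
  apply: (@le_trans _ _ (normc (F w - F z))); last first.
    by rewrite ltW// (lt_le_trans ww)// ge_min lexx.
  by rewrite ler_norml lerNl opprB lerB_normc normc_sub lerB_normc.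
rewrite (le_trans (ler_wpM2r (expR_ge0 _) Fz))//.
rewrite -[X in X * _](lnK (x := normc (F z) + e)) ?posrE// -/(v z) -expRD ler_expR.
by rewrite -normrN opprB in hU; rewrite (le_trans (ler_norm _)).
Qed.

(** Jensen's inequality applied to [outer_bound] after truncation: [ln y] is at most
    [ln (min y L) + y / L], and the logarithm of the truncation is averaged by [ln_tangent] at its
    mean. As [L] grows, the exponential factor tends to 1, uniformly for functions with bounded
    means. *)
Lemma outer_trunc_bound F a (e L : R) : 0 < e -> 0 < L -> normc a < 1 ->
  (forall z, normc z <= 1 -> derivable F z 1) ->
  normc (F a) <= poisson_integral (fun z => Num.min (normc (F z) + e) L) a *
    expR (poisson_integral (fun z => normc (F z) + e) a / L).
Proof.
move=> e0 L0 a1 dF; have mT := @measurable_T R.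
have Fi := circle_integrable_analytic dF.
have n0 z : 0 <= normc (F z) by exact: normc_ge0.
have v0 z : 0 < normc (F z) + e by rewrite ltr_wpDl.
have iy : m.-integrable T (fun z : borelC R => (normc (F z) + e)%:E).
  apply: (RintegrableD mT); first exact: (cintegrable_normc mT Fi).
  exact: circle_integrable_cst.
have my : measurable_fun T ((fun z => normc (F z) + e) : borelC R -> R).
  by apply: measurable_funD => //; apply: cmeas_normc; exact: cintegrable_cmeas Fi.
have imin : m.-integrable T (fun z : borelC R => (Num.min (normc (F z) + e) L)%:E).
  apply: (integrable_bounded_T (M := L)).
    by apply: measurable_minr.
  move=> z Tz; rewrite ger0_norm; last by rewrite le_min !ltW.
  by rewrite ge_min lexx orbT.
set A := poisson_integral _ a.
have A0 : 0 < A.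
  apply: (@lt_le_trans _ _ (Num.min e L)); first by rewrite lt_min e0.
  rewrite -(poisson_integral_cst (Num.min e L) a1); apply: le_poisson_integral => //.
    exact: circle_integrable_cst.
  by move=> z Tz; rewrite le_min !ge_min lerDr n0 lexx orbT.
set B := poisson_integral (fun z => normc (F z) + e) a.
have := outer_bound e0 a1 dF; move=> /le_trans; apply.
rewrite -[X in _ <= X * _](lnK (x := A)) ?posrE// -expRD ler_expR.
have iln : m.-integrable T (fun z : borelC R => (ln (normc (F z) + e))%:E).
  apply: (le_integrable mT _ _ (RintegrableD mT iy (circle_integrable_cst `|ln e|))).
    apply/measurable_EFinP; apply: measurableT_comp my; exact: measurable_ln.
  move=> z Tz /=; rewrite lee_fin.
  have lb : ln e <= ln (normc (F z) + e) by rewrite ler_ln ?posrE// lerDr.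
  have ub := ln_le_subr1 (v0 z).
  have := ler_norm (- ln e); rewrite normrN => h1.
  have := normr_ge0 (ln e) => h2.
  rewrite (le_trans _ (ler_norm _))// ler_norml; move: lb ub h1 h2 (v0 z).
  move: (normc (F z) + e) => y; move: (ln y) (ln e) `|ln e|; clear; move=> x w t; lra.
have iA := RintegrableZl mT A^-1 imin.
have iL := RintegrableZl mT L^-1 iy.
have iS := RintegrableD mT iA iL.
have ic := circle_integrable_cst (ln A - 1).
apply: (@le_trans _ _ (poisson_integral (fun z => (A^-1 * Num.min (normc (F z) + e) L +
   L^-1 * (normc (F z) + e)) + (ln A - 1)) a)).
  apply: le_poisson_integral => //; first exact: (RintegrableD mT iS ic).
  move=> z Tz; have m0 : 0 < Num.min (normc (F z) + e) L by rewrite lt_min v0.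
  rewrite (le_trans (ln_le_min (v0 z) L0))//.
  rewrite [leRHS]addrAC [L^-1 * _]mulrC lerD2r (le_trans (ln_tangent m0 A0))//.
  by rewrite [A^-1 * _]mulrC; move: (_ / A) (ln A); clear; move=> x y; lra.
rewrite (poisson_integralD a1 iS ic) (poisson_integralD a1 iA iL).
rewrite (poisson_integralZ _ a1 imin) (poisson_integralZ _ a1 iy) poisson_integral_cst//.
rewrite -/A -/B mulVf ?gt_eqF// [L^-1 * B]mulrC.
by move: (B / L) (ln A); clear; move=> x y; lra.
Qed.

End OuterBound.

(** * The Hardy space H^1 *)

Import HBNNSimple.

Section NullModification.
Context d (X : measurableType d) (R : realType).
Variables (mu : {measure set X -> \bar R}) (D N : set X).
Hypotheses (mD : measurable D) (mN : measurable N) (N0 : mu N = 0%E).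

(* The library versions require both functions to be measurable; here neither is. *)
Lemma ge0_integral_null_modification (f g : X -> \bar R) :
  (forall x, D x -> 0 <= f x)%E -> (forall x, D x -> 0 <= g x)%E ->
  (forall x, D x -> ~ N x -> f x = g x) ->
  (\int[mu]_(x in D) f x = \int[mu]_(x in D) g x)%E.
Proof.
move=> f0 g0 fg.
have le (f1 f2 : X -> \bar R) : (forall x, D x -> 0 <= f1 x)%E ->
    (forall x, D x -> 0 <= f2 x)%E -> (forall x, D x -> ~ N x -> f1 x = f2 x) ->
    (\int[mu]_(x in D) f1 x <= \int[mu]_(x in D) f2 x)%E.
  move=> f10 f20 ff; rewrite !ge0_integralE//.
  apply: ge_ereal_sup => _ [h hf <-].
  have mNC := measurableC mN.
  apply: ereal_sup_ubound; exists (proj_nnsfun h mNC).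
    move=> x; rewrite -mrestrict /=.
    rewrite patchE; case: ifPn => [|_].
      rewrite inE => nNx; apply: le_trans (hf x) _; rewrite !patchE.
      by case: ifPn => //; rewrite inE => Dx; rewrite ff.
    rewrite patchE; case: ifPn => //; rewrite inE => Dx; exact: f20.
  rewrite -!integralT_nnsfun; apply: ge0_ae_eq_integral => //.
  - by apply/measurable_EFinP; exact: measurable_funPT.
  - by apply/measurable_EFinP; exact: measurable_funPT.
  - by move=> x _; rewrite lee_fin.
  - by move=> x _; rewrite lee_fin.
  exists N; split => // x; apply: contra_notP => nNx _; congr EFin.
  by have := congr1 (fun k => k x) (mrestrict h mNC); rewrite /= patchE mem_set.
apply/eqP; rewrite eq_le !le// => x Dx nNx; by rewrite fg.
Qed.

Lemma Rintegral_null_modification (f g : X -> R) :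
  (forall x, D x -> ~ N x -> f x = g x) -> Rintegral mu D f = Rintegral mu D g.
Proof.
move=> fg; congr fine; rewrite [LHS]integralE [RHS]integralE; congr (_ - _)%E.
  apply: ge0_integral_null_modification => // x Dx nNx.
  by rewrite !funeposE fg.
apply: ge0_integral_null_modification => // x Dx nNx.
by rewrite !funenegE fg.
Qed.

Lemma cint_null_modification (f g : X -> R[i]) :
  (forall x, D x -> ~ N x -> f x = g x) -> cint mu D f = cint mu D g.
Proof.
by move=> fg; rewrite /cint; congr Complex; apply: Rintegral_null_modification => x Dx nNx;
  rewrite fg.
Qed.

End NullModification.

Section Radii.
Variable R : realType.
Local Notation C := R[i].

(** The offset 2 makes even the first radius positive. *)
Definition radius (n : nat) : R := 1 - n.+2%:R^-1.

Lemma radius_itv n : 0 < radius n < 1.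
Proof.
rewrite /radius subr_gt0 invf_lt1 ?ltr0n// ltr1n /= gtrBl invr_gt0 ltr0n//.
Qed.

Lemma radius_cvg : radius @ \oo --> (1 : R).
Proof.
rewrite -[X in _ --> X]subr0; apply: cvgB; first exact: cvg_cst.
have := @cvg_harmonic R; rewrite -(cvg_shiftS (@harmonic R)); exact.
Qed.

Lemma radius_scale_cvg (F : C -> C) (a : C) : F w @[w --> a] --> F a ->
  (fun n => F ((radius n)%:C * a)) @ \oo --> F a.
Proof.
move=> cF; have h : (fun n => (radius n)%:C * a) @ \oo --> a.
  rewrite -[X in _ --> X]mul1r; apply: cvgM; last exact: cvg_cst.
  exact: (cvg_comp _ _ radius_cvg (@real_complex_continuous R 1)).
exact: (cvg_comp _ _ h cF).
Qed.

End Radii.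

Section AlmostEverywhereCircle.
Variable R : realType.
Local Notation C := R[i].
Local Notation T := (@unit_circle R : set (borelC R)).
Local Notation m := (@circle_measure R).
Local Notation lam := (@lebesgue_measure R).
Local Notation I01 := (`[0%R, 1%R]%classic : set (measurableTypeR R)).

(* Push a null set of parameters forward: its complement in [0, 1] is exhausted up to
   measure zero by compact sets, whose images are compact, hence Borel. *)
Lemma ae_circle (P : C -> Prop) : {ae lam, forall t, I01 t -> P (@expi2pi R t)} ->
  {ae m, forall z : borelC R, T z -> P z}.
Proof.
move=> [A [mA A0 nA]]; have mI : measurable I01 by exact: measurable_itv.
pose B := I01 `\` A; have mB : measurable B by exact: measurableD.
have Bfin : (lam B < +oo)%E.
  apply: (@le_lt_trans _ _ (lam I01)); first by apply: le_measure; rewrite ?inE//; exact: subDsetl.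
  by rewrite lebesgue_measure_itv /= lte_fin ltr01 ltry.
have hK n : exists V : set R, [/\ compact V, V `<=` B & (lam (B `\` V) < (n.+1%:R^-1)%:E)%E].
  by apply: lebesgue_regularity_inner => //; rewrite invr_gt0 ltr0n.
have [V hV] := choice hK.
have cE n : closed ((@expi2pi R : R -> C) @` V n).
  apply: compact_closed; first exact: norm_hausdorff.
  apply: continuous_compact; last by case: (hV n).
  by apply: continuous_subspaceT => t; exact: continuous_expi2pi.
pose N : set (borelC R) := T `\` \bigcup_n ((@expi2pi R : R -> C) @` V n).
have mN : measurable N.
  apply: measurableD; first exact: measurable_T.
  apply: bigcupT_measurable => n.
  rewrite -[X in measurable X]setCK; apply: measurableC; apply: measurable_openC.
  by rewrite openC.
exists N; split => //.
  have mEN : measurable ((@expi2pi R @^-1` N) `&` I01).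
    apply: measurableI => //; rewrite -[X in measurable X]setTI.
    exact: (@measurable_expi2pi R).
  apply/eqP; rewrite eq_le measure_ge0 andbT.
  rewrite [leLHS](_ : _ = lam ((@expi2pi R @^-1` N) `&` I01))//.
  apply/lee_addgt0Pr => e e0; rewrite add0e.
  have [n hn] : exists n, n.+1%:R^-1 < e.
    have [n _ hn] := (@cvgrPdist_lt _ _ _ _ _ _ _).1 (@cvg_harmonic R) _ e0.
    exists n; have := hn n (leqnn n); rewrite sub0r normrN; exact: le_lt_trans (ler_norm _).
  have [_ VB hn'] := hV n.
  have mBV : measurable (B `\` V n).
    by apply: measurableD => //; apply: compact_measurable; case: (hV n).
  apply: (@le_trans _ _ (lam (A `|` (B `\` V n)))).
    apply: le_measure; rewrite ?inE//; first exact: measurableU.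
    move=> t [[_ nV] It]; have [At|nAt] := pselect (A t); first by left.
    by right; split => // Vt; apply: nV; exists n => //; exists t.
  apply: le_trans (measureU2 _ _ _) _ => //.
  by rewrite [X in (X + _)%E]A0 add0e ltW// (lt_trans hn')// lte_fin.
move=> z /= /not_implyP[Tz nPz]; split => // -[n _ [t Vt etz]].
have [_ VB _] := hV n; have [It nAt] := VB _ Vt.
apply: nAt; apply: nA => /=; apply/not_implyP; split => //.
by rewrite etz.
Qed.

End AlmostEverywhereCircle.

Section HardyBound.
Variable R : realType.
Local Notation C := R[i].
Local Notation T := (@unit_circle R : set (borelC R)).
Local Notation m := (@circle_measure R).
Implicit Types (f F G k : C -> C) (z w a : C).

Lemma cvg_minr (u : nat -> R) (l L : R) : u @ \oo --> l ->
  (fun n => Num.min (u n) L) @ \oo --> Num.min l L.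
Proof.
have lip (x y : R) : `|Num.min x L - Num.min y L| <= `|x - y|.
  wlog xy : x y / x <= y.
    move=> h; have [|/ltW yx] := leP x y; first exact: h.
    by rewrite distrC [leRHS]distrC; exact: h.
  rewrite !ler0_norm ?subr_le0// ?le_min ?ge_min ?xy ?lexx ?orbT// !opprB.
  rewrite lerBlDl; have [xL|/ltW Lx] := leP x L.
    by rewrite subrKC ge_min lexx.
  by rewrite ge_min lerDl subr_ge0 xy orbT.
move=> /cvgrPdist_lt h; apply/cvgrPdist_lt => e /h.
by apply: filterS => n; exact: le_lt_trans.
Qed.

Lemma dilation_derivable F (r : R) : analytic_in_disk F -> 0 <= r < 1 ->
  forall z, normc z <= 1 -> derivable (fun w => F (r%:C * w)) z 1.
Proof.
move=> dF /andP[r0 r1] z z1; apply: cderiv_scale; apply: dF.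
rewrite /unit_disk /= normcM normc_real ger0_norm// (le_lt_trans _ r1)//.
by rewrite ler_piMr.
Qed.

Lemma radius_itvW n : 0 <= radius R n < 1.
Proof. by have /andP[/ltW -> ->] := radius_itv R n. Qed.

Lemma hardy_mean_bound F : hardy1 F -> exists2 K : R, 0 <= K & forall n,
  Rintegral m T (fun z => normc (F ((radius R n)%:C * z))) <= K.
Proof.
move=> [dF]; set S := ereal_sup _ => Sfin.
have I0 (r : R) : (0 <= \int[m]_(z in T) (normc (F (r%:C * z)))%:E)%E.
  by apply: integral_ge0 => z _; rewrite lee_fin normc_ge0.
have hS n : (\int[m]_(z in T) (normc (F ((radius R n)%:C * z)))%:E <= S)%E.
  by apply: ereal_sup_ubound; exists (radius R n) => //; exact: radius_itvW.
have S0 : (0 <= S)%E by rewrite (le_trans (I0 (radius R 0)))// hS.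
exists (fine S); first exact: fine_ge0.
move=> n; apply: fine_le; rewrite ?ge0_fin_numE//.
by rewrite (le_lt_trans (hS n)).
Qed.

(** [outer_trunc_bound] is applied to the dilations of [F], whose means are bounded by [K]. With [e]
    and [L] fixed the truncated integrands are dominated, so the dilations converge to [k] under the
    integral; then [L] tends to infinity and [e] to 0. *)
Lemma hardy_poisson_le F k a : hardy1 F -> circle_integrable k ->
  {ae m, forall z : borelC R, T z -> (fun n => F ((radius R n)%:C * z)) @ \oo --> k z} ->
  normc a < 1 -> normc (F a) <= poisson_integral (fun z => normc (k z)) a.
Proof.
move=> hF ki Fk a1; have mT := @measurable_T R.
have [dF _] := hF; have [K K0 hK] := hardy_mean_bound hF.
have nk := cintegrable_normc mT ki.
set J := poisson_integral _ a.
have J0 : 0 <= J.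
  by apply: Rintegral_ge0 => z _; rewrite mulr_ge0 ?poisson_ge0 ?normc_ge0.
have dFn n := dilation_derivable dF (radius_itvW n).
have Fni n := circle_integrable_analytic (dFn n).
pose Ca := 2 / (1 - normc a).
have Ca0 : 0 <= Ca by rewrite divr_ge0// subr_ge0 ltW.
have step (e L : R) : 0 < e -> 0 < L ->
    normc (F a) <= (J + e) * expR ((Ca * K + e) / L).
  move=> e0 L0.
  pose A n := poisson_integral (fun z => Num.min (normc (F ((radius R n)%:C * z)) + e) L) a.
  have mF n : measurable_fun T ((fun z => normc (F ((radius R n)%:C * z)) + e) : borelC R -> R).
    by apply: measurable_funD => //; apply: cmeas_normc; exact: cintegrable_cmeas (Fni n).
  have mk : measurable_fun T ((fun z => normc (k z) + e) : borelC R -> R).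
    by apply: measurable_funD => //; apply: cmeas_normc; exact: cintegrable_cmeas ki.
  have mP := poisson_measurable a1.
  have n0 (z : C) : 0 <= normc z by exact: normc_ge0.
  have le1 n : normc (F ((radius R n)%:C * a)) <= A n * expR ((Ca * K + e) / L).
    rewrite (le_trans (outer_trunc_bound e0 L0 a1 (dFn n)))//.
    rewrite ler_wpM2l//.
      apply: Rintegral_ge0 => z _; rewrite mulr_ge0 ?poisson_ge0// le_min (ltW L0) andbT.
      by rewrite addr_ge0// ltW.
    rewrite ler_expR ler_pM2r ?invr_gt0//.
    have nFn := cintegrable_normc mT (Fni n).
    rewrite (poisson_integralD a1 nFn (circle_integrable_cst e)) poisson_integral_cst// lerD2r.
    apply: (@le_trans _ _ (Rintegral m T (fun z => Ca * normc (F ((radius R n)%:C * z))))).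
      apply: (le_Rintegral mT); first exact: (integrable_poissonM a1 nFn).
        exact: (RintegrableZl mT Ca nFn).
      by move=> z Tz; rewrite ler_wpM2r// poisson_le.
    by rewrite (RintegralZl Ca mT nFn) ler_wpM2l.
  have [] := @Rdominated_cvg _ _ R m T mT
    (fun n z => poisson a z * Num.min (normc (F ((radius R n)%:C * z)) + e) L)
    (fun z => poisson a z * Num.min (normc (k z) + e) L) (fun z => poisson a z * L).
  - by move=> n; apply: measurable_funM => //; exact: measurable_minr.
  - by apply: measurable_funM => //; exact: measurable_minr.
  - apply: filterS Fk => z h Tz; apply: cvgM; first exact: cvg_cst.
    have h1 : (fun n => normc (F ((radius R n)%:C * z)) + e) @ \oo --> normc (k z) + e.
      by apply: cvgD; [exact: cvg_normc (h Tz)|exact: cvg_cst].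
    exact: cvg_minr.
  - exact: (integrable_poissonM a1 (circle_integrable_cst L)).
  - move=> n z Tz; rewrite ger0_norm; last first.
      by rewrite mulr_ge0 ?poisson_ge0// le_min (ltW L0) andbT addr_ge0// ltW.
    by rewrite ler_wpM2l ?poisson_ge0// ge_min lexx orbT.
  move=> imin cA.
  have cF : (fun n => normc (F ((radius R n)%:C * a))) @ \oo --> normc (F a).
    apply: cvg_normc; apply: radius_scale_cvg.
    exact: (derivable_continuous (dF a a1)).
  have cR : (fun n => A n * expR ((Ca * K + e) / L)) @ \oo -->
    Rintegral m T (fun z => poisson a z * Num.min (normc (k z) + e) L) * expR ((Ca * K + e) / L).
    by apply: cvgM; [exact: cA|exact: cvg_cst].
  rewrite -(cvg_lim _ cF)//.
  apply: (@le_trans _ _ (limn (fun n => A n * expR ((Ca * K + e) / L)))).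
    apply: ler_lim; [by apply/cvg_ex; eexists; exact: cF|by apply/cvg_ex; eexists; exact: cR|].
    exact: nearW.
  rewrite (cvg_lim _ cR)// ler_wpM2r ?expR_ge0//.
  have -> : J + e = poisson_integral (fun z => normc (k z) + e) a.
    by rewrite (poisson_integralD a1 nk (circle_integrable_cst e)) poisson_integral_cst.
  have iS : m.-integrable T (fun z : borelC R => (normc (k z) + e)%:E).
    exact: (RintegrableD mT nk (circle_integrable_cst e)).
  apply: (le_Rintegral mT imin (integrable_poissonM a1 iS)).
  by move=> z Tz; rewrite ler_wpM2l ?poisson_ge0// ge_min lexx.
apply/ler_addgt0Pr => d d0.
pose e := Num.min 1 (d / (J + 2)).
have J2 : 0 < J + 2 by rewrite ltr_wpDl.
have e0 : 0 < e by rewrite lt_min ltr01 divr_gt0.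
have e1 : e <= 1 by rewrite ge_min lexx.
have ed : e * (J + 2) <= d by rewrite -ler_pdivlMr// ge_min lexx orbT.
have l0 : 0 < ln (1 + e) by rewrite ln_gt0// ltrDl.
pose B := Ca * K + e; have B0 : 0 < B by rewrite ltr_wpDl// mulr_ge0.
(* This value of [L] turns the exponential factor into exactly [1 + e], and [(J + e) (1 + e)] is at
   most [J + e (J + 2)]. *)
have := step e (B / ln (1 + e)) e0 (divr_gt0 B0 l0).
rewrite -/B invf_div mulrCA divff ?gt_eqF// mulr1 lnK ?posrE ?addr_gt0// => /le_trans; apply.
have ee : e * e <= e by rewrite ler_piMl// ltW.
have -> : (J + e) * (1 + e) = J + (e * J + (e + e * e)) by ring.
rewrite lerD2l (le_trans _ ed)// mulrDr lerD2l mulrDr mulr1.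
by rewrite lerD2l.
Qed.

End HardyBound.

Section DyadicKernel.
Variable R : realType.
Local Notation lam := (@lebesgue_measure R).
Variables (p phi : R -> R) (I : set (measurableTypeR R)) (t0 eps dl eta C K : R).
Hypotheses (mI : measurable I) (mp : measurable_fun I p) (mphi : measurable_fun setT phi).
Hypotheses (p0 : forall t, 0 <= p t) (phi0 : forall t, 0 <= phi t).
Hypotheses (eps0 : 0 < eps) (eps_dl : eps < dl) (eta0 : 0 <= eta) (C0 : 0 <= C).
Hypothesis p_le : forall t, I t -> p t <= 2 / eps.
Hypothesis p_far : forall t, I t -> `|t - t0| ^+ 2 * p t <= C * eps.
Hypothesis avg : forall r, 0 < r -> r < dl ->
  (\int[lam]_(t in ball t0 r) (phi t)%:E <= (2 * r * eta)%:E)%E.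
Hypothesis tot : (\int[lam]_(t in I) (phi t)%:E <= K%:E)%E.

Let B (n : nat) : set (measurableTypeR R) := ball t0 (2 ^+ n * eps).

Let mB n : measurable (B n). Proof. exact: measurable_ball. Qed.

Let mpphi (A : set (measurableTypeR R)) : A `<=` I -> measurable_fun A (fun t => (p t * phi t)%:E).
Proof.
move=> AI; apply/measurable_EFinP; apply: measurable_funM.
  exact: measurable_funS mp.
exact: measurable_funS mphi.
Qed.

Let piece (A A' : set (measurableTypeR R)) (c v : R) : measurable A -> measurable A' ->
  A `<=` I -> A `<=` A' -> 0 <= c -> (forall t, A t -> p t <= c) ->
  (\int[lam]_(t in A') (phi t)%:E <= v%:E)%E ->
  (\int[lam]_(t in A) (p t * phi t)%:E <= (c * v)%:E)%E.
Proof.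
move=> mA mA' AI AA' c0 pc hv.
have mph (D : set (measurableTypeR R)) : measurable_fun D (fun t => (phi t)%:E).
  by apply/measurable_EFinP; exact: measurable_funS mphi.
apply: (@le_trans _ _ (\int[lam]_(t in A) (c%:E * (phi t)%:E))%E).
  apply: ge0_le_integral => //.
  - by move=> t _; rewrite lee_fin mulr_ge0.
  - exact: (mpphi AI).
  - by apply: measurable_funeM.
  - by move=> t At; rewrite -EFinM lee_fin ler_wpM2r// pc.
rewrite ge0_integralZl//; last by move=> t _; rewrite lee_fin.
rewrite EFinM; apply: lee_wpmul2l; first by rewrite lee_fin.
apply: le_trans hv; apply: ge0_subset_integral => // t _; by rewrite lee_fin.
Qed.

(** The innermost ball contributes [4 * eta]. On the shell between the radii [2^n eps] and
    [2^(n+1) eps] the kernel is at most [C eps / (2^n eps)^2] and the mass of [phi] at most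
    [2 * 2^(n+1) eps * eta], so the shells form a geometric series with total [8 * C * eta]. *)
Let psi n : 2 ^+ n * eps < dl ->
  (\int[lam]_(t in I `&` B n) (p t * phi t)%:E <=
   (eta * (4 + 8 * C * (1 - 2 ^- n)))%:E)%E.
Proof.
elim: n => [|n IH] hn.
  rewrite expr0 invr1 subrr mulr0 addr0.
  have -> : eta * 4 = 2 / eps * (2 * eps * eta) by field; rewrite gt_eqF.
  apply: (piece (A' := B 0)) => //.
  - exact: measurableI.
  - by rewrite divr_ge0// ltW.
  - by move=> t [It _]; exact: p_le.
  - by rewrite /B expr0 mul1r; apply: avg => //; move: hn; rewrite expr0 mul1r.
have p2 k : 0 < (2 : R) ^+ k by rewrite exprn_gt0.
have hn' : 2 ^+ n * eps < dl.
  by apply: le_lt_trans hn; rewrite exprS -mulrA ler_peMl ?ler1n// mulr_ge0// ltW.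
have BB : B n `<=` B n.+1.
  by apply: le_ball; rewrite exprS -mulrA ler_peMl ?ler1n// mulr_ge0// ltW.
have -> : I `&` B n.+1 = (I `&` B n) `|` (I `&` (B n.+1 `\` B n)).
  by rewrite -setIUr setDUK.
rewrite ge0_integral_setU//=; first last.
- by apply/disj_setPS => t [[_ Bt] [_ [_]]].
- by move=> t _; rewrite lee_fin mulr_ge0.
- by apply: mpphi => t [[]|[]].
- by apply: measurableI => //; exact: measurableD.
- exact: measurableI.
have -> : eta * (4 + 8 * C * (1 - 2 ^- n.+1)) = eta * (4 + 8 * C * (1 - 2 ^- n)) +
    C * eps / (2 ^+ n * eps) ^+ 2 * (2 * (2 ^+ n.+1 * eps) * eta).
  by rewrite exprS; field; rewrite !gt_eqF.
rewrite EFinD leeD ?IH//.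
apply: (piece (A' := B n.+1)) => //.
- by apply: measurableI => //; exact: measurableD.
- by move=> t [_ []].
- by rewrite divr_ge0 ?sqr_ge0// mulr_ge0// ltW.
- move=> t [It [_ nB]]; have far : 2 ^+ n * eps <= `|t - t0|.
    by rewrite leNgt distrC; apply/negP.
  have q0 : 0 < 2 ^+ n * eps by rewrite mulr_gt0.
  rewrite ler_pdivlMr ?exprn_gt0// mulrC (le_trans _ (p_far It))// ler_wpM2r//.
  by rewrite ler_pXn2r ?nnegrE// ltW.
- by apply: avg => //; rewrite mulr_gt0.
Qed.

(** A kernel of height [2 / eps] with quadratic decay tests [phi] on dyadic shells around [t0]. The
    shells inside radius [dl] are governed by the small averages [eta]; outside, the kernel is of
    order [eps] and only the total mass [K] matters. *)
Lemma dyadic_kernel_bound :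
  (\int[lam]_(t in I) (p t * phi t)%:E <= (eta * (4 + 8 * C) + 4 * C * eps / dl ^+ 2 * K)%:E)%E.
Proof.
have dl0 : 0 < dl by exact: lt_trans eps_dl.
have p2 k : 0 < (2 : R) ^+ k by rewrite exprn_gt0.
have exN : exists n, dl <= 2 ^+ n * eps.
  have q0 : 0 <= dl / eps by rewrite divr_ge0// ltW.
  exists (Num.Def.archi_bound (dl / eps)); rewrite -ler_pdivrMr//.
  rewrite (le_trans (ltW (archi_boundP q0)))// -natrX ler_nat.
  exact/ltnW/ltn_expl.
(* As [eps < dl], the least [n] is not 0. Its predecessor [N] gives a ball inside radius [dl] whose
   complement lies at distance at least [dl / 2] from [t0]. *)
have [n hn nmin] := ex_minnP exN.
case: n hn nmin => [|N] hn nmin.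
  by move: hn; rewrite expr0 mul1r leNgt eps_dl.
have hN : 2 ^+ N * eps < dl.
  by rewrite ltNge; apply/negP => /nmin; rewrite ltnn.
have -> : I = (I `&` B N) `|` (I `\` B N) by rewrite setUIDK.
rewrite ge0_integral_setU//=; first last.
- by apply/disj_setPS => t [[_ Bt] []].
- by move=> t _; rewrite lee_fin mulr_ge0.
- by apply: mpphi => t [[]|[]].
- exact: measurableD.
- exact: measurableI.
rewrite EFinD; apply: leeD.
  apply: (le_trans (psi hN)); rewrite lee_fin ler_wpM2l// lerD2l ler_piMr ?mulr_ge0//.
apply: (piece (A' := I)) => //.
- exact: measurableD.
- by rewrite divr_ge0 ?sqr_ge0// !mulr_ge0// ltW.
- move=> t [It nB]; have far : dl / 2 <= `|t - t0|.
    apply: (@le_trans _ _ (2 ^+ N * eps)).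
      by rewrite ler_pdivrMr// mulrC mulrA -exprS.
    by rewrite leNgt distrC; apply/negP.
  have d20 : 0 < dl / 2 by rewrite divr_gt0.
  have -> : 4 * C * eps / dl ^+ 2 = C * eps / (dl / 2) ^+ 2 by field; rewrite gt_eqF.
  rewrite ler_pdivlMr ?exprn_gt0// mulrC (le_trans _ (p_far It))// ler_wpM2r//.
  by rewrite ler_pXn2r ?nnegrE// ltW.
Qed.

End DyadicKernel.

(** * Fatou's theorem *)

Section Chord.
Variable R : realType.
Implicit Types t x : R.

Lemma sqr_normc_expi2pi_sub t t' : normc ((@expi2pi R t : R[i]) - @expi2pi R t') ^+ 2 =
  4 * sin (pi * (t - t')) ^+ 2.
Proof.
rewrite sqr_normcE /=.
have h1 := cos2Dsin2 (2 * pi * t); have h2 := cos2Dsin2 (2 * pi * t').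
have h3 := cosB (2 * pi * t) (2 * pi * t').
have h4 : cos ((pi * (t - t')) *+ 2) = 2 * cos (pi * (t - t')) ^+ 2 - 1.
  by rewrite cos_mulr2n mulr_natl.
have h5 := cos2Dsin2 (pi * (t - t')).
have E : 2 * pi * t - 2 * pi * t' = (pi * (t - t')) *+ 2 by rewrite -mulr_natl; ring.
rewrite E h4 in h3; move: h1 h2 h3 h5.
move: (cos (2 * pi * t)) (sin (2 * pi * t)) (cos (2 * pi * t')) (sin (2 * pi * t')).
move: (cos (pi * (t - t'))) (sin (pi * (t - t'))); clear => c s a b a' b' h1 h2 h3 h5.
have -> : (a - a') ^+ 2 + (b - b') ^+ 2 = (a ^+ 2 + b ^+ 2) + (a' ^+ 2 + b' ^+ 2) - 2 * (a * a' + b * b') by ring.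
have hc : c ^+ 2 = 1 - s ^+ 2 by rewrite -h5; ring.
by rewrite h1 h2 -h3 hc; ring.
Qed.

(** Near 0 the derivative of the sine gives the slope; on the remaining compact interval, which ends
    before [pi] because [b < 1], the sine has a positive minimum. *)
Lemma sin_ge_linear (b : R) : 0 < b < 1 -> exists2 c : R, 0 < c &
  forall x, 0 <= x <= b -> c * x <= sin (pi * x).
Proof.
move=> /andP[b0 b1]; have pi0 := pi_gt0 R.
have [d d0 hd] := real_derive_expand (is_derive_sin (0 : R)) (divr_gt0 ltr01 (ltr0n R 2)).
pose d1 := Num.min (d / 2) (pi * b).
have d10 : 0 < d1 by rewrite lt_min divr_gt0// mulr_gt0.
have d1d : d1 < d by rewrite gt_min ltr_pdivrMr// ltr_pMr// ltr1n.
have d1b : d1 <= pi * b by rewrite ge_min lexx orbT.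
have cs : {within `[d1, pi * b], continuous (@sin R)}.
  by apply: continuous_subspaceT => x; exact: continuous_sin.
have [y] := EVT_min d1b cs; rewrite in_itv /= => /andP[y1 y2] ymin.
have sy : 0 < sin y.
  apply: sin_gt0_pi; rewrite (lt_le_trans d10 y1)/= (le_lt_trans y2)//.
  by rewrite -[ltRHS]mulr1 ltr_pM2l.
exists (Num.min (pi / 2) (sin y)); first by rewrite lt_min sy divr_gt0.
move=> x /andP[x0 xb]; have [xd|xd] := leP (pi * x) d1.
  have px0 : 0 <= pi * x by rewrite mulr_ge0// ltW.
  have := hd (pi * x); rewrite (ger0_norm px0) add0r sin0 subr0 cos0 mul1r.
  move=> /(_ (le_lt_trans xd d1d)); rewrite ler_norml => /andP[h _].
  apply: (@le_trans _ _ (pi / 2 * x)).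
    by rewrite ler_wpM2r// ge_min lexx.
  by move: h; rewrite -[1 / 2 * _]mulrA mul1r mulrAC; move: (pi * x) (sin _); clear; move=> p s; lra.
have := ymin (pi * x); rewrite in_itv /= (ltW xd) /= ler_pM2l// xb => /(_ isT) h.
apply: le_trans h; rewrite (le_trans (ler_wpM2r x0 (_ : _ <= sin y)))//.
  by rewrite ge_min lexx orbT.
by rewrite ler_piMr ?(ltW sy)// (le_trans xb)// ltW.
Qed.

(** For interior [t0] the distance [|t - t0|] stays below 1. At the endpoints the estimate would
    fail, since 0 and 1 parametrize the same point. *)
Lemma chord_ge (t0 : R) : 0 < t0 < 1 -> exists2 c : R, 0 < c & forall t, 0 <= t <= 1 ->
  c * `|t - t0| <= normc ((@expi2pi R t : R[i]) - @expi2pi R t0).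
Proof.
move=> /andP[t00 t01].
have b01 : 0 < Num.max t0 (1 - t0) < 1.
  by rewrite lt_max t00 gt_max t01/= gtrBl.
have [c c0 hc] := sin_ge_linear b01; exists c => // t /andP[h0 h1].
have tb : 0 <= `|t - t0| <= Num.max t0 (1 - t0).
  rewrite normr_ge0 /= le_max; have [tt|tt] := leP t t0.
    by rewrite ler0_norm ?subr_le0// opprB gerBl h0.
  by rewrite gtr0_norm ?subr_gt0// lerD2r h1 orbT.
have := hc _ tb => hs.
have n0 := normc_ge0 ((@expi2pi R t : R[i]) - @expi2pi R t0).
rewrite -(ler_pXn2r (n := 2)) ?nnegrE//; last by rewrite mulr_ge0// ltW.
rewrite sqr_normc_expi2pi_sub.
have -> : sin (pi * (t - t0)) ^+ 2 = sin (pi * `|t - t0|) ^+ 2.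
  have [tt|tt] := leP 0 (t - t0); first by rewrite ger0_norm.
  by rewrite ltr0_norm// mulrN sinN sqrrN.
have cx0 : 0 <= c * `|t - t0| by rewrite mulr_ge0// ltW.
apply: (@le_trans _ _ (sin (pi * `|t - t0|) ^+ 2)).
  by rewrite ler_pXn2r ?nnegrE// (le_trans cx0).
by rewrite ler_peMl ?sqr_ge0// ler1n.
Qed.

End Chord.

Section Fatou.
Variable R : realType.
Local Notation C := R[i].
Local Notation T := (@unit_circle R : set (borelC R)).
Local Notation m := (@circle_measure R).
Local Notation lam := (@lebesgue_measure R).
Local Notation I01 := (`[0%R, 1%R]%classic : set (measurableTypeR R)).
Implicit Types (z w a : C) (v : C -> R).

Let mI : measurable I01. Proof. exact: measurable_itv. Qed.

Lemma measurable_comp_expi2pi (v : C -> R) : measurable_fun T (v : borelC R -> R) ->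
  measurable_fun setT (v \o @expi2pi R).
Proof.
move=> mv; apply: (measurable_comp (@measurable_T R) _ mv (@measurable_expi2pi R)).
by move=> _ [t _ <-]; exact: expi2pi_T.
Qed.

Lemma integrable_comp_expi2pi v : m.-integrable T (fun z : borelC R => (v z)%:E) ->
  lam.-integrable I01 (EFin \o (v \o @expi2pi R)).
Proof.
move=> /integrableP[mv iv]; have mv' : measurable_fun T (v : borelC R -> R) by exact/measurable_EFinP.
apply/integrableP; split.
  by apply/measurable_EFinP; apply: measurable_funS (measurable_comp_expi2pi mv').
rewrite -(@circle_integral_ge0 R (fun z => `|(v z)%:E|%E))//.
by apply/measurable_EFinP; exact: measurableT_comp.
Qed.

Lemma lebesgue_pt_avg (f : R -> R) (t0 : R) : lebesgue_pt f t0 -> forall eta : R, 0 < eta ->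
  exists2 dl : R, 0 < dl & forall r, 0 < r -> r < dl ->
    (\int[lam]_(t in ball t0 r) (`|f t - f t0|)%:E <= (2 * r * eta)%:E)%E.
Proof.
move=> /fine_cvgP[hfin /cvgrPdist_lt h] eta eta0.
have [dl /= dl0 hdl] : \forall r \near 0^'+, davg f t0 r \is a fin_num /\ `|0 - fine (davg f t0 r)| < eta.
  by apply: filterS2 hfin (h _ eta0) => r.
exists dl => // r r0 rdl.
have rr : `|0 - r| < dl by rewrite sub0r normrN gtr0_norm.
have [fin] := hdl r rr r0; rewrite sub0r normrN => hh.
have {}hh : (davg f t0 r <= eta%:E)%E.
  by rewrite -(fineK fin) lee_fin ltW// (le_lt_trans (ler_norm _)).
move: hh; rewrite /davg /iavg lebesgue_measure_ball ?(ltW r0)//.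
have r2 : 0 < r *+ 2 by rewrite mulrn_wgt0.
rewrite inver gt_eqF// lee_pdivrMl// => hh.
rewrite (_ : 2 * r * eta = r *+ 2 * eta); last by rewrite mulr_natl.
by rewrite EFinM.
Qed.

(** In a Stolz region [normc (x - z) <= (1 + al) * normc (x - w)], so the Poisson kernel at [w] is
    controlled by the distance to the vertex [z] instead of [w]. *)
Lemma poisson_stolz (al : R) z w x : 1 < al -> unit_circle z -> unit_circle x ->
  stolz_region al z w ->
  poisson w x <= 2 / (1 - normc w) /\
  normc (x - z) ^+ 2 * poisson w x <= 2 * (1 + al) ^+ 2 * (1 - normc w).
Proof.
move=> al1 Tz Tx [w1 hw]; split; first exact: poisson_le.
have e0 : 0 < 1 - normc w by rewrite subr_gt0.
have n0 := circle_sub_gt0 w1 Tx.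
have h1 : normc (x - z) <= (1 + al) * normc (x - w).
  rewrite -(subrKA w) (le_trans (le_normcD _ _))// mulrDl mul1r lerD2l.
  rewrite (le_trans (ltW hw))// ler_wpM2l ?(le_trans ler01 (ltW al1))//.
  exact: circle_sub_ge.
have al0 : 0 < 1 + al by rewrite addr_gt0// (lt_trans ltr01).
rewrite /poisson mulrA ler_pdivrMr ?exprn_gt0//.
have -> : 1 - normc w ^+ 2 = (1 + normc w) * (1 - normc w) by ring.
have -> : 2 * (1 + al) ^+ 2 * (1 - normc w) * normc (x - w) ^+ 2 =
  ((1 + al) * normc (x - w)) ^+ 2 * (2 * (1 - normc w)) by ring.
apply: ler_pM; rewrite ?sqr_ge0//.
- by rewrite mulr_ge0 ?(ltW e0)// addr_ge0// normc_ge0.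
- by rewrite ler_pXn2r ?nnegrE ?normc_ge0// mulr_ge0 ?normc_ge0// ltW.
- by rewrite ler_pM2r// -[leRHS]/(1 + 1) lerD2l ltW.
Qed.

(** At a Lebesgue point the averages of [phi] are small; [poisson_stolz] and [chord_ge] provide the
    height and decay of the kernel required by [dyadic_kernel_bound], with [eps = 1 - normc w]. *)
Lemma poisson_integral_stolz_cvg v (t0 : R) : m.-integrable T (fun z : borelC R => (v z)%:E) ->
  0 < t0 < 1 -> lebesgue_pt ((v \o @expi2pi R) \_ I01) t0 ->
  forall al : R, 1 < al ->
  poisson_integral v w @[w --> within (stolz_region al (@expi2pi R t0)) (nbhs (@expi2pi R t0 : C))]
    --> v (@expi2pi R t0).
Proof.
move=> iv t001 lpt al al1; have mT := @measurable_T R.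
set z0 : C := @expi2pi R t0; have Tz0 : unit_circle z0 by exact: expi2pi_T.
set f := _ \_ _ in lpt.
have /andP[t00 t01] := t001.
have It0 : I01 t0 by rewrite /= in_itv /= !ltW.
have fE t : I01 t -> f t = v (@expi2pi R t) by move=> It; rewrite /f patchE mem_set.
pose phi t := `|f t - f t0|.
have mv : measurable_fun T (v : borelC R -> R) by apply/measurable_EFinP; exact: measurable_int iv.
have mf : measurable_fun setT f.
  apply/(measurable_restrictT _ _).1 => //.
  exact: measurable_funS (measurable_comp_expi2pi mv).
have mphi : measurable_fun setT phi.
  by apply: measurableT_comp => //; apply: measurable_funB.
have [c c0 hc] := chord_ge t001.
pose CC := 2 * (1 + al) ^+ 2 / c ^+ 2.
have al0 : 0 < 1 + al by rewrite addr_gt0// (lt_trans ltr01).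
have CC0 : 0 <= CC by rewrite divr_ge0 ?sqr_ge0// mulr_ge0// sqr_ge0.
have ivz : m.-integrable T (fun w : borelC R => (v w - v z0)%:E).
  have := RintegrableD mT iv (circle_integrable_cst (- v z0)).
  by [].
have iphi : (\int[lam]_(t in I01) (phi t)%:E < +oo)%E.
  have /integrableP[_] := integrable_comp_expi2pi ivz; apply: le_lt_trans.
  rewrite le_eqVlt; apply/orP; left; apply/eqP; apply: eq_integral => t; rewrite inE => It.
  by rewrite /phi !fE.
have phi0 t : 0 <= phi t by exact: normr_ge0.
have phi_ge0 : (0 <= \int[lam]_(t in I01) (phi t)%:E)%E.
  by apply: integral_ge0 => t _; rewrite lee_fin.
pose K := fine (\int[lam]_(t in I01) (phi t)%:E).
have K0 : 0 <= K by exact: fine_ge0.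
have KE : (\int[lam]_(t in I01) (phi t)%:E)%E = K%:E by rewrite fineK// ge0_fin_numE.
apply/cvgrPdist_lt => e e0.
(* The shells then contribute [e / 2]. The distant part is proportional to [1 - normc w], hence to
   the distance from [w] to the vertex at most, and takes the other half. *)
pose eta := e / 2 / (4 + 8 * CC).
have C40 : 0 < 4 + 8 * CC by rewrite ltr_wpDr// mulr_ge0.
have eta0 : 0 < eta by rewrite !divr_gt0.
have [dl dl0 havg] := lebesgue_pt_avg lpt eta0.
pose B := 4 * CC / dl ^+ 2 * K + 1.
have B0 : 0 < B by rewrite ltr_wpDl// mulr_ge0// divr_ge0 ?sqr_ge0// mulr_ge0.
apply/nbhsc_normP; exists (Num.min dl (e / 2 / B)).
  by rewrite lt_min dl0 !divr_gt0.
move=> w; rewrite lt_min => /andP[wdl wB] sw.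
have [Dw _] := sw; have w1 : normc w < 1 by [].
set eps := 1 - normc w; have eps0 : 0 < eps by rewrite subr_gt0.
have epsw : eps <= normc (z0 - w) by exact: circle_sub_ge.
pose p t := poisson w (@expi2pi R t).
have Tt (t : R) : unit_circle (@expi2pi R t : C) by exact: expi2pi_T.
have p0 t : 0 <= p t by exact: poisson_ge0.
have mp : measurable_fun I01 p.
  exact: measurable_funS (measurable_comp_expi2pi (poisson_measurable w1)).
have := @dyadic_kernel_bound R p phi I01 t0 eps dl eta CC K mI mp mphi p0 phi0
  eps0 (le_lt_trans epsw wdl) (ltW eta0) CC0 _ _ havg _.
rewrite KE => hb.
have {}hb : (\int[lam]_(t in I01) (p t * phi t)%:E <= (eta * (4 + 8 * CC) + 4 * CC * eps / dl ^+ 2 * K)%:E)%E.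
  apply: hb => //.
    by move=> t It; case: (poisson_stolz al1 Tz0 (Tt t) sw).
  move=> t It; have [_ h2] := poisson_stolz al1 Tz0 (Tt t) sw.
  have -> : CC * eps = 2 * (1 + al) ^+ 2 * eps / c ^+ 2 by rewrite /CC mulrAC.
  rewrite ler_pdivlMr ?exprn_gt0//.
  apply: le_trans h2; rewrite [leLHS]mulrAC ler_wpM2r// mulrC -exprMn.
  by rewrite ler_pXn2r ?nnegrE ?normc_ge0 ?mulr_ge0 ?(ltW c0)//; apply: hc; move: It; rewrite /= in_itv.
have -> : v z0 - poisson_integral v w = - (poisson_integral (fun x => v x - v z0) w).
  rewrite poisson_integralD//; last exact: circle_integrable_cst.
  by rewrite poisson_integral_cst// opprB.
rewrite normrN.
have ip := integrable_poissonM w1 ivz.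
apply: le_lt_trans (le_normr_Rintegral mT ip) _.
have -> : Rintegral m T (fun x => `|poisson w x * (v x - v z0)|) =
    fine (\int[lam]_(t in I01) (p t * phi t)%:E).
  congr fine; rewrite circle_integral_ge0//.
    apply: eq_integral => t; rewrite inE => It.
    by rewrite normrM (ger0_norm (p0 t)) /phi !fE.
  by have /integrableP[] := integrable_norm ip.
apply: (@le_lt_trans _ _ (eta * (4 + 8 * CC) + 4 * CC * eps / dl ^+ 2 * K)).
  rewrite -lee_fin fineK// ge0_fin_numE ?(le_lt_trans hb) ?ltry//.
  by apply: integral_ge0 => t _; rewrite lee_fin mulr_ge0.
rewrite [ltRHS]splitr; apply: ler_ltD.
  by rewrite /eta divfK// gt_eqF.
have epsB : eps * B < e / 2.
  by rewrite -ltr_pdivlMr// (le_lt_trans epsw).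
apply: le_lt_trans epsB.
have -> : 4 * CC * eps / dl ^+ 2 * K = eps * (4 * CC / dl ^+ 2 * K).
  by move: (eps) => x; ring.
by rewrite ler_wpM2l ?(ltW eps0)// lerDl.
Qed.

End Fatou.

Section FatouTheorem.
Variable R : realType.
Local Notation C := R[i].
Local Notation T := (@unit_circle R : set (borelC R)).
Local Notation m := (@circle_measure R).
Local Notation lam := (@lebesgue_measure R).
Local Notation I01 := (`[0%R, 1%R]%classic : set (measurableTypeR R)).
Implicit Types (z w a : C) (v : C -> R) (F b : C -> C).

Lemma poisson_integral_ntlim v : m.-integrable T (fun z : borelC R => (v z)%:E) ->
  {ae m, forall z : borelC R, T z -> forall al : R, 1 < al ->
    poisson_integral v w @[w --> within (stolz_region al z) (nbhs (z : C))] --> v z}.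
Proof.
move=> iv; apply: ae_circle.
have lint := integrable_locally_restrict (measurable_itv _) (integrable_comp_expi2pi iv).
have ld := lebesgue_differentiation lint.
(* The endpoints, where [chord_ge] does not apply, form a null set. *)
have n01 : {ae lam, forall t : R, t <> 0 /\ t <> 1}.
  exists [set 0; 1]; split.
  - by apply: measurableU; exact: measurable_set1.
  - apply/eqP; rewrite eq_le measure_ge0 andbT.
    have le01 : (lam ([set 0%R] `|` [set 1%R]) <= lam [set 0%R] + lam [set 1%R])%E.
      by apply: measureU2; exact: measurable_set1.
    by apply: le_trans le01 _; rewrite [lam _]lebesgue_measure_set1 [lam _]lebesgue_measure_set1 adde0.
  - move=> t /= h; have [->|n0] := pselect (t = 0); first by left.
    by right; apply: contrapT => n1; apply: h.
have Flam : Filter (almost_everywhere lam) by exact: ae_filter_ringOfSetsType.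
apply: (@filterS2 _ _ Flam _ _ _ _ n01 ld) => t [t0 t1] lpt /=; rewrite in_itv /= => /andP[h0 h1] al al1.
apply: poisson_integral_stolz_cvg => //.
by rewrite !lt_neqAle h0 h1 !andbT; apply/andP; split; apply/eqP => // /esym.
Qed.

Lemma Re_circle_poisson b a : circle_integral (fun z => b z * (poisson a z)%:C) =
  poisson_integral (fun z => complex.Re (b z)) a +i*
  poisson_integral (fun z => complex.Im (b z)) a.
Proof.
rewrite /circle_integral /poisson_integral; congr Complex; apply: eq_Rintegral => z _.
  by rewrite ReM /= mulr0 subr0 mulrC.
by rewrite ImM /= mulr0 add0r mulrC.
Qed.

Lemma ntlim_poisson F b : circle_integrable b ->
  (forall a, normc a < 1 -> F a = circle_integral (fun z => b z * (poisson a z)%:C)) ->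
  {ae m, forall z : borelC R, T z -> has_ntlim F z (b z)}.
Proof.
move=> [bi1 bi2] hF.
apply: filterS2 (poisson_integral_ntlim bi1) (poisson_integral_ntlim bi2).
move=> z h1 h2 Tz al al1.
have [W FW] : exists W, W = within (stolz_region al z) (nbhs (z : C)) by eexists.
have FFW : Filter W by rewrite FW; exact: within_filter.
rewrite -FW; have := h1 Tz al al1; have := h2 Tz al al1; rewrite -FW => c2 c1.
have c12 : (fun w => poisson_integral (fun z => complex.Re (b z)) w +i*
  poisson_integral (fun z => complex.Im (b z)) w) @ W --> b z.
  by apply/cvgc_ReIm.
apply: cvg_trans c12; apply: near_eq_cvg.
rewrite FW; apply/nbhsc_normP; exists 1 => // w _ [Dw _].
by rewrite hF// Re_circle_poisson.
Qed.

End FatouTheorem.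

(** * Boundary functions of bounded analytic functions *)

Section BoundaryFunction.
Variable R : realType.
Local Notation C := R[i].
Local Notation T := (@unit_circle R : set (borelC R)).
Local Notation m := (@circle_measure R).
Variables (g : C -> C) (M : R).
Hypothesis dg : analytic_in_disk g.
Hypothesis gM : forall z, normc z < 1 -> normc (g z) <= M.
Implicit Types (z w a : C) (r s x y : R).

Let M0 : 0 <= M.
Proof. by apply: le_trans (normc_ge0 (g 0)) (gM _); rewrite normc0 ltr01. Qed.

Definition correlation r s : C :=
  circle_integral (fun z => g (r%:C * z) * (g (s%:C * z))^*%C).

(* By Cauchy's theorem in an annulus, the correlation depends only on the product r * s. *)
Lemma correlation_shift r s x : 0 < r < 1 -> 0 < s < 1 -> 0 < x ->
  r * x < 1 -> s / x < 1 -> correlation (r * x) (s / x) = correlation r s.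
Proof.
move=> /andP[r0 r1] /andP[s0 s1] x0 rx sx.
(* [G] is analytic in [w], the two conjugations undoing each other. For [w = y z] with [z] on the
   circle, [s / w] has conjugate [(s / y) z], so the mean of [G] over radius [y] is the correlation
   at [r y] and [s / y]. *)
pose G w := g (r%:C * w) * (g ((s%:C * w^-1)^*%C))^*%C.
have dG w : 0 < normc w -> r * normc w < 1 -> s / normc w < 1 -> derivable G w 1.
  move=> w0 rw sw; have wn0 : w != 0 by rewrite -normc_gt0.
  have d1 : derivable (fun w => g (r%:C * w)) w 1.
    apply: cderiv_scale; apply: dg.
    by rewrite /unit_disk /= normcM normc_real gtr0_norm.
  have d2 : derivable (fun w => s%:C * w^-1) w 1.
    exact (cderivM (cderiv_cst _ w) (cderivV (F := fun w => w) wn0 (cderiv_id w))).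
  have d3 : derivable (fun u => (g (u^*%C))^*%C) (s%:C * w^-1) 1.
    apply: cderiv_conj; apply: dg.
    by rewrite /unit_disk /= normc_conj normcM normcV normc_real gtr0_norm.
  exact (cderivM d1 (@cderiv_comp R (fun u => (g (u^*%C))^*%C) (fun w => s%:C * w^-1) w d2 d3)).
have GE y : 0 < y -> circle_mean G y = correlation (r * y) (s / y).
  move=> y0; apply: eq_circle_integral => z Tz; rewrite /G; congr (g _ * (g _)^*%C).
    by rewrite mulrA -rmorphM.
  have z0 := circle_neq0 Tz.
  have zi : z^-1 = z^*%C by rewrite -[LHS]mulr1 -(circle_conj Tz) mulKf.
  have sy : s%:C * (y%:C)^-1 = (s / y)%:C by rewrite [RHS]rmorphM /= fmorphV.
  by rewrite invfM zi mulrA sy rmorphM /= conjcK; congr (_ * z); rewrite oppr0.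
have one : correlation r s = circle_mean G 1 by rewrite GE// mulr1 divr1.
rewrite one -GE//; have [x1|/ltW x1] := leP x 1.
  apply: circle_mean_annulus => // z /andP[h1 h2]; have z0 := lt_le_trans x0 h1.
  apply: dG => //; first by rewrite (le_lt_trans _ r1)// ler_piMr// ltW.
  apply: le_lt_trans sx; rewrite ler_wpM2l ?(ltW s0)// lef_pV2//.
apply/esym; apply: circle_mean_annulus => // z /andP[h1 h2]; have z0 := lt_le_trans ltr01 h1.
apply: dG => //; first by rewrite (le_lt_trans _ rx)// ler_wpM2l// ltW.
by rewrite (le_lt_trans _ s1)// ler_pdivrMr// ler_peMr// ltW.
Qed.

Definition dil x z : C := g ((expR x)%:C * z).

Lemma dil_expR_itv x : x < 0 -> 0 < expR x < 1.
Proof. by move=> x0; rewrite expR_gt0 expR_lt1. Qed.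

Lemma dil_deriv x z : x < 0 -> normc z <= 1 -> derivable (dil x) z 1.
Proof.
by move=> x0 z1; have /andP[e0 e1] := dil_expR_itv x0; apply: dilation_derivable => //; rewrite ltW.
Qed.

Lemma dil_cmeas x : x < 0 -> cmeas T (dil x : borelC R -> C).
Proof.
move=> x0; apply: continuous_cmeas_T => z Tz; apply: derivable_continuous.
by apply: dil_deriv; rewrite ?Tz.
Qed.

Lemma dil_le x z : x < 0 -> unit_circle z -> normc (dil x z) <= M.
Proof.
move=> x0 Tz; apply: gM; have /andP[e0 e1] := dil_expR_itv x0.
by rewrite normc_scale_T// ltW.
Qed.

(** The squared L^2 norm of the dilation, as a function of the logarithm of its radius. *)
Definition energy x : R := complex.Re (correlation (expR x) (expR x)).

Lemma correlation_mid x y : x < 0 -> y < 0 ->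
  complex.Re (correlation (expR x) (expR y)) = energy ((x + y) / 2).
Proof.
move=> x0 y0; have r1 := dil_expR_itv x0; have s1 := dil_expR_itv y0.
have e1 : expR x * expR ((y - x) / 2) = expR ((x + y) / 2).
  by rewrite -expRD; congr expR; field.
have e2 : expR y / expR ((y - x) / 2) = expR ((x + y) / 2).
  by rewrite -expRN -expRD; congr expR; field.
have lt1 : expR ((x + y) / 2) < 1 by rewrite expR_lt1; lra.
have := correlation_shift r1 s1 (expR_gt0 ((y - x) / 2)).
by rewrite e1 e2 => /(_ lt1 lt1) h; rewrite /energy h.
Qed.

Let cross_int x y : x < 0 -> y < 0 ->
  circle_integrable (fun z => dil x z * (dil y z)^*%C).
Proof.
move=> x0 y0; apply: (circle_integrable_bounded (M := M * M)).
  by apply: cmeasM; [exact: dil_cmeas|apply: cmeas_conj; exact: dil_cmeas].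
by move=> z Tz; rewrite normcM normc_conj ler_pM ?normc_ge0 ?dil_le.
Qed.

(** Expanding the square leaves a cross term which [correlation_mid] evaluates at the midpoint. The
    L^2 distance thus measures the midpoint convexity of the energy. *)
Lemma energy_dist x y : x < 0 -> y < 0 ->
  Rintegral m T (fun z => normc (dil x z - dil y z) ^+ 2) =
  energy x + energy y - 2 * energy ((x + y) / 2).
Proof.
move=> x0 y0; have ixx := cross_int x0 x0; have iyy := cross_int y0 y0.
have ixy := cross_int x0 y0.
transitivity (complex.Re (circle_integral (fun z => dil x z * (dil x z)^*%C +
    dil y z * (dil y z)^*%C - 2 * (dil x z * (dil y z)^*%C)))).
  have two : (2 : C) = 2%:C by rewrite [RHS]rmorph_nat.
  apply: eq_Rintegral => z _; rewrite sqr_normcE two.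
  case: (dil x z) (dil y z) => [p q] [p' q'] /=.
  by ring.
rewrite circle_integralB; [|exact: circle_integrableD|exact: circle_integrableZ].
rewrite circle_integralD// circle_integralZ// ReB ReD -(correlation_mid x0 y0).
by rewrite mulr_natl [in RHS]mulr_natl !mulr2n ReD.
Qed.

Lemma energy_bounds x : x < 0 -> 0 <= energy x <= M ^+ 2.
Proof.
move=> x0; have ixx := cross_int x0 x0.
have E : energy x = Rintegral m T (fun z => normc (dil x z) ^+ 2).
  by apply: eq_Rintegral => z _; rewrite mulc_conj.
apply/andP; split; first by rewrite E; apply: Rintegral_ge0 => z _; exact: sqr_ge0.
rewrite E -(@circle_Rintegral_cst R (M ^+ 2)); apply: (le_Rintegral (@measurable_T R)).
- case: ixx => h _; move: h; apply: eq_integrable => //; first exact: measurable_T.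
  by move=> z _; rewrite mulc_conj.
- exact: circle_integrable_cst.
- by move=> z Tz; rewrite ler_pXn2r ?nnegrE ?normc_ge0 ?dil_le.
Qed.

(* A bounded midpoint convex function on a left half-line is nondecreasing. *)
Lemma energy_nondecreasing x y : x <= y -> y < 0 -> energy x <= energy y.
Proof.
rewrite le_eqVlt => /orP[/eqP->//|xy] y0; rewrite leNgt; apply/negP => exy.
set h := y - x; have h0 : 0 < h by rewrite subr_gt0.
set d := energy x - energy y; have d0 : 0 < d by rewrite subr_gt0.
have conv u v : u < 0 -> v < 0 -> 2 * energy ((u + v) / 2) <= energy u + energy v.
  move=> u0 v0; rewrite -subr_ge0 -energy_dist//.
  by apply: Rintegral_ge0 => z _; exact: sqr_ge0.
have neg (k : nat) : y - k%:R * h < 0.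
  by rewrite (le_lt_trans _ y0)// gerBl mulr_ge0// ltW.
(* By convexity a drop of [d] between [x] and [y] is repeated on every further step of length [h] to
   the left, so the energy would exceed its bound [M ^+ 2]. *)
have dec (k : nat) : d <= energy (y - k.+1%:R * h) - energy (y - k%:R * h).
  elim: k => [|k IH]; first by rewrite mul0r subr0 mul1r (_ : y - h = x)// /h; ring.
  have := conv _ _ (neg k.+2) (neg k).
  rewrite (_ : (y - k.+2%:R * h + (y - k%:R * h)) / 2 = y - k.+1%:R * h); last first.
    by rewrite -[k.+2]addn2 -[k.+1]addn1 !natrD; field.
  by move: IH; move: (energy _) (energy _) (energy _); clear; move=> p q r; lra.
have grow (k : nat) : k%:R * d <= energy (y - k%:R * h) - energy y.
  elim: k => [|k IH]; first by rewrite !mul0r subr0 subrr.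
  have -> : k.+1%:R * d = k%:R * d + d by rewrite -natr1 mulrDl mul1r.
  move: (dec k) IH; generalize (energy (y - k.+1%:R * h)) (energy (y - k%:R * h)) (energy y) (k%:R * d) => p q r s.
  clear => h1 h2; lra.
have q0 : 0 <= M ^+ 2 / d by rewrite divr_ge0 ?sqr_ge0// ltW.
have := archi_boundP q0; set k := Num.Def.archi_bound _; rewrite ltr_pdivrMr// => hk0.
have hk : (M ^+ 2 < k%:R * d)%R := hk0.
have /andP[_ h1] := energy_bounds (neg k); have /andP[h2 _] := energy_bounds y0.
have gk := grow k; move: gk hk h1 h2; generalize (energy (y - k%:R * h)) (energy y) (k%:R * d) (M ^+ 2) => p q r s.
clear => h4 h5 h6 h7.
suff : (0 : R) < 0 by rewrite ltxx.
lra.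
Qed.

(** In [energy_dist] monotonicity bounds the energy at the midpoint below by the one at [x]. *)
Lemma energy_dist_le x y : x <= y -> y < 0 ->
  Rintegral m T (fun z => normc (dil x z - dil y z) ^+ 2) <= energy y - energy x.
Proof.
move=> xy y0; have x0 := le_lt_trans xy y0; rewrite energy_dist//.
have h : energy x <= energy ((x + y) / 2) by apply: energy_nondecreasing; lra.
by move: h; generalize (energy x) (energy y) (energy ((x + y) / 2)) => p q r h; lra.
Qed.

End BoundaryFunction.

Section MeasurableLimits.
Context d (X : measurableType d) (R : realType).
Variables (mu : {measure set X -> \bar R}) (D : set X).
Hypothesis mD : measurable D.

(** The upper limit is measurable everywhere and equals the limit where the latter exists. *)
Lemma ae_cvg_measurable_limit (f_ : nat -> X -> R) :
  (forall n, measurable_fun D (f_ n)) ->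
  {ae mu, forall x, D x -> cvgn (f_ ^~ x)} ->
  exists2 f : X -> R, measurable_fun D f &
    {ae mu, forall x, D x -> f_ ^~ x @ \oo --> f x}.
Proof.
move=> mf cf; exists (fun x => fine (limn_esup (fun n => (f_ n x)%:E))).
  apply: (measurableT_comp (f := @fine R)).
    by apply: fine_measurable; exact: measurableT.
  by apply: measurable_fun_limn_esup => n; exact/measurable_EFinP.
apply: filterS cf => x h Dx; have /cvg_ex[l fl] := h Dx.
have flE : (f_ n x)%:E @[n --> \oo] --> l%:E by apply/fine_cvgP; split; [exact: nearW|exact: fl].
have -> : limn_esup (fun n => (f_ n x)%:E) = l%:E.
  by rewrite is_cvg_limn_esupE; [exact: cvg_lim|apply/cvg_ex; exists l%:E].
exact: fl.
Qed.

(** The sum of the norms of the increments has finite integral, hence is finite almost everywhere,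
    and there the telescoping series converges absolutely. *)
Lemma ae_cvg_summable_increments (f_ : nat -> X -> R[i]) (eps : nat -> R) :
  (forall n, cmeas D (f_ n)) ->
  (forall n, (\int[mu]_(x in D) (normc (f_ n.+1 x - f_ n x))%:E <= (eps n)%:E)%E) ->
  (\sum_(n <oo) (eps n)%:E < +oo)%E ->
  exists2 f, cmeas D f & {ae mu, forall x, D x -> f_ ^~ x @ \oo --> f x}.
Proof.
move=> mf feps seps.
have mI n : measurable_fun D (fun x => (normc (f_ n.+1 x - f_ n x))%:E).
  have mB : cmeas D (fun x => f_ n.+1 x - f_ n x).
    have [a1 a2] := mf n.+1; have [b1 b2] := mf n.
    split; [under eq_fun do rewrite ReB | under eq_fun do rewrite ImB];
    exact: measurable_funB.
  by apply/measurable_EFinP; exact: (cmeas_normc mB).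
have n0 n x : (0 <= (normc (f_ n.+1 x - f_ n x))%:E)%E by rewrite lee_fin normc_ge0.
have iS : mu.-integrable D (fun x => \sum_(n <oo) (normc (f_ n.+1 x - f_ n x))%:E)%E.
  apply/integrableP; split.
    by apply: ge0_emeasurable_sum => // n x _ _; exact: n0.
  rewrite (eq_integral (fun x => \sum_(n <oo) (normc (f_ n.+1 x - f_ n x))%:E)%E); last first.
    by move=> x _; rewrite gee0_abs//; apply: nneseries_ge0 => n _ _; exact: n0.
  rewrite integral_nneseries//; apply: le_lt_trans seps.
  by apply: lee_nneseries => // n _ _; apply: integral_ge0 => x _; exact: n0.
have fin : {ae mu, forall x, D x -> cvgn (fun n => complex.Re (f_ n x)) /\
                                    cvgn (fun n => complex.Im (f_ n x))}.
  apply: filterS (integrable_ae mD iS) => x h Dx.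
  have {h} := h Dx; rewrite fin_numElt => /andP[_ h].
  have cv (p : R[i] -> R) : (forall z w, p (z - w) = p z - p w) ->
      (forall z, `|p z| <= normc z) -> cvgn (fun n => p (f_ n x)).
    move=> pB pn; pose u n := p (f_ n x).
    have cn : cvgn [normed series (telescope u)].
      apply: nnseries_is_cvg => [i|]; first exact: normr_ge0.
      apply: le_lt_trans h; apply: lee_nneseries => [n _ _|n _]; first by rewrite lee_fin normr_ge0.
      by rewrite lee_fin; apply: le_trans (pn _); rewrite pB; exact: lexx.
    have := normed_cvg cn; rewrite telescopeK => /cvg_ex[l ul].
    apply/cvg_ex; exists (l + u 0%N).
    have -> : (fun n => p (f_ n x)) = (fun n => (u n - u 0%N) + u 0%N).
      by apply/funext => n; rewrite subrK.
    by apply: cvgD; [exact: ul|exact: cvg_cst].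
  by split; apply: cv; first [exact: ReB|exact: ImB|exact: ler_Re_normc|exact: ler_Im_normc].
have fin1 : {ae mu, forall x, D x -> cvgn (fun n => complex.Re (f_ n x))}.
  by apply: filterS fin => x h Dx; have [] := h Dx.
have fin2 : {ae mu, forall x, D x -> cvgn (fun n => complex.Im (f_ n x))}.
  by apply: filterS fin => x h Dx; have [] := h Dx.
have [p mp cp] := ae_cvg_measurable_limit (fun n => (mf n).1) fin1.
have [q mq cq] := ae_cvg_measurable_limit (fun n => (mf n).2) fin2.
exists (fun x => p x +i* q x) => //.
by apply: filterS2 cp cq => x hp hq Dx; apply/cvgc_ReIm; split; [exact: hp|exact: hq].
Qed.

End MeasurableLimits.

Section BoundaryFunctionExistence.
Variable R : realType.
Local Notation C := R[i].
Local Notation T := (@unit_circle R : set (borelC R)).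
Local Notation m := (@circle_measure R).

Let gap_le (p q r s t : R) : s - r < p -> q <= s -> t <= q - p -> t <= r.
Proof. by move=> h1 h2 h3; lra. Qed.

(** Divided by [e] this reads [t <= e + t^2 / e]: an L^2 bound [e^2] on an increment becomes an L^1
    bound [2 e]. *)
Let young_le (e t : R) : 0 < e -> 0 <= t -> t * e <= e * e + t ^+ 2.
Proof. by move=> e0 t0; nra. Qed.

Variables (g : C -> C) (M : R).
Hypothesis dg : analytic_in_disk g.
Hypothesis gM : forall z, normc z < 1 -> normc (g z) <= M.

Let h (k : nat) : R := 1 / (2 ^ k.+1)%:R.

Let h_gt0 k : 0 < h k.
Proof. by rewrite divr_gt0// ltr0n expn_gt0. Qed.

(* As the energy is monotone and bounded, the dilations of g form a Cauchy net in L^2; *)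
(* this sequence of radii makes the convergence fast enough to hold almost everywhere. *)
Lemma energy_sequence : exists x_ : nat -> R, [/\ forall k, x_ k < 0,
  x_ @ \oo --> (0 : R) &
  forall k, Rintegral m T (fun z => normc (dil g (x_ k.+1) z - dil g (x_ k) z) ^+ 2) <= h k ^+ 2].
Proof.
pose E := [set energy g x | x in [set x : R | x < 0]].
have Eb x : x < 0 -> energy g x <= M ^+ 2.
  by move=> x0; have /andP[] := energy_bounds dg gM x0.
have sE : has_sup E.
  split; first by exists (energy g (-1)), (-1) => //=; rewrite ltrN10.
  by exists (M ^+ 2) => _ [x x0 <-]; exact: Eb.
have ub x : x < 0 -> energy g x <= sup E.
  by move=> x0; apply: sup_upper_bound => //; exists x.
have /choice[x_ hx] (k : nat) : exists x : R,
    [/\ x < 0, - k.+1%:R^-1 <= x & sup E - h k ^+ 2 < energy g x].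
  have hk : 0 < h k ^+ 2 by rewrite exprn_gt0.
  have [_ [y y0 <-] hy] := sup_adherent hk sE.
  have n0 : - k.+1%:R^-1 < (0 : R) by rewrite oppr_lt0 invr_gt0.
  have m0 : Num.max y (- k.+1%:R^-1) < 0 by rewrite gt_max y0 n0.
  (* Moving to the right keeps the energy near its supremum, by monotonicity, and forces the
     sequence to tend to 0. *)
  exists (Num.max y (- k.+1%:R^-1)); split; [exact: m0|by rewrite le_max lexx orbT|].
  apply: (lt_le_trans hy); apply: (energy_nondecreasing dg gM) => //.
  by rewrite le_max lexx.
exists x_; split => [k||k]; first by have [] := hx k.
  have c1 : (fun n => - @harmonic R n) @ \oo --> (0 : R).
    by rewrite -oppr0; apply: cvgN; exact: cvg_harmonic.
  apply: (squeeze_cvgr _ c1 (cvg_cst _)); apply: nearW => k.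
  by have [h1 h2 _] := hx k; rewrite h2 ltW.
have [a1 _ a2] := hx k; have [b1 _ b2] := hx k.+1.
have hh : h k.+1 ^+ 2 <= h k ^+ 2.
  have h1 : h k.+1 <= h k.
    by rewrite /h ler_pM2l// lef_pV2 ?posrE ?ltr0n ?expn_gt0// ler_nat leq_exp2l.
  by apply: lerXn2r => //; rewrite nnegrE ltW.
have ua := ub _ a1; have ubb := ub _ b1.
have mono u v a b : u <= v -> sup E - h k ^+ 2 < energy g u -> energy g v <= sup E ->
    Rintegral m T (fun z => normc (dil g a z - dil g b z) ^+ 2) <= energy g v - energy g u ->
    Rintegral m T (fun z => normc (dil g a z - dil g b z) ^+ 2) <= h k ^+ 2.
  by move=> _; exact: gap_le.
have b2' : sup E - h k ^+ 2 < energy g (x_ k.+1) by apply: le_lt_trans b2; rewrite lerD2l lerN2.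
(* The sequence need not be monotone; in either order the two energies lie within [h k ^+ 2] of the
   supremum. *)
have [xy|/ltW yx] := leP (x_ k.+1) (x_ k).
  exact: (mono _ _ _ _ xy b2' ua (energy_dist_le dg gM xy a1)).
have -> : (fun z => normc (dil g (x_ k.+1) z - dil g (x_ k) z) ^+ 2) =
   (fun z => normc (dil g (x_ k) z - dil g (x_ k.+1) z) ^+ 2).
  by apply/funext => z; rewrite normc_sub.
exact: (mono _ _ _ _ yx a2 ubb (energy_dist_le dg gM yx b1)).
Qed.

(** The dilations along [energy_sequence] have summable L^1 increments, hence converge almost
    everywhere to some [b]; they are bounded by [M], so their Poisson formulas pass to the limit. *)
Lemma boundary_function : exists2 b : C -> C, cmeas T (b : borelC R -> C) /\ circle_integrable b &
  forall a, normc a < 1 -> g a = circle_integral (fun z => b z * (poisson a z)%:C).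
Proof.
have [x_ [x0 xc xd]] := energy_sequence.
have md k := dil_cmeas dg (x0 k).
have mB k : cmeas T (fun z : borelC R => dil g (x_ k.+1) z - dil g (x_ k) z).
  have [a1 a2] := md k.+1; have [b1 b2] := md k.
  split; [under eq_fun do rewrite ReB | under eq_fun do rewrite ImB];
  exact: measurable_funB.
have le2M k z : T z -> normc (dil g (x_ k.+1) z - dil g (x_ k) z) <= M + M.
  move=> Tz; apply: le_trans (le_normcD _ _) _; rewrite normcN.
  by apply: lerD; apply: (dil_le gM).
have iB k := circle_integrable_bounded (mB k) (le2M k).
have i1 k : m.-integrable T (fun z : borelC R => (normc (dil g (x_ k.+1) z - dil g (x_ k) z))%:E).
  exact: (cintegrable_normc (@measurable_T R) (iB k)).
have i2 k : m.-integrable T (fun z : borelC R => (normc (dil g (x_ k.+1) z - dil g (x_ k) z) ^+ 2)%:E).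
  apply: (@integrable_bounded_T R _ ((M + M) ^+ 2)).
    by apply: measurable_funX; exact: (cmeas_normc (mB k)).
  move=> z Tz; rewrite ger0_norm ?exprn_ge0 ?normc_ge0//.
  by rewrite lerXn2r ?nnegrE ?normc_ge0 ?le2M// (le_trans (normc_ge0 _) (le2M k z Tz)).
have inc k : (\int[m]_(z in T) (normc (dil g (x_ k.+1) z - dil g (x_ k) z))%:E <= (h k + h k)%:E)%E.
  rewrite -[leLHS]fineK ?integrable_fin_num//; last exact: measurable_T.
  rewrite lee_fin -/(Rintegral m T (fun z => normc (dil g (x_ k.+1) z - dil g (x_ k) z))).
  have i3 := integrableD (@measurable_T R) (circle_integrable_cst (h k))
     (integrableZl (@measurable_T R) (h k)^-1 (i2 k)).
  have le3 z : T z -> normc (dil g (x_ k.+1) z - dil g (x_ k) z) <=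
     h k + (h k)^-1 * normc (dil g (x_ k.+1) z - dil g (x_ k) z) ^+ 2.
    move=> _; move: (normc_ge0 (dil g (x_ k.+1) z - dil g (x_ k) z)).
    generalize (normc (dil g (x_ k.+1) z - dil g (x_ k) z)) => t t0.
    have hk := h_gt0 k; rewrite mulrC.
    by have := young_le hk t0; rewrite -ler_pdivlMr// mulrDl mulfK ?gt_eqF.
  apply: le_trans (le_Rintegral (@measurable_T R) (i1 k) i3 le3) _.
  rewrite RintegralD//; last 3 first.
  - exact: measurable_T.
  - exact: (circle_integrable_cst (h k)).
  - exact: (integrableZl (@measurable_T R) (h k)^-1 (i2 k)).
  rewrite circle_Rintegral_cst lerD2l (RintegralZl _ (@measurable_T R) (i2 k)).
  by rewrite ler_pdivrMl// -expr2; exact: xd.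
have se : (\sum_(k <oo) (h k + h k)%:E < +oo)%E.
  under eq_eseriesr do rewrite EFinD.
  have h0 k : (0 <= (h k)%:E)%E by rewrite lee_fin ltW.
  rewrite nneseriesD; [|by move=> *; exact: h0|by move=> *; exact: h0].
  have hs : (\sum_(k <oo) (h k)%:E < +oo)%E.
    by apply: le_lt_trans (@epsilon_trick0 R 1 xpredT ler01) _; rewrite ltry.
  by apply: lte_add_pinfty.
have [b mb cb] := ae_cvg_summable_increments (@measurable_T R) md inc se.
exists b.
  split => //.
  have [] // := @cdominated_cvg _ _ _ m T (@measurable_T R) (fun k => dil g (x_ k)) b (fun=> M).
  - exact: (circle_integrable_cst M).
  - by move=> n z Tz; exact: (dil_le gM).
move=> a a1.
have [|||||_ cI] := @cdominated_cvg _ _ _ m T (@measurable_T R)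
  (fun k z => dil g (x_ k) z * (poisson a z)%:C) (fun z => b z * (poisson a z)%:C)
  (fun=> M * (2 / (1 - normc a))).
- by move=> n; apply: cmeasM => //; exact: poisson_cmeas.
- by apply: cmeasM => //; exact: poisson_cmeas.
- by apply: filterS cb => z hz Tz; apply: cvgM; [exact: hz|exact: cvg_cst].
- exact: (circle_integrable_cst (M * (2 / (1 - normc a)))).
- move=> n z Tz; rewrite normcM normc_poisson//.
  by apply: ler_pM; rewrite ?normc_ge0 ?poisson_ge0 ?poisson_le ?(dil_le gM).
have cg : (fun k => g ((expR (x_ k))%:C * a)) @ \oo --> g a.
  have ca : g w @[w --> a] --> g a.
    by apply: derivable_continuous; exact: dg.
  have ce : (fun k => (expR (x_ k))%:C * a) @ \oo --> a.
    rewrite -[X in _ --> X]mul1r; apply: cvgM; last exact: cvg_cst.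
    have e1 : (fun k => expR (x_ k)) @ \oo --> expR 0.
      exact: (cvg_comp _ _ xc (@continuous_expR R 0)).
    by rewrite expR0 in e1; exact: (cvg_comp _ _ e1 (@real_complex_continuous R 1)).
  exact: (cvg_comp _ _ ce ca).
have eI : (fun k => circle_integral (fun z => dil g (x_ k) z * (poisson a z)%:C)) =
          (fun k => g ((expR (x_ k))%:C * a)).
  apply/funext => k; apply: poisson_formula_dilation => //.
  by rewrite expR_ge0 expR_lt1 x0.
have cI' : (fun k => circle_integral (fun z => dil g (x_ k) z * (poisson a z)%:C)) @ \oo -->
  circle_integral (fun z => b z * (poisson a z)%:C) by exact: cI.
rewrite eI in cI'; exact: (@cvg_unique _ _ _ _ _ _ cg cI').
Qed.

End BoundaryFunctionExistence.

(** * Radial limits and the mean value property in H^1 *)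

Section HardyMeanValue.
Variable R : realType.
Local Notation C := R[i].
Local Notation T := (@unit_circle R : set (borelC R)).
Local Notation m := (@circle_measure R).
Implicit Types (z a l : C) (F G k : C -> C) (w : C -> R).

(** On the radius [normc (r z - z) = 1 - r], so every aperture above 1 contains it; 2 is the one
    used throughout. *)
Lemma radius_stolz z : unit_circle z ->
  (fun n => (radius R n)%:C * z) @ \oo --> within (stolz_region 2 z) (nbhs z).
Proof.
move=> Tz A /= hA.
have c : (fun n => (radius R n)%:C * z) @ \oo --> z by exact: (@radius_scale_cvg R id z).
have ev : \forall n \near \oo, stolz_region 2 z ((radius R n)%:C * z) -> A ((radius R n)%:C * z).
  exact: (c _ hA).
have : \forall n \near \oo, A ((radius R n)%:C * z); last exact.
apply: filterS ev => n; apply.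
have /andP[r0 r1] := radius_itv R n.
have nr : normc ((radius R n)%:C * z) = radius R n by rewrite normc_scale_T// ltW.
split; first by rewrite /unit_disk /= nr.
have -> : (radius R n)%:C * z - z = (radius R n - 1)%:C * z.
  by clear; generalize (radius R n) => r; rewrite rmorphB /= mulrBl mul1r.
rewrite nr normcM normc_real Tz mulr1 ler0_norm ?subr_le0 ?ltW// opprB.
by rewrite ltr_pMl ?subr_gt0// ltr1n.
Qed.

Lemma has_ntlim_radius F z l : unit_circle z -> has_ntlim F z l ->
  (fun n => F ((radius R n)%:C * z)) @ \oo --> l.
Proof.
move=> Tz h; have h2 : 1 < (2 : R) by rewrite ltr1n.
exact: (cvg_comp _ _ (radius_stolz Tz) (h 2 h2)).
Qed.

(** [ntlim] is an arbitrary choice among the limits; it is determined because any such limit is also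
    the radial limit. *)
Lemma has_ntlim_ntlim F z l : unit_circle z -> has_ntlim F z l -> ntlim F z = l.
Proof.
move=> Tz h; rewrite /ntlim; case: xgetP => [l' _ h'|/(_ l)/(_ h)//].
exact: (@cvg_unique _ _ _ _ _ _ (has_ntlim_radius Tz h') (has_ntlim_radius Tz h)).
Qed.

Let limn_einf_ge0 (u : nat -> \bar R) : (forall n, 0 <= u n)%E -> (0 <= limn_einf u)%E.
Proof.
move=> u0; rewrite limn_einf_lim; apply: lime_ge; first exact: is_cvg_einfs.
by apply: nearW => n; apply: le_ereal_inf_tmp => _ [k _ <-]; exact: u0.
Qed.

(** The means of [Re G] over all circles equal [Re (G 0)], and Fatou's lemma compares them with the
    integral of the lower limit, which is [w] off a null set. *)
Lemma Re_radial_fatou G w : analytic_in_disk G ->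
  (forall z, normc z < 1 -> 0 <= complex.Re (G z)) ->
  m.-integrable T (fun z : borelC R => (w z)%:E) -> (forall z, T z -> 0 <= w z) ->
  {ae m, forall z : borelC R, T z ->
    (fun n => complex.Re (G ((radius R n)%:C * z))) @ \oo --> w z} ->
  Rintegral m T w <= complex.Re (G 0).
Proof.
move=> dG G0 iw w0 cw.
pose f n (z : borelC R) : \bar R := (complex.Re (G ((radius R n)%:C * z)))%:E.
have dGn n z : normc z <= 1 -> derivable (fun z => G ((radius R n)%:C * z)) z 1.
  by move=> z1; apply: dilation_derivable => //; exact: radius_itvW.
have iG n : circle_integrable (fun z => G ((radius R n)%:C * z)).
  by apply: circle_integrable_analytic; exact: dGn.
have mf n : measurable_fun T (f n) by apply: (measurable_int m); have [] := iG n.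
have f0 n z : T z -> (0 <= f n z)%E.
  move=> Tz; rewrite lee_fin G0//; have /andP[r0 r1] := radius_itv R n.
  by rewrite normc_scale_T// ltW.
have If n : (\int[m]_(z in T) f n z = (complex.Re (G 0))%:E)%E.
  rewrite -[LHS]fineK; last by apply: integrable_fin_num; [exact: measurable_T|have [] := iG n].
  have := circle_integral_disk (dGn n); rewrite mulr0 => <-; congr EFin.
have [N [mN N0 hN]] := cw.
have -> : Rintegral m T w = fine (\int[m]_(z in T) limn_einf (f^~ z))%E.
  congr fine; apply: (@ge0_integral_null_modification _ _ R m _ N mN N0
    (fun z => (w z)%:E) (fun z => limn_einf (f^~ z))).
  - by move=> z Tz; rewrite lee_fin w0.
  - move=> z Tz; apply: limn_einf_ge0 => n; exact: f0.
  - move=> z Tz nN.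
    have cz : (fun n => complex.Re (G ((radius R n)%:C * z))) @ \oo --> w z.
      by apply: contrapT => h; apply: nN; apply: hN => /= /(_ Tz).
    have fE : f^~ z @ \oo --> (w z)%:E by apply/fine_cvgP; split; [exact: nearW|exact: cz].
    by rewrite is_cvg_limn_einfE; [exact/esym/cvg_lim|apply/cvg_ex; exists (w z)%:E].
have := fatou m (@measurable_T R) mf f0.
rewrite (_ : (fun n => \int[m]_(x in T) f n x)%E = fun=> (complex.Re (G 0))%:E); last first.
  by apply/funext => n; exact: If.
rewrite is_cvg_limn_einfE; last exact: is_cvg_cst.
rewrite lim_cst// => h; rewrite -lee_fin fineK//.
rewrite ge0_fin_numE; first exact: le_lt_trans h (ltry _).
by apply: integral_ge0 => z Tz; apply: limn_einf_ge0 => n; exact: f0.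
Qed.

(* Fatou's lemma applied to the nonnegative functions u + Re (c F), where u is the *)
(* Poisson integral of |k|, which dominates |F|. *)
Lemma hardy_mean F k : hardy1 F -> circle_integrable k ->
  {ae m, forall z : borelC R, T z -> (fun n => F ((radius R n)%:C * z)) @ \oo --> k z} ->
  circle_integral k = F 0.
Proof.
move=> hF ik ck; pose v z := normc (k z).
have iv : m.-integrable T (fun z : borelC R => (v z)%:E).
  exact: (cintegrable_normc (@measurable_T R) ik).
have n01 : normc (0 : C) < 1 by rewrite normc0 ltr01.
have half c : normc c = 1 -> complex.Re (c * circle_integral k) <= complex.Re (c * F 0).
  move=> c1; pose G z := herglotz v z + c * F z.
  have GE z : normc z < 1 -> complex.Re (G z) = poisson_integral v z + complex.Re (c * F z).
    by move=> z1; rewrite /G ReD Re_herglotz.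
  have ick : circle_integrable (fun z => c * k z) by exact: circle_integrableZ.
  have iw := integrableD (@measurable_T R) iv ick.1.
  have Re_ge z : - normc z <= complex.Re z.
    by have := ler_Re_normc z; rewrite ler_norml => /andP[].
  have := @Re_radial_fatou G (fun z => v z + complex.Re (c * k z)).
  rewrite GE// RintegralD//; [|exact: measurable_T|exact: ick.1].
  have -> : poisson_integral v 0 = Rintegral m T v.
    apply: eq_Rintegral => z; rewrite inE => Tz.
    by rewrite /poisson subr0 normc0 expr0n subr0 Tz expr1n divr1 mul1r.
  rewrite lerD2l -[X in _ -> _ -> _ -> _ -> _ -> X <= _]/(complex.Re (circle_integral (fun z => c * k z))).
  rewrite circle_integralZ//; apply.
  - move=> z Dz; apply: derivableD; first exact: herglotz_derivable.
    exact: (cderivM (cderiv_cst c z) (hF.1 z Dz)).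
  - move=> z z1; rewrite GE//; have hp : normc (F z) <= poisson_integral v z by exact: hardy_poisson_le.
    have := Re_ge (c * F z); rewrite normcM c1 mul1r => hc.
    by rewrite -(addrN (normc (F z))); exact: lerD.
  - exact: iw.
  - move=> z Tz; have := Re_ge (c * k z); rewrite normcM c1 mul1r => hc.
    by rewrite -(addrN (normc (k z))); apply: lerD.
  - apply: filterS2 ck (poisson_integral_ntlim iv) => z ckz pz Tz.
    have c2 : (fun n => poisson_integral v ((radius R n)%:C * z)) @ \oo --> v z.
      have h2 : 1 < (2 : R) by rewrite ltr1n.
      exact: (cvg_comp _ _ (radius_stolz Tz) (pz Tz 2 h2)).
    have c3 : (fun n => complex.Re (c * F ((radius R n)%:C * z))) @ \oo --> complex.Re (c * k z).
      have c4 : (fun n => c * F ((radius R n)%:C * z)) @ \oo --> c * k z.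
        by apply: cvgM; [exact: cvg_cst|exact: ckz].
      by have /cvgc_ReIm[] := c4.
    have -> : (fun n => complex.Re (G ((radius R n)%:C * z))) =
      (fun n => poisson_integral v ((radius R n)%:C * z) + complex.Re (c * F ((radius R n)%:C * z))).
      apply/funext => n; rewrite GE//; have /andP[r0 r1] := radius_itv R n.
      by rewrite normc_scale_T// ltW.
    exact: cvgD.
have ni : normc ('i : C) = 1 by rewrite /normc /= expr0n expr1n add0r sqrtr1.
(* The rotations [1], [-1], ['i] and [- 'i] give both inequalities for the real and for the
   imaginary part. *)
move: (half 1 (normc1 _)) (half (-1)) (half 'i ni) (half (- 'i)).
rewrite !normcN normc1 ni !mulN1r !mul1r !mulNr => h1 /(_ erefl) h2 h3 /(_ erefl) h4.
move: h1 h2 h3 h4; case: (circle_integral k) (F 0) => [p q] [p' q'] /=.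
rewrite ?oppr0 ?mul0r ?mul1r ?mulN1r ?sub0r ?subr0 ?lerN2 ?opprK. move=> h1 h2 h3 h4.
by congr Complex; apply/eqP; rewrite eq_le ?h1 ?h2 ?h3 ?h4.
Qed.

End HardyMeanValue.

(** * Bounded analytic functions *)

Section BoundedAnalytic.
Variable R : realType.
Local Notation C := R[i].
Local Notation D := (@unit_disk R).
Local Notation T := (@unit_circle R : set (borelC R)).
Local Notation m := (@circle_measure R).
Implicit Types (z a l : C) (F G f : C -> C) (K : R).

Lemma cmeas_limit (f_ : nat -> C -> C) f :
  (forall n, cmeas T (f_ n : borelC R -> C)) ->
  (forall z, T z -> f_ ^~ z @ \oo --> f z) -> cmeas T (f : borelC R -> C).
Proof.
move=> mf cf; split.
  apply: (measurable_fun_cvg (fun n => (mf n).1)) => z Tz.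
  by have /cvgc_ReIm[] := cf z Tz.
apply: (measurable_fun_cvg (fun n => (mf n).2)) => z Tz.
by have /cvgc_ReIm[] := cf z Tz.
Qed.

Lemma circle_dominated (f_ : nat -> C -> C) f (k : C -> R) :
  (forall n, cmeas T (f_ n : borelC R -> C)) ->
  (forall z, T z -> f_ ^~ z @ \oo --> f z) ->
  m.-integrable T (fun z : borelC R => (k z)%:E) ->
  (forall n z, T z -> normc (f_ n z) <= k z) ->
  circle_integrable f /\
  (fun n => circle_integral (f_ n)) @ \oo --> circle_integral f.
Proof.
move=> mf cf ik fk.
have [] := @cdominated_cvg _ _ _ m T (@measurable_T R) f_ f k mf (cmeas_limit mf cf) _ ik fk.
  by apply: aeW.
by [].
Qed.

(* The Cauchy formula on a smaller disk passes to the limit. *)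
Lemma analytic_limit (F_ : nat -> C -> C) F K :
  (forall n, analytic_in_disk (F_ n)) ->
  (forall n z, D z -> normc (F_ n z) <= K) ->
  (forall z, D z -> F_ ^~ z @ \oo --> F z) -> analytic_in_disk F.
Proof.
move=> dF FK cF z Dz.
have [r r1 zr] : exists2 r : R, 0 < r < 1 & normc z < r.
  exists ((1 + normc z) / 2); move: (normc_ge0 z) Dz; rewrite /unit_disk /=.
    by generalize (normc z) => x x0 x1; apply/andP; split; lra.
  by generalize (normc z) => x x0 x1; lra.
have /andP[r0 rlt1] := r1; have rn0 : r%:C != 0 :> C by rewrite gt_eqF// ltcR.
have rW : 0 <= r < 1 by rewrite ltW.
have Dr w : T w -> D (r%:C * w) by move=> Tw; rewrite /unit_disk /= normc_scale_T// ltW.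
have dFr n w : normc w <= 1 -> derivable (fun w => F_ n (r%:C * w)) w 1.
  exact (dilation_derivable (dF n) rW (z := w)).
have mFr n : cmeas T (fun w : borelC R => F_ n (r%:C * w)).
  by apply: continuous_cmeas_T => w Tw; apply: derivable_continuous; apply: dFr; rewrite (Tw : normc w = 1).
have [iF _] := circle_dominated mFr (fun w Tw => cF _ (Dr w Tw))
  (circle_integrable_cst K) (fun n w Tw => FK n _ (Dr w Tw)).
have FE a : normc a < 1 -> F (r%:C * a) = cauchy_transform (fun w => F (r%:C * w)) a.
  move=> a1; have mk := cauchy_kernel_cmeas a1.
  have Dra : D (r%:C * a).
    rewrite /unit_disk /= normcM normc_real gtr0_norm//.
    by apply: le_lt_trans rlt1; rewrite ler_piMr ?(ltW r0)// ltW.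
  have [||_ cI] := @circle_dominated (fun n w => F_ n (r%:C * w) * cauchy_kernel a w)
    (fun w => F (r%:C * w) * cauchy_kernel a w) (fun=> K * (1 - normc a)^-1)
    (fun n => cmeasM (mFr n) mk) _ (circle_integrable_cst _).
  - by move=> w Tw; apply: cvgM; [exact: (cF _ (Dr w Tw))|exact: cvg_cst].
  - move=> n w Tw; rewrite normcM; apply: ler_pM; rewrite ?normc_ge0//.
      exact: (FK n _ (Dr w Tw)).
    exact: normc_cauchy_kernel.
  have eI : (fun n => circle_integral (fun w => F_ n (r%:C * w) * cauchy_kernel a w)) =
            (fun n => F_ n (r%:C * a)).
    by apply/funext => n; exact: (cauchy_formula a1 (dFr n)).
  rewrite eI in cI; exact: (@cvg_unique _ _ _ _ _ _ (cF _ Dra) cI).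
have rz : 0 < r - normc z by rewrite subr_gt0.
apply: (@cderiv_near R (fun w => cauchy_transform (fun w => F (r%:C * w)) ((r%:C)^-1 * w)) F z _ rz).
  move=> w hw; rewrite -FE ?mulVKf// normcM -fmorphV normc_real gtr0_norm ?invr_gt0//.
  rewrite ltr_pdivrMl// mulr1 -[w](subrK z); apply: le_lt_trans (le_normcD _ _) _.
  by rewrite -ltrBrDr.
apply: cderiv_scale; apply: cauchy_transform_derivable => //.
by rewrite normcM -fmorphV normc_real gtr0_norm ?invr_gt0// ltr_pdivrMl// mulr1.
Qed.

Lemma bounded_radius_limit F K z l : (forall z, D z -> normc (F z) <= K) ->
  unit_circle z -> (fun n => F ((radius R n)%:C * z)) @ \oo --> l -> normc l <= K.
Proof.
move=> FK Tz cF.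
have cn : (fun n => normc (F ((radius R n)%:C * z))) @ \oo --> normc l.
  exact: (cvg_comp _ _ cF (@normc_continuous R l)).
have <- := @cvg_lim _ _ _ _ _ _ _ cn; last by [].
apply: limr_le; first by apply/cvg_ex; exists (normc l).
apply: nearW => n; apply: FK; have /andP[r0 r1] := radius_itv R n.
by rewrite /unit_disk /= normc_scale_T// ltW.
Qed.

(** A single null set [N], containing the prescribed [N0], serves the whole sequence. Setting the
    boundary functions to 0 on [N] makes their bounds valid at every point of the circle while
    changing no integral. *)
Lemma boundary_family (F : nat -> C -> C) (K : nat -> R) (N0 : set (borelC R)) :
  (forall n, analytic_in_disk (F n)) -> (forall n z, D z -> normc (F n z) <= K n) ->
  measurable N0 -> m N0 = 0%E ->
  exists (b : nat -> C -> C) (N : set (borelC R)), [/\ forall n, cmeas T (b n : borelC R -> C),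
    forall n z, T z -> normc (b n z) <= K n,
    [/\ measurable N, m N = 0%E, N0 `<=` N & forall n z, N z -> b n z = 0],
    forall n z, T z -> ~ N z -> has_ntlim (F n) z (b n z) &
    forall n a, normc a < 1 -> F n a = circle_integral (fun z => b n z * (poisson a z)%:C)].
Proof.
move=> dF FK mN0 N00.
have D0 : D (0 : C) by rewrite /unit_disk /mkset normc0 ltr01.
have /choice[b hb] (n : nat) : exists b : C -> C, (cmeas T (b : borelC R -> C) /\ circle_integrable b) /\
    forall a, normc a < 1 -> F n a = circle_integral (fun z => b z * (poisson a z)%:C).
  by have [b h1 h2] := boundary_function (dF n) (FK n); exists b.
have /choice[N1 hN1] (n : nat) := ntlim_poisson (hb n).1.2 (hb n).2.
pose N n : set (borelC R) := if n is n'.+1 then N1 n' else N0.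
have mN n : measurable (N n) by case: n => [//|n]; have [] := hN1 n.
have N0E n : m (N n) = 0%E by case: n => [//|n]; have [] := hN1 n.
pose N' : set (borelC R) := \bigcup_n N n.
have mN' : measurable N' by exact: bigcup_measurable.
have N'0 : m N' = 0%E.
  apply: measure_negligible => //; apply: negligible_bigcup => n.
  by apply/negligibleP; [exact: mN|exact: N0E].
pose b' n z : C := if z \in (N' : set C) then 0 else b n z.
have b0 n z : N' z -> b' n z = 0 by move=> Nz; rewrite /b' mem_set.
have bE n z : ~ N' z -> b' n z = b n z by move=> nNz; rewrite /b' memNset.
have mI : measurable_fun T (fun z : borelC R => \1_(~` N') z : R).
  by apply: measurable_indic; exact: measurableC.
have b'E n : b' n = fun z => (\1_(~` N' : set C) z : R)%:C * b n z.
  apply/funext => z; rewrite /b' indicE in_setC.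
  by case: (z \in _); rewrite ?mul0r ?mul1r.
have lim n z : T z -> ~ N' z -> has_ntlim (F n) z (b n z).
  move=> Tz nNz; have : ~ N1 n z by move=> h; apply: nNz; exists n.+1.
  have [_ _ h] := hN1 n; move=> nh; apply: contrapT => h'; apply: nh; apply: h => /= /(_ Tz).
  exact: h'.
exists b', N'; split.
- by move=> n; rewrite b'E; apply: cmeasM; [exact: cmeas_real|exact: (hb n).1.1].
- move=> n z Tz; have [Nz|nNz] := pselect (N' z).
    by rewrite b0// normc0; exact: (le_trans (normc_ge0 (F n 0)) (FK n 0 D0)).
  rewrite bE//; apply: (bounded_radius_limit (FK n) Tz).
  by apply: has_ntlim_radius => //; exact: lim.
- split; [exact: mN'|exact: N'0| |].
    by move=> z N0z; exists 0%N.
  by move=> n z Nz; exact: (b0 _ _ Nz).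
- by move=> n z Tz nNz; rewrite bE//; exact: lim.
- move=> n a a1; rewrite (hb n).2//.
  apply: (@cint_null_modification _ _ R m T N' mN' N'0) => z Tz nNz.
  by rewrite bE.
Qed.

End BoundedAnalytic.

Section HinfPairing.
Variable R : realType.
Local Notation C := R[i].
Local Notation D := (@unit_disk R).
Local Notation T := (@unit_circle R : set (borelC R)).
Local Notation m := (@circle_measure R).
Implicit Types (z a : C) (f : L1 R) (h k : Hinf R) (F b : C -> C) (K : R).

Lemma Hinf_analytic h : analytic_in_disk h.
Proof. by case: h => F /= /asboolP[]. Qed.

Lemma Hinf_bounded h : exists K, forall z, D z -> normc (h z) <= K.
Proof. by case: h => F /= /asboolP[]. Qed.

Lemma Hinf_eq h k : (forall z, D z -> h z = k z) -> h = k.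
Proof.
move=> hk; apply/val_inj/funext => z /=; have [/hk//|nDz] := pselect (D z).
by case: h k {hk} => F /= /asboolP[_ _ F0] [G /= /asboolP[_ _ G0]]; rewrite F0// G0.
Qed.

Lemma L1_integrable f : circle_integrable f.
Proof. by case: f => F /= /asboolP. Qed.

(** The given null set [N0] is absorbed into [N], so that successive uses yield one null set common
    to several functions. *)
Lemma Hinf_boundary h (N0 : set (borelC R)) : measurable N0 -> m N0 = 0%E ->
  exists b (N : set (borelC R)) K, [/\ cmeas T (b : borelC R -> C),
    forall z, T z -> normc (b z) <= K,
    [/\ measurable N, m N = 0%E & N0 `<=` N] &
    forall z, T z -> ~ N z -> has_ntlim h z (b z)].
Proof.
move=> mN0 N00; have [K hK] := Hinf_bounded h.
have [b [N [h1 h2 [h3 h4 h5 _] h6 _]]] := boundary_family (fun n : nat => @Hinf_analytic h) (fun _ : nat => hK) mN0 N00.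
by exists (b 0%N), N, K; split => //; [exact: h2|exact: h6].
Qed.

(** The pairing is defined with [ntlim], for which no measurability is at hand; a change on a null
    set does not affect the integral and allows a measurable [b] instead. *)
Lemma H_pairing_boundary f h b (N : set (borelC R)) : measurable N -> m N = 0%E ->
  (forall z, T z -> ~ N z -> has_ntlim h z (b z)) ->
  H_pairing f h = circle_integral (fun z => f z * b z).
Proof.
move=> mN N0 hb; apply: (@cint_null_modification _ _ R m T N mN N0) => z Tz nNz.
by rewrite (has_ntlim_ntlim Tz (hb z Tz nNz)).
Qed.

Lemma H_pairingDZr f c h k : H_pairing f (c *: h + k) = c * H_pairing f h + H_pairing f k.
Proof.
have [b [N [K [mb bK [mN N0 _] hb]]]] := Hinf_boundary h measurable0 (measure0 m).
have [b' [N' [K' [mb' bK' [mN' N'0 NN'] hb']]]] := Hinf_boundary k mN N0.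
have hbN z : T z -> ~ N' z -> has_ntlim h z (b z).
  by move=> Tz nz; apply: hb => // /NN'.
rewrite (H_pairing_boundary f mN' N'0 hbN) (H_pairing_boundary f mN' N'0 hb').
have hc z : T z -> ~ N' z -> has_ntlim (c *: h + k) z (c * b z + b' z).
  by move=> Tz nz; apply: (@has_ntlim_lin R c h k z); [exact: hbN|exact: hb'].
rewrite (@H_pairing_boundary f (c *: h + k) (fun z => c * b z + b' z) N' mN' N'0 hc).
have i1 := circle_integrableMr (L1_integrable f) mb bK.
have i2 := circle_integrableMr (L1_integrable f) mb' bK'.
rewrite -circle_integralZ// -circle_integralD//; last exact: circle_integrableZ.
by apply: eq_circle_integral => z _; rewrite mulrDr mulrCA.
Qed.

Lemma H_pairingDZl c f f' h : H_pairing (c *: f + f') h = c * H_pairing f h + H_pairing f' h.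
Proof.
have [b [N [K [mb bK [mN N0 _] hb]]]] := Hinf_boundary h measurable0 (measure0 m).
rewrite !(H_pairing_boundary _ mN N0 hb).
have i1 := circle_integrableMr (L1_integrable f) mb bK.
have i2 := circle_integrableMr (L1_integrable f') mb bK.
rewrite -circle_integralZ// -circle_integralD//; last exact: circle_integrableZ.
by apply: eq_circle_integral => z _; rewrite mulrA -mulrDl.
Qed.

Lemma hardy1M F h : hardy1 F -> hardy1 (fun z => F z * h z).
Proof.
move=> [dF bF]; have [K hK] := Hinf_bounded h.
have D0 : D (0 : C) by rewrite /unit_disk /mkset normc0 ltr01.
have K0 : 0 <= K by exact: (le_trans (normc_ge0 (h 0)) (hK 0 D0)).
have dFh : analytic_in_disk (fun z => F z * h z).
  by move=> z Dz; exact (cderivM (dF z Dz) (@Hinf_analytic h z Dz)).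
split; first exact: dFh.
set S := ereal_sup _ in bF.
have S0 : (0 <= S)%E.
  apply: (@le_trans _ _ (\int[m]_(z in T) (normc (F ((0 : R)%:C * z)))%:E)%E).
    by apply: integral_ge0 => z _; rewrite lee_fin normc_ge0.
  by apply: ereal_sup_ubound; exists 0 => //=; apply/andP; split => //; exact: ltr01.
apply: (@le_lt_trans _ _ (K%:E * S)%E); last by rewrite lte_mul_pinfty.
apply: ge_ereal_sup => _ [r r01 <-].
have mF := measurable_dilation dF r01; have mFh := measurable_dilation dFh r01.
apply: (@le_trans _ _ (\int[m]_(z in T) (K%:E * (normc (F (r%:C * z)))%:E))%E).
  apply: ge0_le_integral => //; first exact: measurable_T.
  - by move=> z _; rewrite lee_fin normc_ge0.
  - exact: measurable_funeM.
  - move=> z Tz; rewrite -EFinM lee_fin normcM mulrC ler_wpM2r ?normc_ge0// hK//.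
    by case/andP: r01 => r0 r1; rewrite /unit_disk /mkset normc_scale_T.
rewrite ge0_integralZl//; [|exact: measurable_T|by move=> z _; rewrite lee_fin normc_ge0].
by apply: lee_wpmul2l => //; apply: ereal_sup_ubound; exists r.
Qed.

(** If [F] has boundary values [f], then [F h] is in H^1 with boundary function [f b], so by
    [hardy_mean] the pairing is [F 0 * h 0 = 0]. *)
Lemma H10_pairing f h : f \in @H10 R -> H_pairing f h = 0.
Proof.
move=> /asboolP[F [hF F0 [N0 [mN0 N00 hN0]]]].
have [b [N [K [mb bK [mN Nn N0N] hb]]]] := Hinf_boundary h mN0 N00.
rewrite (H_pairing_boundary f mN Nn hb).
have ifb := circle_integrableMr (L1_integrable f) mb bK.
rewrite (hardy_mean (hardy1M h hF) ifb) ?F0 ?mul0r//.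
exists N; split => // z /= /not_implyP[Tz hz]; apply: contrapT => nNz; apply: hz.
apply: cvgM; apply: has_ntlim_radius => //; last exact: hb.
by apply: contrapT => h'; apply: nNz; apply: N0N; apply: hN0 => /= /(_ Tz).
Qed.

Lemma H_pairing_class f f' h : L1_class f = L1_class f' -> H_pairing f h = H_pairing f' h.
Proof.
move=> /eqP; rewrite L1_class_eq => ff'.
rewrite -[f](subrK f') -[f - f']scale1r H_pairingDZl (H10_pairing _ ff').
by rewrite mulr0 add0r.
Qed.

(** The Poisson kernel at [a] represents evaluation at [a]. This turns weak* statements into
    pointwise ones and supplies the test vectors for the norm of S. *)
Lemma poisson_evaluation a : normc a < 1 ->
  exists2 f : L1 R, L1_norm f = 1%E & forall h, H_pairing f h = h a.
Proof.
move=> a1; have ip : circle_integrable (fun z => (poisson a z)%:C).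
  by apply/circle_integrable_real; exact: integrable_poisson.
have fP : (fun z => (poisson a z)%:C) \in @L1_fun R by apply/asboolP.
exists (MkL1 fP).
  rewrite /L1_norm -[RHS]/((1 : R)%:E) -(Rintegral_poisson a1) /Rintegral.
  rewrite fineK; last by apply: integrable_fin_num; [exact: measurable_T|exact: integrable_poisson].
  by apply: eq_integral => z _; congr EFin; exact: normc_poisson.
move=> h; have [K hK] := Hinf_bounded h.
have [b [N [h1 h2 [h3 h4 h5 _] h6 h7]]] := boundary_family (fun n : nat => @Hinf_analytic h)
  (fun _ : nat => hK) measurable0 (measure0 m).
rewrite (H_pairing_boundary _ h3 h4 (h6 0%N)) (h7 0%N a a1).
by apply: eq_circle_integral => z _ /=; rewrite mulrC.
Qed.

End HinfPairing.

(** * Summable families in H^oo *)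

Section AbsoluteSeries.
Variable R : realType.
Local Notation C := R[i].
Implicit Types (u : nat -> R) (v : nat -> C) (K : R).

Lemma nneseries_leP u (x : \bar R) : (forall n, 0 <= u n) ->
  (\sum_(n <oo) (u n)%:E <= x)%E <-> forall n, ((\sum_(0 <= k < n) u k)%:E <= x)%E.
Proof.
move=> u0; split=> [h n|h].
  apply: le_trans h; rewrite -sumEFin; apply: nneseries_lim_ge => k _ _.
  by rewrite lee_fin.
apply: lime_le; first by apply: is_cvg_nneseries => n _ _; rewrite lee_fin.
by apply: nearW => n; rewrite sumEFin.
Qed.

Lemma normc_sum_le v n : normc (\sum_(0 <= k < n) v k) <= \sum_(0 <= k < n) normc (v k).
Proof.
elim: n => [|n IH]; first by rewrite !big_nil normc0.
rewrite !big_nat_recr//=; apply: le_trans (le_normcD _ _) _.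
by rewrite lerD2r.
Qed.

Lemma cvg_cseries v K : (forall n, \sum_(0 <= k < n) normc (v k) <= K) -> cvgn (series v).
Proof.
move=> vK.
have cv (p : C -> R) : (forall z w, p (z + w) = p z + p w) -> p 0 = 0 ->
    (forall z, `|p z| <= normc z) -> cvgn (fun n => p (series v n)).
  move=> pD p0 pn; pose u n := p (v n).
  have -> : (fun n => p (series v n)) = series u.
    apply/funext => n; rewrite /series /=; elim: n => [|n IH]; first by rewrite !big_nil.
    by rewrite !big_nat_recr//= pD IH.
  apply: normed_cvg; apply: nondecreasing_is_cvgn.
    by apply: nondecreasing_series => n _ _; exact: normr_ge0.
  exists K => _ [n _ <-]; apply: le_trans (vK n).
  by rewrite /series /=; apply: ler_sum => k _; exact: pn.
have /cvg_ex[p hp] := cv _ (@ReD R) erefl (@ler_Re_normc R).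
have /cvg_ex[q hq] := cv _ (@ImD R) erefl (@ler_Im_normc R).
by apply/cvg_ex; exists (p +i* q); apply/cvgc_ReIm.
Qed.

Lemma normc_cvg_le (w : nat -> C) (l : C) K : w @ \oo --> l ->
  (forall n, normc (w n) <= K) -> normc l <= K.
Proof.
move=> wl wK; have cn : (fun n => normc (w n)) @ \oo --> normc l.
  exact: (cvg_comp _ _ wl (@normc_continuous R l)).
have <- := @cvg_lim _ _ _ _ _ _ _ cn; last by [].
by apply: limr_le; [apply/cvg_ex; exists (normc l)|exact: nearW].
Qed.

End AbsoluteSeries.

Section BoundedSums.
Variable R : realType.
Local Notation C := R[i].
Local Notation D := (@unit_disk R).
Local Notation T := (@unit_circle R : set (borelC R)).
Local Notation m := (@circle_measure R).
Variable g : nat -> Hinf R.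
Implicit Types (z a : C) (f : L1 R) (K : R) (B : set C).

Lemma boundary_sum_le K z (l : nat -> C) :
  (forall z, D z -> forall n, \sum_(0 <= k < n) normc (g k z) <= K) ->
  unit_circle z -> (forall k, has_ntlim (g k) z (l k)) ->
  forall n, \sum_(0 <= k < n) normc (l k) <= K.
Proof.
move=> gK Tz hl n.
have cs : (fun j => \sum_(0 <= k < n) normc (g k ((radius R j)%:C * z))) @ \oo -->
    \sum_(0 <= k < n) normc (l k).
  elim: n => [|n IH].
    rewrite big_nil; under eq_fun do rewrite big_nil; exact: cvg_cst.
  rewrite big_nat_recr//=; under eq_fun do rewrite big_nat_recr//=.
  apply: cvgD; first exact: IH.
  exact: (cvg_comp _ _ (has_ntlim_radius Tz (hl n)) (@normc_continuous R (l n))).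
have <- := @cvg_lim _ _ _ _ _ _ _ cs; last by [].
apply: limr_le; first by apply/cvg_ex; eexists; exact: cs.
apply: nearW => j; apply: gK; have /andP[r0 r1] := radius_itv R j.
by rewrite /unit_disk /mkset normc_scale_T// ltW.
Qed.

Lemma poisson_sum_le (b : nat -> C -> C) K a n : normc a < 1 -> 0 <= K ->
  (forall k, circle_integrable (b k)) ->
  (forall z, T z -> forall n, \sum_(0 <= k < n) normc (b k z) <= K) ->
  \sum_(0 <= k < n) normc (circle_integral (fun z => b k z * (poisson a z)%:C)) <= K.
Proof.
move=> a1 K0 ib bK.
have inb k : m.-integrable T (fun z : borelC R => (normc (b k z))%:E).
  exact: (cintegrable_normc (@measurable_T R) (ib k)).
have [h1 h2] : m.-integrable T (fun z : borelC R => (\sum_(0 <= k < n) normc (b k z))%:E) /\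
    \sum_(0 <= k < n) normc (circle_integral (fun z => b k z * (poisson a z)%:C)) <=
    poisson_integral (fun z => \sum_(0 <= k < n) normc (b k z)) a.
  elim: n => [|n [IH1 IH2]].
    under eq_fun do rewrite big_nil; split; first exact: integrable0.
    rewrite big_nil; under [X in _ <= poisson_integral X _]eq_fun do rewrite big_nil.
    by apply: Rintegral_ge0 => z _; rewrite mulr0.
  under eq_fun do rewrite big_nat_recr//=; split.
    exact: (integrableD (@measurable_T R) IH1 (inb n)).
  rewrite big_nat_recr//=.
  under [X in _ <= poisson_integral X _]eq_fun do rewrite big_nat_recr//=.
  rewrite poisson_integralD//; apply: lerD => //.
  exact: normc_poisson_le.
apply: le_trans h2 _; rewrite -[leRHS](@poisson_integral_cst R K a a1).
apply: le_poisson_integral => //; first exact: circle_integrable_cst.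
by move=> z Tz; exact: bK.
Qed.

Lemma full_ntlim_set_null B : full_ntlim_set g B ->
  measurable (T `\` B) /\ m (T `\` B) = 0%E.
Proof.
move=> [mB BT mB1 _]; have mT := @measurable_T R.
split; first exact: measurableD.
rewrite measureD//; last by apply: le_lt_trans (probability_le1 m mT) _; rewrite ltry.
by rewrite setIidr// [X in (_ - X)%E]mB1 [X in (X - _)%E](circle_measure_T R) subee.
Qed.

(** The null set [N] is made to contain the complement of [B]. Off [N] the boundary functions are
    the nontangential limits, on [N] they vanish; so their sums are bounded by [K] on the whole
    circle, and Poisson averaging carries the bound inside. *)
Lemma disk_sum_le B K : full_ntlim_set g B ->
  (forall z, B z -> forall n, \sum_(0 <= k < n) normc (ntlim (g k) z) <= K) ->
  forall z, D z -> forall n, \sum_(0 <= k < n) normc (g k z) <= K.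
Proof.
move=> fB gK z Dz n; have [mTB TB0] := full_ntlim_set_null fB.
have K0 : 0 <= K.
  have [z0 Bz0] : B !=set0.
    apply/set0P/negP => /eqP B0; case: fB => _ _; rewrite B0 measure0 => /esym/eqP.
    by rewrite onee_eq0.
  by apply: le_trans (gK _ Bz0 0%N); rewrite big_nil.
have /choice[L hL] (k : nat) := Hinf_bounded (g k).
have [b [N [mb bL [mN N0 N0N bN] hb gb]]] := boundary_family
  (fun n : nat => @Hinf_analytic R (g n)) hL mTB TB0.
have := @poisson_sum_le b K z n Dz K0 (fun k => circle_integrable_bounded (mb k) (bL k)).
rewrite (eq_bigr (fun k => normc (g k z))); last by move=> k _; rewrite gb.
apply=> w Tw j; have [Nw|nNw] := pselect (N w).
  by rewrite big1// => k _; rewrite bN// normc0.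
have Bw : B w by apply: contrapT => nBw; apply: nNw; apply: N0N.
rewrite (eq_bigr (fun k => normc (ntlim (g k) w))); first exact: gK.
by move=> k _; rewrite (has_ntlim_ntlim Tw (hb k w Tw nNw)).
Qed.

Variable K : R.
Hypothesis gK : forall z, D z -> forall n, \sum_(0 <= k < n) normc (g k z) <= K.

Let g_le k z : D z -> normc (g k z) <= K.
Proof.
move=> Dz; apply: le_trans (gK Dz k.+1); rewrite big_nat_recr//= lerDr.
by apply: sumr_ge0 => i _; exact: normc_ge0.
Qed.

Let K_ge0 : 0 <= K.
Proof.
have D0 : D (0 : C) by rewrite /unit_disk /mkset normc0 ltr01.
by apply: le_trans (gK D0 0%N); rewrite big_nil.
Qed.

Lemma summable_boundary_family : exists (b : nat -> C -> C) (N : set (borelC R)),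
  [/\ forall n, cmeas T (b n : borelC R -> C),
    forall z, T z -> forall n, \sum_(0 <= k < n) normc (b k z) <= K,
    measurable N /\ m N = 0%E,
    forall n z, T z -> ~ N z -> has_ntlim (g n) z (b n z) &
    forall n a, normc a < 1 -> g n a = circle_integral (fun z => b n z * (poisson a z)%:C)].
Proof.
have [b [N [mb bL [mN N0 _ bN] hb gb]]] := boundary_family
  (fun n : nat => @Hinf_analytic R (g n)) (fun k z => @g_le k z) measurable0 (measure0 m).
exists b, N; split => // z Tz n; have [Nz|nNz] := pselect (N z).
  by rewrite big1// => k _; rewrite bN// normc0.
by apply: (boundary_sum_le gK Tz) => k; exact: hb.
Qed.

(** The bound [K] for the norm of S, stated for representatives and partial sums. *)
Lemma pairing_sum_le f n : \sum_(0 <= k < n) normc (H_pairing f (g k)) <=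
  K * Rintegral m T (fun z => normc (f z)).
Proof.
have [b [N [mb bK [mN N0] hb _]]] := summable_boundary_family.
have ifn : m.-integrable T (fun z : borelC R => (normc (f z))%:E).
  exact: (cintegrable_normc (@measurable_T R) (L1_integrable f)).
have bk k z : T z -> normc (b k z) <= K.
  move=> Tz; apply: le_trans (bK z Tz k.+1); rewrite big_nat_recr//= lerDr.
  by apply: sumr_ge0 => i _; exact: normc_ge0.
have ifb k := circle_integrableMr (L1_integrable f) (mb k) (bk k).
have inb k : m.-integrable T (fun z : borelC R => (normc (f z * b k z))%:E).
  exact: (cintegrable_normc (@measurable_T R) (ifb k)).
have [h1 h2] : m.-integrable T (fun z : borelC R => (\sum_(0 <= k < n) normc (f z * b k z))%:E) /\
    \sum_(0 <= k < n) normc (H_pairing f (g k)) <=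
    Rintegral m T (fun z => \sum_(0 <= k < n) normc (f z * b k z)).
  elim: n => [|n [IH1 IH2]].
    under eq_fun do rewrite big_nil; split; first exact: integrable0.
    by rewrite big_nil; apply: Rintegral_ge0 => z _; rewrite big_nil.
  under eq_fun do rewrite big_nat_recr//=; split.
    exact: (integrableD (@measurable_T R) IH1 (inb n)).
  rewrite big_nat_recr//.
  have -> : (fun z => \sum_(0 <= k < n.+1) normc (f z * b k z)) =
      (fun z => \sum_(0 <= k < n) normc (f z * b k z) + normc (f z * b n z)).
    by apply/funext => z; rewrite big_nat_recr.
  rewrite (RintegralD (@measurable_T R) IH1 (inb n)); apply: lerD; first exact: IH2.

  have -> : H_pairing f (g n) = circle_integral (fun z => f z * b n z).
    exact: (H_pairing_boundary f mN N0 (hb n)).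
  exact: (normc_cint (@measurable_T R) (ifb n)).
apply: le_trans h2 _; rewrite -(RintegralZl _ (@measurable_T R) ifn).
apply: (le_Rintegral (@measurable_T R) h1 (integrableZl (@measurable_T R) K ifn)) => z Tz.
under eq_bigr do rewrite normcM; rewrite -mulr_sumr mulrC.
by apply: ler_wpM2r; [exact: normc_ge0|exact: bK].
Qed.

(** The partial sums are uniformly bounded, so [analytic_limit] makes their sum analytic. Its
    boundary function is the sum of the [u_n b_n], as the Poisson formulas pass to the limit;
    termwise pairing is dominated convergence on the circle. *)
Lemma linf_combination (u : linf R) : exists h : Hinf R,
  (forall z, D z -> series (fun n => u n * g n z) @ \oo --> h z) /\
  forall f, series (fun n => H_pairing f (g n) * u n) @ \oo --> H_pairing f h.
Proof.
have [U uU] : exists U, forall n, normc (u n) <= U by case: u => u' /= /asboolP.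
have U0 : 0 <= U by exact: le_trans (normc_ge0 _) (uU 0%N).
have [b [N [mb bK [mN N0] hb gb]]] := summable_boundary_family.
have le_sum (w : nat -> C) n : (forall n, \sum_(0 <= k < n) normc (w k) <= K) ->
    \sum_(0 <= k < n) normc (u k * w k) <= U * K.
  move=> wK; apply: (@le_trans _ _ (U * \sum_(0 <= k < n) normc (w k))).
    by rewrite mulr_sumr; apply: ler_sum => k _; rewrite normcM ler_wpM2r ?normc_ge0.
  exact: ler_wpM2l.
pose F_ n z := series (fun k => u k * g k z) n.
pose F z := if z \in D then limn (F_ ^~ z) else 0.
have FE z : D z -> F z = limn (F_ ^~ z) by move=> Dz; rewrite /F mem_set.
have cF z : D z -> F_ ^~ z @ \oo --> F z.
  move=> Dz; rewrite FE//; apply: (@cvg_cseries R _ (U * K)) => n.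
  by apply: (le_sum (fun k => g k z)); exact: gK.
have F_K n z : D z -> normc (F_ n z) <= U * K.
  move=> Dz; apply: le_trans (normc_sum_le _ _) _.
  by apply: (le_sum (fun k => g k z)); exact: gK.
have dF_ n : analytic_in_disk (F_ n).
  move=> z Dz; rewrite /F_ /series /=; elim: n => [|n IH].
    by under eq_fun do rewrite big_nil; exact: derivable_cst.
  under eq_fun do rewrite big_nat_recr//=; apply: derivableD; first exact: IH.
  exact (cderivM (cderiv_cst (u n) z) (@Hinf_analytic R (g n) z Dz)).
have dF : analytic_in_disk F := analytic_limit dF_ F_K cF.
have FH : F \in @Hinf_fun R.
  apply/asboolP; split => //; last by move=> z nDz; rewrite /F memNset.
  by exists (U * K) => z Dz; apply: (normc_cvg_le (cF z Dz)) => n; exact: F_K.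
pose B_ n z := series (fun k => u k * b k z) n.
pose Bu z := limn (B_ ^~ z).
have cB z : T z -> B_ ^~ z @ \oo --> Bu z.
  move=> Tz; apply: (@cvg_cseries R _ (U * K)) => n.
  by apply: (le_sum (fun k => b k z)); exact: bK.
have B_K n z : T z -> normc (B_ n z) <= U * K.
  move=> Tz; apply: le_trans (normc_sum_le _ _) _.
  by apply: (le_sum (fun k => b k z)); exact: bK.
have mB_ n : cmeas T (B_ n : borelC R -> C).
  rewrite /B_ /series /=; elim: n => [|n IH].
    by under eq_fun do rewrite big_nil; exact: cmeas_cst.
  under eq_fun do rewrite big_nat_recr//=; apply: cmeasD; first exact: IH.
  by apply: cmeasM; [exact: cmeas_cst|exact: mb].
have [iB _] := circle_dominated mB_ cB (circle_integrable_cst (U * K)) B_K.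
have bk k z : T z -> normc (b k z) <= K.
  move=> Tz; apply: le_trans (bK z Tz k.+1); rewrite big_nat_recr//= lerDr.
  by apply: sumr_ge0 => i _; exact: normc_ge0.
(* Used twice: with a Poisson kernel, to recognize [Bu] as the boundary function of [F], and with
   the given [f]. *)
have pair (f : C -> C) : circle_integrable f ->
    series (fun k => circle_integral (fun z => f z * b k z) * u k) @ \oo -->
    circle_integral (fun z => f z * Bu z).
  move=> fi; have mf := cintegrable_cmeas fi.
  have ifn := integrableZl (@measurable_T R) (U * K) (cintegrable_normc (@measurable_T R) fi).
  have [||_ cI] := @circle_dominated R (fun n z => f z * B_ n z) (fun z => f z * Bu z) _
     (fun n => cmeasM mf (mB_ n)) _ ifn.
  - by move=> z Tz; apply: cvgM; [exact: cvg_cst|exact: cB].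
  - by move=> n z Tz; rewrite normcM mulrC ler_wpM2r ?normc_ge0 ?B_K.
  have E : (fun n => circle_integral (fun z => f z * B_ n z)) =
      series (fun k => circle_integral (fun z => f z * b k z) * u k).
    apply/funext => n; rewrite /B_ /series /=.
    have ifb k := circle_integrableMr fi (mb k) (bk k).
    elim: n => [|n IH].
      rewrite big_nil; under eq_fun do rewrite big_nil mulr0.
      by rewrite circle_integral_cst.
    rewrite big_nat_recr//= -IH mulrC -circle_integralZ// -circle_integralD//.
    - by apply: eq_circle_integral => z _; rewrite big_nat_recr//= mulrDr (mulrCA (f z)).
    - exact: (circle_integrableMr fi (mB_ n) (B_K n)).
    - exact: circle_integrableZ.
  by rewrite -E.
have FB a : normc a < 1 -> F a = circle_integral (fun z => Bu z * (poisson a z)%:C).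
  move=> a1; have ip : circle_integrable (fun z => (poisson a z)%:C).
    by apply/circle_integrable_real; exact: integrable_poisson.
  have := pair _ ip.
  have -> : series (fun k => circle_integral (fun z => (poisson a z)%:C * b k z) * u k) = F_ ^~ a.
    apply/funext => n; apply: eq_bigr => k _; rewrite gb// mulrC; congr (_ * _).
    by apply: eq_circle_integral => z _; rewrite mulrC.
  move=> c; rewrite (_ : circle_integral _ = circle_integral (fun z => (poisson a z)%:C * Bu z)).
    exact: (@cvg_unique _ _ _ _ _ _ (cF a a1) c).
  by apply: eq_circle_integral => z _; rewrite mulrC.
have [N' [mN' N'0 hN']] := ntlim_poisson iB FB.
exists (MkHinf FH); split; first exact: cF.
move=> f; have hBu z : T z -> ~ N' z -> has_ntlim (MkHinf FH) z (Bu z).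
  by move=> Tz nNz; apply: contrapT => h; apply: nNz; apply: hN' => /= /(_ Tz).
rewrite (H_pairing_boundary f mN' N'0 hBu).
have -> : (fun n => H_pairing f (g n) * u n) =
    (fun k => circle_integral (fun z => f z * b k z) * u k).
  by apply/funext => k; rewrite (H_pairing_boundary f mN N0 (hb k)).
exact: (pair _ (L1_integrable f)).
Qed.

End BoundedSums.

(** * Weak* topologies *)

Section InitialTopology.

Lemma cvg_initial (S : choiceType) (X : topologicalType) (w : S -> X) (F : set_system S)
  (FF : Filter F) (s : S) : w @ F --> w s -> F --> (s : initial_topology w).
Proof.
move=> cw A [B [[W oW <-] Ws]] /filterS; apply; apply: cw; exact: open_nbhs_nbhs.
Qed.

Lemma cvg_pointwise (U : choiceType) (V : topologicalType) (F : set_system (U -> V))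
  (FF : Filter F) (f : U -> V) : (forall t, (fun h : U -> V => h t) @ F --> f t) ->
  F --> (f : {ptws U -> V}).
Proof. by move=> Ff; apply/cvg_sup => t; apply: cvg_initial; exact: Ff. Qed.

End InitialTopology.

Section WeakStar.
Variable R : realType.
Local Notation C := R[i].
Implicit Types (u : linf R) (v : l1 R) (f : L1 R).

Lemma weakstar_linf_cvg (w : nat -> linf R) u :
  (forall v, (fun n => l1_pairing v (w n)) @ \oo --> l1_pairing v u) ->
  w @ \oo --> (u : weakstar_linf R).
Proof.
move=> cw; apply: cvg_initial; apply: cvg_pointwise => v; exact: cw.
Qed.

Lemma l1_pairing_continuous v :
  continuous ((fun u => l1_pairing v u) : weakstar_linf R -> C).
Proof.
move=> u; pose p := (fun u : linf R => (fun v => l1_pairing v u) : {ptws l1 R -> C}).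
have c1 : p @ nbhs (u : weakstar_linf R) --> p u by exact: (@initial_continuous _ _ p u).
exact: (cvg_comp _ _ c1 (@proj_continuous _ (fun=> C) v (p u))).
Qed.

Lemma H_pairing_continuous f :
  continuous ((fun h => H_pairing f h) : weakstar_Hinf R -> C).
Proof.
move=> h; pose p := (fun h : Hinf R => (fun f => H_pairing f h) : {ptws L1 R -> C}).
have c1 : p @ nbhs (h : weakstar_Hinf R) --> p h by exact: (@initial_continuous _ _ p h).
exact: (cvg_comp _ _ c1 (@proj_continuous _ (fun=> C) f (p h))).
Qed.

Lemma weakstar_continuousP (U : linf R -> Hinf R) :
  (forall f, continuous ((fun u => H_pairing f (U u)) : weakstar_linf R -> C)) ->
  weakstar_continuous U.
Proof.
move=> cU u.
suff : U @ nbhs (u : weakstar_linf R) --> (U u : weakstar_Hinf R) by [].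
have FF : Filter (nbhs (u : weakstar_linf R)) by exact: nbhs_filter.
have cu f : (fun u => H_pairing f (U u)) @ nbhs (u : weakstar_linf R) --> H_pairing f (U u).
  exact: cU.
move: FF cu; generalize (nbhs (u : weakstar_linf R)) => F FF cu.
pose p := (fun h : Hinf R => (fun f => H_pairing f h) : {ptws L1 R -> C}).
have c1 : p @ (U @ F) --> p (U u).
  by apply: (@cvg_pointwise (L1 R) C (p @ (U @ F)) _ (p (U u))) => f; exact: cu.
exact: (@cvg_initial _ _ p (U @ F) _ (U u) c1).
Qed.

Definition truncation u (n : nat) : linf R := \sum_(0 <= j < n) u j *: unit_seq R j.

Lemma truncationE u n k : truncation u n k = if (k < n)%N then u k else 0.
Proof.
rewrite /truncation; elim: n => [|n IH]; first by rewrite big_nil.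
rewrite big_nat_recr//.
transitivity ((\sum_(0 <= j < n) u j *: unit_seq R j : linf R) k + u n * (k == n)%:R) => //.
rewrite IH ltnS [(k <= n)%N]leq_eqVlt; case: eqVneq => [->|] /=; first by rewrite ltnn mulr1 add0r.
by rewrite mulr0 addr0.
Qed.

Lemma l1_pairing_cvg v u : series (fun k => v k * u k) @ \oo --> l1_pairing v u.
Proof.
have [U uU] : exists U, forall n, normc (u n) <= U by case: u => u' /= /asboolP.
have U0 : 0 <= U by exact: le_trans (normc_ge0 _) (uU 0%N).
have v0 n : 0 <= normc (v n) by exact: normc_ge0.
have sv : (\sum_(n <oo) (normc (v n))%:E < +oo)%E by case: v {v0} => v' /= /asboolP.
have fv : (\sum_(n <oo) (normc (v n))%:E)%E \is a fin_num.
  rewrite ge0_fin_numE; first exact: sv.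
  by apply: nneseries_ge0 => n _ _; rewrite lee_fin; exact: v0.
apply: (@cvg_cseries R _ (fine (\sum_(n <oo) (normc (v n))%:E)%E * U)) => n.
apply: (@le_trans _ _ ((\sum_(0 <= k < n) normc (v k)) * U)).
  by rewrite mulr_suml; apply: ler_sum => k _; rewrite normcM ler_wpM2l.
apply: ler_wpM2r => //; rewrite -lee_fin fineK//.
exact: ((@nneseries_leP R (fun k => normc (v k)) _ v0).1 (lexx _) n).
Qed.

(** Pairing [v] with the [n]-th truncation gives the [n]-th partial sum of the pairing with [u]. *)
Lemma truncation_cvg u : truncation u @ \oo --> (u : weakstar_linf R).
Proof.
apply: weakstar_linf_cvg => v.
have -> : (fun n => l1_pairing v (truncation u n)) = series (fun k => v k * u k).
  apply/funext => n; apply: cvg_lim => //; apply: cvg_near_cst.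
  exists n => // N /= nN; rewrite /series /= (big_cat_nat (n := n))//=.
  have -> : \sum_(n <= k < N) v k * truncation u n k = 0.
    rewrite big_nat_cond big1// => k /andP[/andP[nk _] _].
    by rewrite truncationE ltnNge nk mulr0.
  rewrite addr0.
  rewrite big_nat_cond [RHS]big_nat_cond; apply: eq_bigr => k /andP[/andP[_ kn] _].
  by rewrite truncationE kn.
exact: l1_pairing_cvg.
Qed.

Lemma H_pairing0 f : H_pairing f 0 = 0.
Proof. by have := H_pairingDZr f (-1) 0 0; rewrite scaler0 addr0 mulN1r addNr. Qed.

(** On truncations, linearity and the values on unit sequences determine the map; weak* continuity
    carries the formula to [u]. *)
Lemma weakstar_continuous_series (U : {linear linf R -> Hinf R}) (g : nat -> Hinf R) f u :
  weakstar_continuous U -> (forall j, U (unit_seq R j) = g j) ->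
  series (fun j => H_pairing f (g j) * u j) @ \oo --> H_pairing f (U u).
Proof.
move=> cU Ug.
have c : (fun n => H_pairing f (U (truncation u n))) @ \oo --> H_pairing f (U u).
  have c1 : (fun n => U (truncation u n)) @ \oo --> (U u : weakstar_Hinf R).
    exact: (cvg_comp _ _ (@truncation_cvg u) (cU u)).
  exact: (cvg_comp _ _ c1 (@H_pairing_continuous f (U u))).
have E n : H_pairing f (U (truncation u n)) = \sum_(0 <= j < n) H_pairing f (g j) * u j.
  rewrite /truncation; elim: n => [|n IH]; first by rewrite !big_nil linear0 H_pairing0.
  rewrite big_nat_recr// [RHS]big_nat_recr// -IH /= linearD linearZ Ug.
  by rewrite [_ + u n *: _]addrC H_pairingDZr addrC mulrC.
by rewrite (funext E) in c.
Qed.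

End WeakStar.

Section PredualMap.
Variable R : realType.
Local Notation C := R[i].
Local Notation D := (@unit_disk R).
Local Notation T := (@unit_circle R : set (borelC R)).
Local Notation m := (@circle_measure R).
Variables (g : nat -> Hinf R) (K : R).
Hypothesis gK : forall z, D z -> forall n, \sum_(0 <= k < n) normc (g k z) <= K.

Let K0 : 0 <= K.
Proof.
have D0 : D (0 : C) by rewrite /unit_disk /mkset normc0 ltr01.
by apply: le_trans (gK D0 0%N); rewrite big_nil.
Qed.

Lemma L1_normE (f : L1 R) : L1_norm f = (Rintegral m T (fun z => normc (f z)))%:E.
Proof.
rewrite /L1_norm /Rintegral fineK//; apply: integrable_fin_num; first exact: measurable_T.
exact: (cintegrable_normc (@measurable_T R) (L1_integrable f)).
Qed.

(** S is computed on the canonical representative of a class; by [H_pairing_class] any other gives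
    the same sequence, and this also yields linearity. *)
Lemma predual_map : exists S : {linear L1_H10 R -> l1 R},
  forall f n, S (L1_class f) n = H_pairing f (g n).
Proof.
have sm (f : L1 R) : (fun n => H_pairing f (g n)) \in @summable_seq R.
  apply/asboolP; apply: le_lt_trans (ltry (K * Rintegral m T (fun z => normc (f z)))).
  by apply/nneseries_leP => [n|n]; [exact: normc_ge0|rewrite lee_fin; exact: pairing_sum_le].
pose S (x : L1_H10 R) : l1 R := L1seq (sm (repr x)).
have SE f n : S (L1_class f) n = H_pairing f (g n).
  by apply: H_pairing_class; exact: reprK.
have Slin : linear S.
  move=> c x y; apply/val_inj/funext => n.
  have rK (t : L1_H10 R) : L1_class (repr t) = t by exact: reprK.
  have E : c *: x + y = L1_class (c *: repr x + repr y).
    by rewrite L1_classD L1_classZ !rK.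
  rewrite -[LHS]/(S _ n) E SE H_pairingDZl -!SE !rK.
  by [].
by exists (HB.pack_for {linear L1_H10 R -> l1 R} S (GRing.isLinear.Build _ _ _ _ S Slin)).
Qed.

Lemma predual_norm_le (S : L1_H10 R -> l1 R) : (forall f n, S (L1_class f) n = H_pairing f (g n)) ->
  forall x, (l1_norm (S x) <= K%:E * L1_H10_norm x)%E.
Proof.
move=> SE x.
have le1 f : L1_class f = x -> (l1_norm (S x) <= K%:E * L1_norm f)%E.
  move=> <-; rewrite L1_normE -EFinM /l1_norm.
  apply/nneseries_leP => [n|n]; first exact: normc_ge0.
  rewrite lee_fin; under eq_bigr do rewrite SE.
  exact: pairing_sum_le.
(* The bound is passed to the infimum over representatives by dividing by [K], so [K = 0] is treated
   apart. *)
have := K0; rewrite le_eqVlt => /orP[/eqP K00|Kp].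
  by have := le1 (repr x) (reprK x); rewrite -K00 !mul0e.
rewrite muleC -lee_pdivrMr//; apply: le_ereal_inf_tmp => _ [f fx <-].
by rewrite lee_pdivrMr// muleC; exact: le1.
Qed.

End PredualMap.

(** * Phases, suprema of sums and the gliding hump *)

Section Phases.
Variable R : realType.
Local Notation C := R[i].
Implicit Types (c : C) (v : nat -> C).

(** At [c = 0] the inverse is 0 by convention, so the phase is 0: its modulus is at most 1, and
    [phaseM] holds without exception. *)
Definition phase c : C := c^*%C / (normc c)%:C.

Lemma phaseM c : phase c * c = (normc c)%:C.
Proof.
have [->|c0] := eqVneq c 0; first by rewrite mulr0 normc0.
have n0 : (normc c)%:C != 0 :> C by rewrite gt_eqF// ltcR normc_gt0.
by rewrite /phase mulrAC [_ * c]mulrC mulc_conj rmorphXn /= expr2 mulfK.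
Qed.

Lemma normc_phase_le1 c : normc (phase c) <= 1.
Proof.
have [->|c0] := eqVneq c 0.
  by rewrite /phase rmorph0 mul0r normc0.
by rewrite normcM normc_conj -fmorphV normc_real ger0_norm ?invr_ge0 ?normc_ge0// divff// normc_eq0.
Qed.

Lemma linf_of_le1 v : (forall n, normc (v n) <= 1) ->
  exists2 u : linf R, forall n, u n = v n & (linf_norm u <= 1)%E.
Proof.
move=> v1; have vb : v \in @bounded_seq R by apply/asboolP; exists 1.
exists (Linf vb) => //; apply: ge_ereal_sup => _ [n _ <-]; by rewrite lee_fin /=.
Qed.

End Phases.

Section SupSum.
Variable R : realType.
Local Notation C := R[i].
Local Notation D := (@unit_disk R).
Local Notation T := (@unit_circle R : set (borelC R)).
Local Notation m := (@circle_measure R).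
Implicit Types (A B : set C) (h : nat -> C -> C) (K : R) (g : nat -> Hinf R).

Lemma sup_sum_leP A h (x : \bar R) : (sup_sum A h <= x)%E <->
  forall z, A z -> forall n, ((\sum_(0 <= k < n) normc (h k z))%:E <= x)%E.
Proof.
split=> [hx z Az|hx].
  apply/nneseries_leP => [n|]; first exact: normc_ge0.
  by apply: le_trans hx; apply: ereal_sup_ubound; exists z.
apply: ge_ereal_sup => _ [z Az <-]; apply/nneseries_leP => [n|]; first exact: normc_ge0.
exact: hx.
Qed.

Lemma sup_sum_fine A h : A !=set0 -> (sup_sum A h < +oo)%E ->
  sup_sum A h = (fine (sup_sum A h))%:E.
Proof.
move=> [z Az] lty; rewrite fineK// ge0_fin_numE//.
have := (sup_sum_leP A h _).1 (lexx _) z Az 0%N.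
by rewrite big_nil.
Qed.

Lemma disk_nonempty : D !=set0.
Proof. by exists 0; rewrite /unit_disk /mkset normc0 ltr01. Qed.

Lemma full_ntlim_set_nonempty g B : full_ntlim_set g B -> B !=set0.
Proof.
move=> [_ _ B1 _]; apply/set0P/negP => /eqP B0.
by move: B1; rewrite B0 measure0 => /esym/eqP; rewrite onee_eq0.
Qed.

(** Each inequality is trivial when its right-hand side is infinite; otherwise [disk_sum_le] gives
    one and [boundary_sum_le] the other. *)
Lemma sup_sum_boundary g B : full_ntlim_set g B ->
  sup_sum D g = sup_sum B (fun n => ntlim (g n)).
Proof.
move=> fB; apply/eqP; rewrite eq_le; apply/andP; split.
  have [lty|] := ltP (sup_sum B (fun n => ntlim (g n))) +oo%E; last first.
    by rewrite leye_eq => /eqP ->; rewrite leey.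
  have E := sup_sum_fine (full_ntlim_set_nonempty fB) lty; rewrite E.
  apply/sup_sum_leP => z Dz n; rewrite lee_fin.
  apply: (disk_sum_le fB) => // w Bw k; rewrite -lee_fin -E.
  exact: ((sup_sum_leP _ _ _).1 (lexx _) w Bw k).
have [lty|] := ltP (sup_sum D g) +oo%E; last by rewrite leye_eq => /eqP ->; rewrite leey.
have E := sup_sum_fine disk_nonempty lty; rewrite E.
have [_ BT _ hB] := fB.
apply/sup_sum_leP => z Bz n; rewrite lee_fin.
have gK w : D w -> forall k, \sum_(0 <= i < k) normc (g i w) <= fine (sup_sum D g).
  by move=> Dw k; rewrite -lee_fin -E; exact: ((sup_sum_leP _ _ _).1 (lexx _) w Dw k).
apply: (boundary_sum_le (l := fun k => ntlim (g k) z) gK (BT z Bz)) => k.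
by have [l hl] := hB z Bz k; rewrite (has_ntlim_ntlim (BT z Bz) hl).
Qed.

Lemma full_ntlim_set_exists g : exists B, full_ntlim_set g B.
Proof.
have /choice[L hL] (k : nat) := Hinf_bounded (g k).
have [b [N [_ _ [mN N0 _ _] hb _]]] := boundary_family
  (fun n : nat => @Hinf_analytic R (g n)) hL measurable0 (measure0 m).
have mT := @measurable_T R.
exists (T `\` N); split.
- exact: measurableD.
- by move=> z [].
- rewrite [LHS]measureD//; last by apply: le_lt_trans (probability_le1 m mT) _; rewrite ltry.
  have TN0 : m (T `&` N) = 0%E.
    apply/eqP; rewrite eq_le measure_ge0 andbT -N0.
    by apply: le_measure; rewrite ?inE//; exact: measurableI.
  by rewrite [X in (_ - X)%E]TN0 sube0 [LHS](circle_measure_T R).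
- by move=> z [Tz nNz] n; exists (b n z); exact: hb.
Qed.

Lemma disk_algebra_ntlim (G : C -> C) (h : C -> C) z : disk_algebra G ->
  (forall z, D z -> h z = G z) -> unit_circle z -> has_ntlim h z (G z).
Proof.
move=> [cG _] hG Tz al al1.
have cz : G w @[w --> within [set z : C | normc z <= 1] (nbhs z)] --> G z.
  have := cG z; rewrite /prop_for /continuous_at.
  by rewrite nbhs_subspace_in//= Tz.
have sub : within (stolz_region al z) (nbhs z) `=>` within [set z : C | normc z <= 1] (nbhs z).
  move=> A; rewrite /within /=; apply: filterS => w hw [Dw _]; apply: hw.
  exact: ltW.
have c2 : G w @[w --> within (stolz_region al z) (nbhs z)] --> G z.
  by apply: cvg_trans cz; exact: cvg_app.
apply: cvg_trans c2; apply: near_eq_cvg.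
by apply/nbhsc_normP; exists 1 => // w _ [Dw _]; rewrite hG.
Qed.

End SupSum.

Section GlidingHump.
Variable R : realType.
Local Notation C := R[i].
Local Notation D := (@unit_disk R).
Variables (g : nat -> Hinf R) (U : linf R -> Hinf R).
Hypothesis gU : forall (u : linf R) z, D z -> series (fun n => (u : nat -> C) n * g n z) @ \oo --> U u z.
Implicit Types (z : C) (u : linf R).

Let P n z : R := \sum_(0 <= k < n) normc (g k z).

(** With [u] the phases of the [g n z], the partial sums of the series for [U u z] are the sums of
    the [normc (g n z)]. *)
Lemma phase_series z : D z -> exists2 u : linf R, (linf_norm u <= 1)%E &
  P ^~ z @ \oo --> complex.Re (U u z).
Proof.
move=> Dz; have [u uE u1] := linf_of_le1 (fun n => normc_phase_le1 (g n z)).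
exists u => //; have := @gU u _ Dz.
have -> : series (fun n => u n * g n z) = fun n => (P n z)%:C.
  apply/funext => n; rewrite /series /= /P rmorph_sum /=.
  by apply: eq_bigr => k _; rewrite uE phaseM.
by move=> /cvgc_ReIm[].
Qed.

Let P_mono z n n' : (n <= n')%N -> P n z <= P n' z.
Proof.
move=> nn'; rewrite /P (big_cat_nat (n := n) (p := n'))//= lerDl.
by apply: sumr_ge0 => k _; exact: normc_ge0.
Qed.

Lemma phase_series_le z u n : P ^~ z @ \oo --> complex.Re (U u z) -> P n z <= complex.Re (U u z).
Proof.
move=> c; rewrite -(@cvg_lim _ _ _ _ _ _ _ c)//.
apply: limr_ge; first by apply/cvg_ex; eexists; exact: c.
by exists n => // n' /= nn'; exact: P_mono.
Qed.

(** Here [s] bounds all the sums at the point, [p] and [q] are the sums up to the two ends of the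
    block, and [r] is a later partial sum. The block contributes [q - p], the other indices at least
    [- (r - (q - p))]. *)
Let hump_le (a s w p q r : R) : 2 * a + 2 + w < s -> p <= a -> s - 1 < q -> r <= s ->
  w <= 2 * (q - p) - r.
Proof. by move=> *; lra. Qed.

(* Gliding hump: were the sums unbounded, one could choose points z_k and consecutive *)
(* blocks of indices such that the block k carries almost all of the (large) sum at   *)
(* z_k; for u equal to the phases of the g_n (z_k) on the block k, U u is unbounded.  *)
Lemma bounded_of_linf_sums : exists K : R, forall z, D z -> forall n, P n z <= K.
Proof.
apply: contrapT => unb.
have /choice[A hA] (n : nat) : exists a, forall z, D z -> P n z <= a.
  elim: n => [|n [a ha]]; first by exists 0 => z _; rewrite /P big_nil.
  have [b hb] := Hinf_bounded (g n); exists (a + b) => z Dz.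
  by rewrite /P big_nat_recr//=; apply: lerD; [exact: ha|exact: hb].
have step (kN : nat * nat) : exists zN : C * nat, [/\ D zN.1, (kN.2 <= zN.2)%N &
    exists s, [/\ 2 * A kN.2 + 2 + kN.1%:R < s, s - 1 < P zN.2 zN.1 &
                  forall n, P n zN.1 <= s]].
  case: kN => k N /=; apply: contrapT => nex; apply: unb.
  (* If no point and cut had the required properties, this constant would bound all the sums: at a
     point where it is exceeded, [s] is the full sum and [N'] a cut that captures it up to 1. *)
  exists (2 * A N + 2 + k%:R) => z Dz n; rewrite leNgt; apply/negP => lt.
  apply: nex; have [u _ cu] := phase_series Dz.
  set s := complex.Re (U u z) in cu; have Ps n' : P n' z <= s by exact: phase_series_le.
  have s1 : s - 1 < s by rewrite gtrBl.
  have [N' _ hN'] : \forall n \near \oo, s - 1 < P n z.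
    exact: (cvgr_gt _ cu).
  exists (z, maxn N N') => /=; split => //; first exact: leq_maxl.
  exists s; split => //; first exact: lt_le_trans lt (Ps n).
  by apply: hN' => /=; exact: leq_maxr.
have /choice[ch hch] := step.
pose Ns := fix Ns k := if k is k'.+1 then (ch (k', Ns k')).2 else 0%N.
pose zs k := (ch (k, Ns k)).1.
have Dzs k : D (zs k) by have [] := hch (k, Ns k).
have Nmono : {homo Ns : i j / (i <= j)%N}.
  by apply: homo_leq => [//|? ? ?|k]; [exact: leq_trans|have [] := hch (k, Ns k)].
pose blk n k := (Ns k <= n < Ns k.+1)%N.
have blk_uniq n k k' : blk n k -> blk n k' -> k = k'.
  have aux i j : blk n i -> blk n j -> ~~ (i < j)%N.
    move=> /andP[_ h1] /andP[h2 _]; apply/negP => ij.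
    by have := leq_trans (leq_trans h1 (Nmono _ _ ij)) h2; rewrite ltnn.
  move=> h1 h2; have a1 := aux _ _ h1 h2; have a2 := aux _ _ h2 h1.
  by move: a1 a2; case: ltngtP.
(* An index lies in at most one block and receives the phase at the point of that block; indices in
   no block receive 0. *)
pose v n : C := if pselect (exists k, blk n k) is left e then phase (g n (zs (projT1 (cid e)))) else 0.
have vE n k : blk n k -> v n = phase (g n (zs k)).
  move=> nk; rewrite /v; case: pselect => [e|]; last by case; exists k.
  by rewrite (blk_uniq n _ _ (projT2 (cid e)) nk).
have v1 n : normc (v n) <= 1.
  by rewrite /v; case: pselect => [e|_]; rewrite ?normc0 ?ler01 ?normc_phase_le1.
have [u uE _] := linf_of_le1 v1.
have [W hW] := Hinf_bounded (U u).
have W0 : 0 <= W by exact: le_trans (normc_ge0 _) (hW _ (Dzs 0%N)).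
pose k := (Num.Def.archi_bound W).
have Wk : W < k%:R by exact: archi_boundP.
have [Dz NN [s [h1 h2 h3]]] := hch (k, Ns k); rewrite /= in Dz NN h1 h2 h3.
rewrite -/(zs k) in Dz h2 h3; have NE : (ch (k, Ns k)).2 = Ns k.+1 by [].
rewrite NE in NN h2.
have ge n : (Ns k.+1 <= n)%N -> k%:R <= complex.Re (series (fun n => u n * g n (zs k)) n).
  (* Adding the modulus makes every term nonnegative, and equal to twice the modulus on the block;
     the terms outside the block can then be dropped. *)
  move=> nn; pose t j := complex.Re (u j * g j (zs k)) + normc (g j (zs k)).
  have t0 j : 0 <= t j.
    have h := ler_Re_normc (u j * g j (zs k)); rewrite ler_norml in h.
    have {h} /andP[h _] := h; rewrite normcM in h.
    have h' : normc (u j) * normc (g j (zs k)) <= normc (g j (zs k)).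
      by rewrite ler_piMl ?normc_ge0// uE.
    rewrite /t -lerBlDr sub0r; apply: le_trans h; by rewrite lerN2.
  have tE : \sum_(0 <= j < n) t j = complex.Re (series (fun n => u n * g n (zs k)) n) + P n (zs k).
    rewrite /t big_split /=; congr (_ + _); rewrite /series /=.
    elim: (n) => [|j IH]; first by rewrite !big_nil.
    by rewrite !big_nat_recr//= ReD IH.
  have t2 : 2 * (P (Ns k.+1) (zs k) - P (Ns k) (zs k)) <= \sum_(0 <= j < n) t j.
    rewrite (big_cat_nat (n := Ns k.+1))//= (big_cat_nat (n := Ns k) (p := Ns k.+1))//=.
    have -> : P (Ns k.+1) (zs k) - P (Ns k) (zs k) = \sum_(Ns k <= j < Ns k.+1) normc (g j (zs k)).
      by rewrite /P (big_cat_nat (n := Ns k) (p := Ns k.+1))//= addrAC subrr add0r.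
    have -> : 2 * \sum_(Ns k <= j < Ns k.+1) normc (g j (zs k)) = \sum_(Ns k <= j < Ns k.+1) t j.
      rewrite mulr_sumr big_nat_cond [RHS]big_nat_cond; apply: eq_bigr => j /andP[jk _].
      by rewrite /t uE (vE _ _ jk) phaseM /= -mulr2n mulr_natl.
    have q0 : 0 <= \sum_(0 <= j < Ns k) t j by exact: sumr_ge0.
    have q1 : 0 <= \sum_(Ns k.+1 <= j < n) t j by exact: sumr_ge0.
    by rewrite addrAC lerDr addr_ge0.
  rewrite tE -lerBlDr in t2; apply: le_trans t2.
  exact: (hump_le h1 (hA _ _ Dz) h2 (h3 n)).
have := hW _ Dz; apply/negP; rewrite -ltNge; apply: lt_le_trans Wk _.
apply: le_trans (ler_Re_normc _); apply: le_trans (ler_norm _).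
have /cvgc_ReIm[c _] := @gU u _ Dz.
rewrite -(@cvg_lim _ _ _ _ _ _ _ c)//; apply: limr_ge; first by apply/cvg_ex; eexists; exact: c.
by exists (Ns k.+1).
Qed.

End GlidingHump.

Section WeakStarMap.
Variable R : realType.
Local Notation C := R[i].
Local Notation D := (@unit_disk R).
Implicit Types (g : nat -> Hinf R) (u : linf R) (K : R).

(** The values are those of [linf_combination], linear because limits are unique. Paired with [f],
    they give the pairing of [S f] in l^1 with [u], which is weak* continuous by definition. *)
Lemma weakstar_map_exists g K :
  (forall z, D z -> forall n, \sum_(0 <= k < n) normc (g k z) <= K) ->
  exists U : {linear linf R -> Hinf R},
    weakstar_continuous U /\ forall j, U (unit_seq R j) = g j.
Proof.
move=> gK; have /choice[U hU] := linf_combination gK.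
have cU u z : D z -> series (fun n => u n * g n z) @ \oo --> U u z by exact: (hU u).1.
have Ulin : linear U.
  move=> c u v; apply: Hinf_eq => z Dz.
  have c1 : series (fun n => (c *: u + v : linf R) n * g n z) @ \oo --> c * U u z + U v z.
    have -> : series (fun n => (c *: u + v : linf R) n * g n z) =
        (fun n => c * series (fun n => u n * g n z) n + series (fun n => v n * g n z) n).
      apply/funext => n; rewrite /series /= mulr_sumr -big_split /=.
      by apply: eq_bigr => k _; rewrite mulrA -mulrDl.
    by apply: cvgD; [apply: cvgM; [exact: cvg_cst|exact: cU]|exact: cU].
  exact: (@cvg_unique _ _ _ _ _ _ (cU _ z Dz) c1).
exists (HB.pack_for {linear linf R -> Hinf R} U (GRing.isLinear.Build _ _ _ _ U Ulin)).
split=> [|j].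
  apply: weakstar_continuousP => f; have [S SE] := predual_map gK.
  have -> : (fun u => H_pairing f (U u)) = (fun u => l1_pairing (S (L1_class f)) u).
    apply/funext => u; have := @l1_pairing_cvg R (S (L1_class f)) u.
    have -> : (fun k => S (L1_class f) k * u k) = (fun k => H_pairing f (g k) * u k).
      by apply/funext => k; rewrite SE.
    move=> c; exact: (@cvg_unique _ _ _ _ _ _ ((hU u).2 f) c).
  exact: l1_pairing_continuous.
apply: Hinf_eq => z Dz.
have c1 : series (fun n => unit_seq R j n * g n z) @ \oo --> g j z.
  apply: cvg_near_cst; exists j.+1 => // n /= jn; rewrite /series /=.
  rewrite (big_cat_nat (n := j.+1))//= big_nat_recr//= eqxx mul1r.
  rewrite big_nat_cond big1 ?add0r; last first.
    by move=> k /andP[/andP[_ kj] _]; rewrite ltn_eqF// mul0r.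
  rewrite big_nat_cond big1 ?addr0// => k /andP[/andP[jk _] _].
  by rewrite gtn_eqF// mul0r.
exact: (@cvg_unique _ _ _ _ _ _ (cU _ z Dz) c1).
Qed.

Variables (g : nat -> Hinf R) (U : {linear linf R -> Hinf R}).
Hypotheses (cU : weakstar_continuous U) (Ug : forall j, U (unit_seq R j) = g j).

(** [weakstar_continuous_series] with [f] the Poisson kernel at [z]. *)
Lemma weakstar_map_series u z : D z -> series (fun n => u n * g n z) @ \oo --> U u z.
Proof.
move=> Dz; have [f _ fz] := poisson_evaluation Dz.
have := @weakstar_continuous_series R U g f u cU Ug; rewrite fz.
by under eq_fun do rewrite fz mulrC.
Qed.

Lemma weakstar_map_finite : (sup_sum D g < +oo)%E.
Proof.
have [K hK] := bounded_of_linf_sums weakstar_map_series.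
apply: (@le_lt_trans _ _ K%:E); last exact: ltry.
by apply/sup_sum_leP => z Dz n; rewrite lee_fin; exact: hK.
Qed.

(** The upper bound is the triangle inequality; the phases at [z] form a vector of norm at most 1
    whose image at [z] is the full sum there. *)
Lemma weakstar_map_norm : op_norm (@linf_norm R) (@Hinf_norm R) U = sup_sum D g.
Proof.
apply/eqP; rewrite eq_le; apply/andP; split.
  have E := sup_sum_fine (@disk_nonempty R) weakstar_map_finite; rewrite E.
  apply: ge_ereal_sup => _ [u u1 <-]; apply: ge_ereal_sup => _ [z Dz <-].
  rewrite lee_fin; apply: (normc_cvg_le (@weakstar_map_series u z Dz)) => n.
  apply: le_trans (normc_sum_le _ _) _.
  apply: (@le_trans _ _ (\sum_(0 <= k < n) normc (g k z))).
    apply: ler_sum => k _; rewrite normcM ler_piMl ?normc_ge0// -lee_fin.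
    by apply: le_trans u1; apply: ereal_sup_ubound; exists k.
  by rewrite -lee_fin -E; exact: ((sup_sum_leP _ _ _).1 (lexx _) z Dz n).
apply/sup_sum_leP => z Dz n.
have [u u1 cu] := phase_series weakstar_map_series Dz.
apply: (@le_trans _ _ (Hinf_norm (U u))); last by apply: ereal_sup_ubound; exists u.
apply: (@le_trans _ _ (normc (U u z))%:E); last by apply: ereal_sup_ubound; exists z.
rewrite lee_fin; apply: le_trans (ler_Re_normc _); apply: le_trans (ler_norm _).
exact: phase_series_le cu.
Qed.

(** The class of the Poisson kernel at [z] has norm at most 1, and S maps it to the sequence of the
    [g n z], whose l^1 norm is the sum at [z]; the upper bound is [predual_norm_le]. *)
Lemma predual_op_norm (S : L1_H10 R -> l1 R) :
  (forall f n, S (L1_class f) n = H_pairing f (g n)) ->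
  op_norm (@L1_H10_norm R) (@l1_norm R) S = sup_sum D g.
Proof.
move=> SE; have E := sup_sum_fine (@disk_nonempty R) weakstar_map_finite.
have gK z : D z -> forall n, \sum_(0 <= k < n) normc (g k z) <= fine (sup_sum D g).
  by move=> Dz n; rewrite -lee_fin -E; exact: ((sup_sum_leP _ _ _).1 (lexx _) z Dz n).
have K0 : 0 <= fine (sup_sum D g).
  by have [z Dz] := @disk_nonempty R; apply: le_trans (gK z Dz 0%N); rewrite big_nil.
apply/eqP; rewrite eq_le; apply/andP; split.
  rewrite E; apply: ge_ereal_sup => _ [x x1 <-].
  apply: le_trans (predual_norm_le gK SE x) _.
  by rewrite -[leRHS]mule1; apply: lee_wpmul2l; rewrite ?lee_fin.
apply: ge_ereal_sup => _ [z Dz <-]; have [f f1 fz] := poisson_evaluation Dz.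
apply: ereal_sup_ubound; exists (L1_class f).
  by rewrite -f1; apply: ereal_inf_lbound; exists f.
by apply: eq_eseriesr => n _; rewrite SE fz.
Qed.

End WeakStarMap.

(** * The equivalences and the equality of norms *)

Theorem proposition2p3 (R : realType) (g : nat -> Hinf R) :
  let M := sup_sum (@unit_disk R) g in
  let Mtilde (B : set R[i]) := sup_sum B (fun n => ntlim (g n)) in
  let cond_i (T : {linear linf R -> Hinf R}) :=
    weakstar_continuous T /\ forall j, T (unit_seq R j) = g j in
  let cond_ii := (M < +oo)%E in
  let cond_iii (B : set R[i]) := full_ntlim_set g B /\ (Mtilde B < +oo)%E in
  [/\ (exists T, cond_i T) <-> cond_ii,
      cond_ii <-> (exists B, cond_iii B),
      forall T B, cond_i T -> cond_iii B ->
        exists S : {linear L1_H10 R -> l1 R},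
          [/\ bounded_map (@L1_H10_norm R) (@l1_norm R) S,
              forall f n, S (L1_class f) n =
                circle_integral (fun z => f z * ntlim (g n) z),
              is_adjoint S T &
              [/\ M = Mtilde B,
                  Mtilde B = op_norm (@L1_H10_norm R) (@l1_norm R) S &
                  op_norm (@L1_H10_norm R) (@l1_norm R) S =
                  op_norm (@linf_norm R) (@Hinf_norm R) T]] &
      forall G : nat -> R[i] -> R[i],
        (forall n, disk_algebra (G n)) ->
        (forall n z, unit_disk z -> g n z = G n z) ->
        let M1 := sup_sum (@unit_circle R) G in
        (cond_ii <-> (M1 < +oo)%E) /\ ((M1 < +oo)%E -> M1 = M)].

Proof.
move=> M Mtilde cond_i cond_ii cond_iii.
have gKof : cond_ii -> forall z, unit_disk z -> forall n, \sum_(0 <= k < n) normc (g k z) <= fine M.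
  move=> lty z Dz n; rewrite -lee_fin -(sup_sum_fine (@disk_nonempty R) lty).
  exact: ((sup_sum_leP _ _ _).1 (lexx _) z Dz n).
split.
- split=> [[T [cT Tg]]|/gKof gK]; first exact: weakstar_map_finite cT Tg.
  exact: weakstar_map_exists gK.
- split=> [lty|[B [fB ltB]]]; last by rewrite /cond_ii /M (sup_sum_boundary fB).
  have [B fB] := full_ntlim_set_exists g.
  by exists B; split => //; rewrite /Mtilde -(sup_sum_boundary fB).
- move=> T B [cT Tg] [fB _].
  have gK := gKof (weakstar_map_finite cT Tg).
  have [S SE] := predual_map gK; exists S; split.
  + by exists (fine M) => x; exact: (predual_norm_le gK SE).
  + exact: SE.
  + move=> f u; have c1 := @weakstar_continuous_series R T g f u cT Tg.
    have := @l1_pairing_cvg R (S (L1_class f)) u.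
    have -> : (fun k => S (L1_class f) k * u k) = (fun k => H_pairing f (g k) * u k).
      by apply/funext => k; rewrite SE.
    move=> c2; exact: (@cvg_unique _ _ _ _ _ _ c1 c2).
  + rewrite (predual_op_norm cT Tg SE) (weakstar_map_norm cT Tg).
    by rewrite /Mtilde -(sup_sum_boundary fB).
move=> G hG gG M1.
have ntG n z : unit_circle z -> has_ntlim (g n) z (G n z).
  by move=> Tz; apply: disk_algebra_ntlim => // w; exact: gG.
(* For functions in the disk algebra the whole circle is a full set, with the continuous boundary
   values as limits; [sup_sum_boundary] applied to it gives the equality even when both sides are
   infinite. *)
have fT : full_ntlim_set g (@unit_circle R).
  split => //; [exact: measurable_T|exact: circle_measure_T|].
  by move=> z Tz n; exists (G n z); exact: ntG.
have ME : M1 = M.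
  rewrite /M (sup_sum_boundary fT) /M1 /sup_sum; congr ereal_sup.
  apply: eq_imagel => z Tz; apply: eq_eseriesr => n _.
  by rewrite (has_ntlim_ntlim Tz (ntG n z Tz)).
by rewrite /cond_ii ME.
Qed.
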